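(* Let $\ell\in\mathbb{N}$ and let $A=(A_{11},A_{12},A_{22})$ be an elliptic tuple of real $\ell\times\ell$ matrices. For $0<\alpha\le 2\pi$ let $$\Lambda_\alpha:=\{\lambda\in\mathbb{C}:\ \text{there exists } r^\lambda v\neq 0 \text{ solving the model problem for } A \text{ with angle } \alpha \text{ and Dirichlet boundary conditions}\}.$$ Then: - (i) $\Lambda_\alpha\subset\{\lambda\in\mathbb{C}:|\operatorname{Re}\lambda|>1\}$ for $0<\alpha<\pi$; - (ii) $\Lambda_\pi=\mathbb{Z}\setminus\{0\}$; - (iii) $\Lambda_\alpha\subset\{\lambda\in\mathbb{C}:|\operatorname{Re}\lambda|>\tfrac12\}$ for $\pi<\alpha<2\pi$; - (iv) $\Lambda_{2\pi}=\tfrac12\mathbb{Z}\setminus\{0\}$.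
   Context: **Elliptic tuples.** For a triple $A=(A_{11},A_{12},A_{22})$ of symmetric matrices in $\operatorname{Mat}_\ell(\mathbb{R})$ put $A_{21}:=A_{12}$, $L_A(\xi_1,\xi_2):=A_{11}\xi_1^2+2A_{12}\xi_1\xi_2+A_{22}\xi_2^2$ and $L_A(\partial_{x_1},\partial_{x_2}):=\sum_{i,j=1}^2A_{ij}\partial_{x_i}\partial_{x_j}$. $A$ is an *elliptic tuple* if moreover $A_{11},A_{22}$ are positive definite and $\det L_A(\xi)\ne0$ for all $\xi\in\mathbb{R}^2\setminus\{0\}$. **Model problem.** Use polar coordinates $x_1=r\cos\varphi$, $x_2=r\sin\varphi$. For $0<\alpha\le2\pi$ let $\mathcal{K}_\alpha$ be the angle $\{r>0,\ 0\le\varphi\le\alpha\}$ with sides $\Gamma^-=\{\varphi=0\}$, $\Gamma^+=\{\varphi=\alpha\}$ (for $\alpha=2\pi$ the sides are distinguished by the value of $\varphi\in[0,2\pi]$). A solution $r^\lambda v$ ($\lambda\in\mathbb{C}$) of the model problem with Dirichlet boundary conditions is a function $u(r,\varphi)=r^\lambda v(\varphi)$ with $v:[0,\alpha]\to\mathbb{C}^\ell$ smooth such that $L_A(\partial_{x_1},\partial_{x_2})u=0$ on $\mathcal{K}_\alpha$ and $u=0$ on $\Gamma^-$ and on $\Gamma^+$. Equivalently, in terms of $v$ on $[0,\alpha]$: $b_2v''+(\lambda-1)b_1v'+\lambda(\lambda-1)b_0v+\lambda b_2v=0$ and $v(0)=v(\alpha)=0$, where $b_0=A_{11}\cos^2\varphi+A_{22}\sin^2\varphi+2A_{12}\sin\varphi\cos\varphi$,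 $b_1=2(A_{22}-A_{11})\sin\varphi\cos\varphi+2A_{12}(\cos^2\varphi-\sin^2\varphi)$, $b_2=A_{11}\sin^2\varphi+A_{22}\cos^2\varphi-2A_{12}\cos\varphi\sin\varphi$. *)

(* Defs.v *)
From mathcomp Require Import all_boot all_order all_algebra.
From mathcomp Require Import all_classical all_reals all_analysis.
From mathcomp Require Import complex.

Set Implicit Arguments.
Unset Strict Implicit.
Unset Printing Implicit Defensive.

Import Order.TTheory GRing.Theory Num.Theory.
Import numFieldNormedType.Exports.

Local Open Scope classical_set_scope.
Local Open Scope ring_scope.
Local Open Scope complex_scope.

Section EllipticTuples.
Variables (R : realType) (l : nat).

(* The entry A21 := A12 is not stored. *)
Record mx_triple := MxTriple {
  A11 : 'M[R]_l;
  A12 : 'M[R]_l;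
  A22 : 'M[R]_l }.

Definition posdefmx (M : 'M[R]_l) : Prop :=
  forall x : 'cV[R]_l, x != 0 -> 0 < (x^T *m M *m x) ord0 ord0.

Definition symbol (A : mx_triple) (xi1 xi2 : R) : 'M[R]_l :=
  xi1 ^+ 2 *: A11 A + (2 * xi1 * xi2) *: A12 A + xi2 ^+ 2 *: A22 A.

Definition elliptic_tuple (A : mx_triple) : Prop :=
  [/\ [/\ (A11 A)^T = A11 A, (A12 A)^T = A12 A & (A22 A)^T = A22 A],
      posdefmx (A11 A), posdefmx (A22 A) &
      forall xi1 xi2 : R, (xi1, xi2) != (0, 0) -> \det (symbol A xi1 xi2) != 0].

End EllipticTuples.

Section Calculus.
Variables (R : realType) (l : nat).
Local Notation CV := 'cV[R[i]]_l.

(* r^lambda = exp(lambda * ln r), meaningful for r > 0. *)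
Definition cpow (r : R) (lambda : R[i]) : R[i] :=
  let m := expR (complex.Re lambda * ln r) in
  let t := complex.Im lambda * ln r in
  (m * cos t) +i* (m * sin t).

(* R[i] is not a normed module over R in the library, so a C^l-valued function
   of a real variable is differentiated through the real and imaginary parts
   of its components. *)
Definition re_comp (f : R -> CV) (k : 'I_l) (t : R) : R :=
  complex.Re (f t k ord0).
Definition im_comp (f : R -> CV) (k : 'I_l) (t : R) : R :=
  complex.Im (f t k ord0).

Definition cV_derive (f : R -> CV) (t : R) : CV :=
  \col_k (derive1 (re_comp f k) t +i* derive1 (im_comp f k) t).

Definition smooth (f : R -> CV) : Prop :=
  forall (k : 'I_l) (n : nat) (t : R),
    derivable (derive1n n (re_comp f k)) t 1 /\ derivable (derive1n n (im_comp f k)) t 1.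

(* Smoothness on [a, b] up to the endpoints: the restriction to [a, b]
   extends to a smooth function. *)
Definition smooth_on (a b : R) (f : R -> CV) : Prop :=
  exists g : R -> CV,
    smooth g /\ forall t : R, a <= t <= b -> f t = g t.

Definition partial1 (U : R -> R -> CV) (x1 x2 : R) : CV :=
  cV_derive (fun t => U t x2) x1.
Definition partial2 (U : R -> R -> CV) (x1 x2 : R) : CV :=
  cV_derive (fun t => U x1 t) x2.

Definition actmx (M : 'M[R]_l) (w : CV) : CV := map_mx (real_complex R) M *m w.

Definition L_op (A : mx_triple R l) (U : R -> R -> CV) (x1 x2 : R) : CV :=
  actmx (A11 A) (partial1 (partial1 U) x1 x2)
  + actmx (A12 A) (partial1 (partial2 U) x1 x2)
  + actmx (A12 A) (partial2 (partial1 U) x1 x2)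
  + actmx (A22 A) (partial2 (partial2 U) x1 x2).

(* u is given in polar coordinates (r, phi), 0 <= phi <= alpha <= 2 pi. These
   are injective on the open angle r > 0, 0 < phi < alpha, even when
   alpha = 2 pi, so u is there a function U of the Cartesian coordinates. The
   values of U off this open set do not matter. The total derivatives in L_op
   are genuine ones for u = r^lambda v with v smooth, the only functions to
   which this predicate is applied. For such u the equation on the open angle
   extends by continuity to the sides. *)
Definition model_problem (A : mx_triple R l) (alpha : R) (u : R -> R -> CV) :
    Prop :=
  (exists U : R -> R -> CV,
     forall r phi : R, 0 < r -> 0 < phi < alpha ->
       U (r * cos phi) (r * sin phi) = u r phi /\
       L_op A U (r * cos phi) (r * sin phi) = 0)
  /\ (forall r : R, 0 < r -> u r 0 = 0 /\ u r alpha = 0).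

Definition power_fun (lambda : R[i]) (v : R -> CV) (r phi : R) : CV :=
  cpow r lambda *: v phi.

Definition Lambda (A : mx_triple R l) (alpha : R) : set R[i] :=
  [set lambda : R[i] | exists v : R -> CV,
     [/\ smooth_on 0 alpha v,
         exists r phi : R,
           [/\ 0 < r, 0 <= phi <= alpha & power_fun lambda v r phi != 0]
       & model_problem A alpha (power_fun lambda v)]].

End Calculus.

(* Main.v *)
Require Import Defs.
From mathcomp Require Import all_boot all_order all_algebra.
From mathcomp Require Import all_classical all_reals all_analysis.
From mathcomp Require Import perm complex.
From mathcomp Require Import ring lra.

Set Implicit Arguments.
Unset Strict Implicit.
Unset Printing Implicit Defensive.

Import Order.TTheory GRing.Theory Num.Theory.
Import numFieldNormedType.Exports.

Local Open Scope classical_set_scope.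
Local Open Scope ring_scope.
Local Open Scope complex_scope.

(** Ellipticity says that the quadratic matrix polynomial A11 + 2 t A12 + t^2 A22
    has no real eigenvalue.  Its eigenvalues in the upper half plane are those
    of a matrix Z0 with A11 + 2 A12 Z0 + A22 Z0^2 = 0, and the conjugate of Z0
    solves the same equation.  In a suitable basis Z0 becomes a dissipative
    matrix Z, that is Im (x, Z x) > 0 for x <> 0, and the conjugate of Z0 becomes
    the adjoint of Z (dissipative_solvent).  The solutions of L_A u = 0 are then
    sums of functions of x1 + x2 Z and of x1 + x2 adj Z.

    On the ray of angle phi, x1 + x2 Z = r T(phi) with T = cos + sin Z.  For
    lambda <> 0, the function r^lambda v is a solution when lambda v = f - g with
    f' = lambda T' T^-1 f and g' = lambda adj (T' T^-1) g, and the boundary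
    condition is that f = g at 0 (common value c) and at alpha (common value y);
    this is lemma reduction.  Writing s = Re lambda, everything rests on the real
    powers T^s and on two facts about them.  The powers are obtained from the
    binomial series (is_power_exists): up to a constant factor commuting with Z,
    T is e^(i phi) (1 + e^(-2 i phi) G), where G, the Cayley transform of Z, is a
    strict contraction.

    - Im T^s > 0 on ]0, pi[ for 0 < s <= 1 (power_dissipative), because the
      imaginary parts of sin^-s T^s and of sin^-(1-s) T^(1-s) increase as long
      as both are positive (power_mono).
    - For h commuting with Z, the number (g, T^(-2 s) h f) does not depend on phi,
      so that (y, T^(-2 s)(alpha) h y) = (c, h c) (first_order_pairing).

    If alpha < pi, the choice h = T^s(alpha) gives (y, T^-s y) = (c, T^s c), whose
    two sides have imaginary parts of opposite signs when 0 < |s| <= 1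
    (spectrum_convex); the value s = 0 is excluded by first_order_norm.  If
    pi < alpha < 2 pi and 0 < s <= 1/2, the choice
    h = T^(2 s)(alpha) gives (c, T^(2 s) c) = |y|^2, which is impossible because
    T^(2 s)(alpha) = e^(2 i pi s) T^(2 s)(alpha - pi); negative s are similar
    (spectrum_reentrant).  If alpha is pi or 2 pi, then T^-s(alpha) is a scalar
    of modulus 1.  The norms of T^-s f and of its counterpart for g move in
    opposite directions when Im lambda <> 0 (first_order_norm), so lambda is
    real; then c is the image of y under T^-s(alpha) and under its adjoint, and
    e^(2 i s alpha) = 1 (spectrum_unimodular).

    Conversely, when s <> 0 is real and e^(2 i s alpha) = 1 with alpha equal to
    pi or 2 pi, the exponent s is attained by v = T^s c - adj (T^s) c in the same
    basis, since T^s(alpha) is a real scalar (power_wave_Lambda). *)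

(** * Conjugate transpose and sesquilinear form *)

Section Algebra.
Variable R : realType.
Local Notation C := R[i].
Local Notation Re := (@complex.Re R).
Local Notation Im := (@complex.Im R).
Local Notation cc := (@conjc R).
Local Notation cj := (map_mx (@conjc R)).

Definition adj m n (M : 'M[C]_(m, n)) : 'M[C]_(n, m) := (cj M)^T.

Lemma cjV (x : C) : cc x^-1 = (cc x)^-1.
Proof. exact: conjc_inv. Qed.

Lemma cjR (x : R) : cc x%:C = x%:C :> C.
Proof. exact: conjc_real. Qed.

Lemma adjE m n (M : 'M[C]_(m, n)) i j : adj M i j = cc (M j i).
Proof. by rewrite !mxE. Qed.

Lemma cjK m n (M : 'M[C]_(m, n)) : cj (cj M) = M.
Proof. by apply/matrixP=> i j; rewrite !mxE conjcK. Qed.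

Lemma adjK m n (M : 'M[C]_(m, n)) : adj (adj M) = M.
Proof. by apply/matrixP=> i j; rewrite !mxE conjcK. Qed.

Lemma adjM m n p (M : 'M[C]_(m, n)) (N : 'M[C]_(n, p)) :
  adj (M *m N) = adj N *m adj M.
Proof. by rewrite /adj map_mxM trmx_mul. Qed.

Lemma adjD m n (M N : 'M[C]_(m, n)) : adj (M + N) = adj M + adj N.
Proof. by rewrite /adj map_mxD raddfD. Qed.

Lemma adjN m n (M : 'M[C]_(m, n)) : adj (- M) = - adj M.
Proof. by rewrite /adj map_mxN raddfN. Qed.

Lemma adjB m n (M N : 'M[C]_(m, n)) : adj (M - N) = adj M - adj N.
Proof. by rewrite adjD adjN. Qed.

Lemma adjZ m n a (M : 'M[C]_(m, n)) : adj (a *: M) = cc a *: adj M.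
Proof. by apply/matrixP=> i j; rewrite !mxE rmorphM. Qed.

Lemma adj1 n : adj (1%:M : 'M[C]_n) = 1%:M.
Proof. by rewrite /adj map_mx1 trmx1. Qed.

Lemma adj0 m n : adj (0 : 'M[C]_(m, n)) = 0.
Proof. by rewrite /adj map_mx0 trmx0. Qed.

Lemma adj_unit n (M : 'M[C]_n) : (adj M \in unitmx) = (M \in unitmx).
Proof. by rewrite /adj unitmx_tr map_unitmx. Qed.

Lemma adj_inv n (M : 'M[C]_n) : adj (invmx M) = invmx (adj M).
Proof. by rewrite /adj map_invmx trmx_inv. Qed.

Definition dot n (x y : 'cV[C]_n) : C := (adj x *m y) 0 0.

Lemma dotE n (x y : 'cV[C]_n) : dot x y = \sum_i cc (x i 0) * y i 0.
Proof. by rewrite /dot !mxE; apply: eq_bigr => i _; rewrite !mxE. Qed.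

Lemma dotDl n (x y z : 'cV[C]_n) : dot (x + y) z = dot x z + dot y z.
Proof. by rewrite /dot adjD mulmxDl mxE. Qed.

Lemma dotDr n (x y z : 'cV[C]_n) : dot x (y + z) = dot x y + dot x z.
Proof. by rewrite /dot mulmxDr mxE. Qed.

Lemma dotZl n a (x y : 'cV[C]_n) : dot (a *: x) y = cc a * dot x y.
Proof. by rewrite /dot adjZ -scalemxAl mxE. Qed.

Lemma dotZr n a (x y : 'cV[C]_n) : dot x (a *: y) = a * dot x y.
Proof. by rewrite /dot -scalemxAr mxE. Qed.

Lemma dotNr n (x y : 'cV[C]_n) : dot x (- y) = - dot x y.
Proof. by rewrite -scaleN1r dotZr mulN1r. Qed.

Lemma dotNl n (x y : 'cV[C]_n) : dot (- x) y = - dot x y.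
Proof. by rewrite /dot adjN mulNmx mxE. Qed.

Lemma dotBr n (x y z : 'cV[C]_n) : dot x (y - z) = dot x y - dot x z.
Proof. by rewrite dotDr dotNr. Qed.

Lemma dot0r n (x : 'cV[C]_n) : dot x 0 = 0.
Proof. by rewrite /dot mulmx0 mxE. Qed.

Lemma dot0l n (x : 'cV[C]_n) : dot 0 x = 0.
Proof. by rewrite /dot adj0 mul0mx mxE. Qed.

Lemma dotMl m n (M : 'M[C]_(m, n)) x y : dot (M *m x) y = dot x (adj M *m y).
Proof. by rewrite /dot adjM mulmxA. Qed.

Lemma dotMr m n (M : 'M[C]_(m, n)) x y : dot x (M *m y) = dot (adj M *m x) y.
Proof. by rewrite dotMl adjK. Qed.

Lemma dotC n (x y : 'cV[C]_n) : dot y x = cc (dot x y).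
Proof.
rewrite !dotE rmorph_sum; apply: eq_bigr => i _.
by rewrite rmorphM /= conjcK mulrC.
Qed.

Lemma Im_dotxx n (x : 'cV[C]_n) : Im (dot x x) = 0.
Proof. by have := dotC x x; case: (dot x x) => a b /= [] h; lra. Qed.

Lemma Re_sum I (r : seq I) (F : I -> C) : Re (\sum_(i <- r) F i) = \sum_(i <- r) Re (F i).
Proof. by apply: (big_morph Re) => // -[a b] [c d]. Qed.

Lemma Im_sum I (r : seq I) (F : I -> C) : Im (\sum_(i <- r) F i) = \sum_(i <- r) Im (F i).
Proof. by apply: (big_morph Im) => // -[a b] [c d]. Qed.

Lemma dot_ge0 n (x : 'cV[C]_n) : 0 <= Re (dot x x).
Proof.
rewrite dotE Re_sum sumr_ge0 // => i _.
by case: (x i 0) => a b /=; rewrite -!expr2 mulNr opprK -expr2 addr_ge0 ?sqr_ge0.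
Qed.

Lemma dot_gt0 n (x : 'cV[C]_n) : x != 0 -> 0 < Re (dot x x).
Proof.
move=> x0; rewrite lt_neqAle dot_ge0 andbT eq_sym; apply: contra x0 => /eqP.
rewrite dotE Re_sum => /eqP; rewrite psumr_eq0; last first.
  move=> i _.
  by case: (x i 0) => a b /=; rewrite mulNr opprK -!expr2 addr_ge0 ?sqr_ge0.
move=> /allP h; apply/eqP/colP => i; rewrite mxE.
have := h i (mem_index_enum _); case: (x i 0) => a b /=.
rewrite mulNr opprK -!expr2 paddr_eq0 ?sqr_ge0 // !sqrf_eq0 => /andP[/eqP-> /eqP->].
by [].
Qed.

Lemma dotxxE n (x : 'cV[C]_n) : dot x x = (Re (dot x x))%:C.
Proof. by have := Im_dotxx x; case: (dot x x) => a b /= ->. Qed.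

(** The imaginary part (Z - adj Z) / 2i is positive definite. *)
Definition dissipative n (Z : 'M[C]_n) : Prop :=
  forall x : 'cV[C]_n, x != 0 -> 0 < Im (dot x (Z *m x)).

Lemma unitmx_ker n (M : 'M[C]_n) :
  (forall x : 'cV[C]_n, M *m x = 0 -> x = 0) -> M \in unitmx.
Proof.
move=> h; rewrite -unitmx_tr -row_free_unit -kermx_eq0; apply/eqP/row_matrixP => i.
rewrite row0; apply: trmx_inj; rewrite trmx0; apply: h; apply: trmx_inj.
by rewrite trmx_mul trmxK trmx0 -row_mul mulmx_ker row0.
Qed.

Lemma unitmx_inj n (M : 'M[C]_n) (x : 'cV[C]_n) :
  M \in unitmx -> M *m x = 0 -> x = 0.
Proof. by move=> u h; rewrite -[x](mulKmx u) h mulmx0. Qed.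

End Algebra.

(** * A Lyapunov lemma *)

Section Lyapunov.
Variable R : realType.
Local Notation C := R[i].
Local Notation Re := (@complex.Re R).
Local Notation Im := (@complex.Im R).
Local Notation cc := (@conjc R).

Lemma Im_realM (a b : C) : Im b = 0 -> Im (a * b) = Im a * Re b.
Proof. by case: a b => [a1 a2] [b1 b2] /= ->; ring. Qed.

Lemma exists_unit_firstcol n (x : 'cV[C]_(1 + n)) : x != 0 ->
  exists2 S : 'M[C]_(1 + n), S \in unitmx & exists2 k, k != 0 & col 0 S = k *: x.
Proof.
move=> x0.
have r1 : \rank x^T = 1%N.
  apply/eqP; rewrite eqn_leq rank_leq_row lt0n mxrank_eq0.
  by rewrite -(trmx0 C) (inj_eq (@trmx_inj _ _ _)).
exists (row_ebase x^T)^T; first by rewrite unitmx_tr row_ebase_unit.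
have /= := mulmx_ebase x^T; rewrite r1 => e.
have cu := col_ebase_unit x^T.
set c := col_ebase x^T in cu e *.
have c0 : c 0 0 != 0.
  by move: cu; rewrite unitmxE det_mx11 unitfE.
exists (c 0 0)^-1; first by rewrite invr_eq0.
have ex i : x i 0 = c 0 0 * row_ebase x^T 0 i.
  move/matrixP: (e) => /(_ 0 i); rewrite [RHS]mxE => <-.
  rewrite !mxE big_ord_recl big1 => [|j _]; last first.
    by rewrite !mxE big_ord_recl big_ord0 !mxE /= mulr0 addr0 mul0r.
  by rewrite !mxE big_ord_recl big_ord0 !mxE /= mulr1 !addr0.
by apply/colP => i; rewrite !mxE ex mulKf.
Qed.

Lemma gram_entry m n (S : 'M[C]_(n, m)) (M : 'M[C]_n) i j :
  (adj S *m M *m S) i j = dot (col i S) (M *m col j S).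
Proof.
have -> : adj S *m M *m S = adj S *m (M *m S) by rewrite mulmxA.
have -> : M *m col j S = col j (M *m S) by rewrite !colE mulmxA.
rewrite /dot; have -> : adj (col i S) = row i (adj S).
  by apply/matrixP=> p q; rewrite !mxE.
by rewrite -row_mul [LHS]mxE [RHS]mxE [RHS]mxE; apply: eq_bigr => k _; rewrite !mxE.
Qed.

(** If Im (Y Z) > 0 and Z has its spectrum in the upper half plane, the Hermitian
    matrix Y is positive definite.  Positivity is expressed by a factorization
    because it serves to change the basis. *)
Definition lyapunov_at n := forall Z Y : 'M[C]_n, adj Y = Y -> dissipative (Y *m Z) ->
  (forall (x : 'cV[C]_n) z, x != 0 -> Z *m x = z *: x -> 0 < Im z) ->
  exists2 S : 'M[C]_n, S \in unitmx & adj S *m Y *m S = 1%:M.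

(** For an eigenvector x of Z, Z x = a x, the number (x, Y x) is real and
    Im (x, Y Z x) = Im a (x, Y x), whence (x, Y x) > 0.  In a basis starting with
    x and otherwise Y-orthogonal to x, the matrix Y is block diagonal and Z is
    block upper triangular, and the lower right blocks inherit the hypotheses. *)
Lemma lyapunov_step n : lyapunov_at n -> lyapunov_at (1 + n).
Proof.
move=> IH Z Y hY hZ heig.
have [a] := eigenvalue_closed Z^T (ltn0Sn n : (0 < 1 + n)%N).
move=> /eigenvalueP[w /(congr1 trmx)]; rewrite trmx_mul trmxK linearZ /= => hw w0.
have wT0 : w^T != 0 by rewrite -(trmx0 C) (inj_eq (@trmx_inj _ _ _)).
have [S Su [k k0 Sx]] := @exists_unit_firstcol n w^T wT0.
set x := w^T in hw wT0 Sx.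
have xp : 0 < Re (dot x (Y *m x)).
  have h := hZ x wT0; have hi := heig x a wT0 hw.
  move: h; rewrite -mulmxA hw -scalemxAr dotZr Im_realM ?pmulr_rgt0 //.
  by have := dotC x (Y *m x); rewrite dotMl hY; case: (dot x _) => p q /= [] *; lra.
have xr : dot x (Y *m x) = (Re (dot x (Y *m x)))%:C.
  by have := dotC x (Y *m x); rewrite dotMl hY; case: (dot x _) => p q /= [] q0;
    apply/eqP; rewrite eq_complex /= eqxx /=; apply/eqP; lra.
pose Y1 : 'M[C]_(1 + n) := adj S *m Y *m S.
have hY1 : adj Y1 = Y1 by rewrite /Y1 !adjM adjK hY mulmxA.
pose y0 := Re (cc k * k * dot x (Y *m x)).
have y0p : 0 < y0.
  rewrite /y0 xr -complexr0; case: (k) k0 => p q; rewrite eq_complex /= negb_and => h.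
  have : 0 < p ^+ 2 + q ^+ 2.
    by case/orP: h => h; [apply: ltr_pwDl|apply: ltr_wpDl];
      rewrite ?sqr_ge0 // lt_neqAle sqr_ge0 eq_sym sqrf_eq0 h.
  by move=> h2; rewrite mulr0 subr0 mulNr opprK -!expr2 mulr_gt0.
have ey : ulsubmx Y1 = y0%:C%:M.
  apply/matrixP => i j; rewrite !ord1 [LHS]mxE [LHS]mxE.
  have -> : lshift n (0 : 'I_1) = 0 by apply/val_inj.
  rewrite gram_entry Sx -scalemxAr dotZl dotZr !mulrA xr /y0 xr.
  case: (k) => p q; apply/eqP; rewrite eq_complex !mxE /=; apply/andP; split; apply/eqP; ring.
pose u := ursubmx Y1; pose d := dlsubmx Y1; pose D := drsubmx Y1.
have eY1 : Y1 = block_mx y0%:C%:M u d D by rewrite -ey submxK.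
have ud : adj u = d.
  by apply/matrixP => i j; rewrite /u /d -[in RHS]hY1 !mxE.
have yc0 : y0%:C != 0 by rewrite eq_complex /= eqxx andbT gt_eqF.
(* U clears the first row and column of Y1, leaving a Schur complement. *)
pose U : 'M[C]_(1 + n) := block_mx 1%:M (- (y0%:C^-1 *: u)) 0 1%:M.
have Uu : U \in unitmx by rewrite unitmxE det_ublock !det1 mulr1 unitr1.
pose Y2 := D - y0%:C^-1 *: (d *m u).
have eY2 : adj U *m Y1 *m U = block_mx y0%:C%:M 0 0 Y2.
  have -> : adj U = block_mx 1%:M 0 (- (y0%:C^-1 *: d)) 1%:M.
    rewrite /adj /U map_block_mx tr_block_mx !map_mx1 !trmx1 map_mx0 trmx0.
    by congr block_mx; rewrite -[LHS]/(adj (- (y0%:C^-1 *: u))) adjN adjZ ud cjV cjR.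
  have e1 : y0%:C%:M *m - (y0%:C^-1 *: u) + u = 0.
    by rewrite mulmxN mul_scalar_mx scalerA mulfV // scale1r addNr.
  have e2 : - (y0%:C^-1 *: d) *m y0%:C%:M + d = 0.
    by rewrite mulNmx -scalemxAl mul_mx_scalar scalerA mulVf // scale1r addNr.
  rewrite eY1 /U !mulmx_block !mul1mx !mul0mx !addr0 !mulmx1 e1 e2.
  by rewrite !mul0mx !mulmx0 !addr0 add0r mulNmx -scalemxAl addrC.
pose S2 := S *m U.
have S2u : S2 \in unitmx by rewrite unitmx_mul Su.
have o0 : 0 = lshift n 0 :> 'I_(1 + n) by apply/val_inj.
have S2x : col 0 S2 = k *: x.
  rewrite /S2 colE -mulmxA -colE.
  have -> : col 0 U = col 0 1%:M.
    apply/colP => i; rewrite [LHS]mxE [RHS]mxE o0 /U.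
    case: (split_ordP i) => j ->; rewrite [RHS]mxE.
      by apply: (etrans (block_mxEul _ _ _ _ _ _)); rewrite !ord1 mxE.
    by apply: (etrans (block_mxEdl _ _ _ _ _ _)); rewrite mxE.
  by rewrite colE mul1mx -colE.
have eS2 : adj S2 *m Y *m S2 = block_mx y0%:C%:M 0 0 Y2.
  by rewrite -eY2 /S2 /Y1 adjM !mulmxA.
pose Z2 : 'M[C]_(1 + n) := invmx S2 *m Z *m S2.
have SZ : S2 *m Z2 = (Z : 'M[C]_(1 + n)) *m S2 by rewrite /Z2 !mulmxA mulmxV // mul1mx.
clearbody Z2 S2.
have cZ2 : col 0 Z2 = a *: col 0 1%:M.
  apply: (can_inj (mulKmx S2u)); rewrite -scalemxAr !colE mul1mx mulmxA SZ -mulmxA -!colE S2x.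
  by rewrite -scalemxAr hw !scalerA mulrC.
pose r := ursubmx Z2; pose Z1 := drsubmx Z2.
have eZ2 : Z2 = block_mx a%:M r 0 Z1.
  have h (i : 'I_(1 + n)) : Z2 i (lshift n 0) = a * (i == lshift n 0)%:R.
    by have /colP/(_ i) := cZ2; rewrite !mxE o0.
  rewrite -[LHS]submxK; congr block_mx; apply/matrixP => i j;
    rewrite !ord1 [LHS]mxE [LHS]mxE [RHS]mxE; apply: (etrans (h _)).
    by rewrite eqxx mulr1.
  by rewrite eq_rlshift mulr0.
have YZ w1 : adj S2 *m (Y *m Z) *m (S2 *m w1) = block_mx y0%:C%:M 0 0 Y2 *m (Z2 *m w1).
  have h2 : Z *m (S2 *m w1) = S2 *m (Z2 *m w1) by rewrite mulmxA -SZ mulmxA.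
  by rewrite -eS2 -!mulmxA h2.
have S2i (w1 : 'cV_(1 + n)) : w1 != 0 -> S2 *m w1 != 0.
  by apply: contra => /eqP /(unitmx_inj S2u) ->.
have c0 (t : 'cV[C]_1) (w1 : 'cV_n) : w1 != 0 -> col_mx t w1 != 0 :> 'cV_(1 + n).
  by rewrite col_mx_eq0 negb_and orbC => ->.
have hY2 : adj Y2 = Y2.
  have : adj (adj S2 *m Y *m S2) = adj S2 *m Y *m S2 by rewrite !adjM adjK hY mulmxA.
  rewrite eS2 /adj map_block_mx tr_block_mx => /(congr1 drsubmx).
  by rewrite !block_mxKdr.
have [S1 S1u S1e] : exists2 S1 : 'M[C]_n, S1 \in unitmx & adj S1 *m Y2 *m S1 = 1%:M.
  apply: (IH Z1 Y2 hY2).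
    move=> w1 w10; have := hZ _ (S2i _ (c0 0 _ w10)).
    rewrite dotMl mulmxA YZ eZ2 !mul_block_col !mul0mx !mulmx0 !add0r mulmxA.
    rewrite /dot /adj map_col_mx tr_col_mx mul_row_col map_mx0 trmx0 mul0mx add0r.
    by rewrite -(mulmxA Y2).
  move=> w1 z w10 hw1; have [->|za] := eqVneq z a; first exact: heig wT0 hw.
  (* an eigenvector of the lower block Z1, for an eigenvalue z other than a,
     extends to an eigenvector of the block triangular matrix Z2 *)
  apply: (heig (S2 *m col_mx ((z - a)^-1 *: (r *m w1)) w1)); first exact/S2i/c0.
  rewrite mulmxA -SZ -mulmxA [RHS]scalemxAr; congr (_ *m _).
  rewrite eZ2 mul_block_col mul0mx add0r hw1 scale_col_mx; congr col_mx.
  rewrite mul_scalar_mx scalerA -{2}[r *m w1]scale1r -scalerDl scalerA; congr (_ *: _).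
  by field; rewrite subr_eq0.
pose q : C := ((Num.sqrt y0)^-1)%:C.
have q0 : q != 0.
  by rewrite eq_complex /= eqxx andbT invr_eq0 sqrtr_eq0 -ltNge.
pose V : 'M[C]_(1 + n) := block_mx q%:M 0 0 S1.
exists (S2 *m V).
  rewrite unitmx_mul S2u unitmxE det_ublock unitrM -!unitmxE S1u andbT unitmxE.
  by rewrite det_scalar1 unitfE.
rewrite adjM; have -> : adj V *m adj S2 *m Y *m (S2 *m V) = adj V *m (adj S2 *m Y *m S2) *m V.
  by rewrite !mulmxA.
have -> : adj V = block_mx q%:M 0 0 (adj S1).
  rewrite /adj map_block_mx tr_block_mx !map_mx0 !trmx0 map_scalar_mx tr_scalar_mx.
  by congr (block_mx _%:M _ _ _); exact: cjR.
rewrite eS2 /V !mulmx_block !(mulmx0, mul0mx, addr0, add0r) S1e.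
rewrite scalar_mx_block -!scalar_mxM; congr (block_mx _%:M _ _ _).
rewrite /q -!rmorphM /= -[RHS]/(1%:C); congr (_%:C).
by rewrite -{2}(sqr_sqrtr (ltW y0p)) expr2 mulKf ?mulfV // gt_eqF ?sqrtr_gt0.
Qed.

Lemma lyapunov n : lyapunov_at n.
Proof.
elim: n => [|n IH]; last exact: lyapunov_step.
by move=> Z Y _ _ _; exists 1%:M; rewrite ?unitmx1 //; apply/matrixP => -[].
Qed.
End Lyapunov.

(** * A dissipative solvent of the quadratic matrix equation *)

Section Solvent.
Variable R : realType.
Local Notation C := R[i].
Local Notation Re := (@complex.Re R).
Local Notation Im := (@complex.Im R).
Local Notation cc := (@conjc R).
Local Notation cj := (map_mx (@conjc R)).

Lemma root_prodXsubC (r : seq C) (P : pred C) z :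
  root (\prod_(x <- r | P x) ('X - x%:P)) z -> P z && (z \in r).
Proof.
by rewrite -big_filter root_prod_XsubC mem_filter.
Qed.

Lemma Im_conj (z : C) : Im (cc z) = - Im z.
Proof. by case: z. Qed.

(** Conjugation exchanges the generalized eigenspaces of the upper and of the
    lower half plane.  Each is disjoint from its conjugate, so neither exceeds
    half of the dimension, and together they span the space. *)
Lemma half_spectrum k (g : 'M[C]_(k.+1 + k.+1)) : cj g = g ->
  (forall z, eigenvalue g z -> Im z != 0) ->
  exists2 p : {poly C}, (forall z, root p z -> 0 < Im z)
    & \rank (kermxpoly g p) = k.+1.
Proof.
move=> gr nor.
have [r er] := closed_field_poly_normal (char_poly g).
rewrite (monicP (char_poly_monic g)) scale1r in er.
have rI z : z \in r -> Im z != 0.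
  by move=> zr; apply: nor; rewrite eigenvalue_root_char er root_prod_XsubC.
pose p := \prod_(x <- r | 0 < Im x) ('X - x%:P).
pose q := \prod_(x <- r | ~~ (0 < Im x)) ('X - x%:P).
have rp z : root p z -> 0 < Im z by move/root_prodXsubC/andP => [].
have rq z : root q z -> Im z < 0.
  move/root_prodXsubC/andP => [h /rI]; rewrite -leNgt in h.
  by rewrite lt_neqAle h andbT.
have copq : coprimep p q.
  by apply/Pdiv.ClosedField.coprimepP => x /rp h; apply/negP => /rq; rewrite ltNge ltW.
have rcj (f : {poly C}) z : root (map_poly cc f) z -> root f (cc z).
  by rewrite -{1}[z]conjcK fmorph_root.
have full : (\rank (kermxpoly g p) + \rank (kermxpoly g q) >= k.+1 + k.+1)%N.
  apply: leq_trans (mxrank_adds_leqif _ _).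
  have epq : p * q = char_poly g.
    by rewrite er /p /q [RHS](bigID (fun x => 0 < Im x)).
  rewrite -(kermxpolyM g copq) epq.
  by rewrite (kermxpoly_min (mxminpoly_dvd_char g)) mxrank1.
have half (f : {poly C}) : (forall z, root f z -> forall w, root f w -> z != cc w) ->
    (\rank (kermxpoly g f) + \rank (kermxpoly g f) <= k.+1 + k.+1)%N.
  move=> h.
  have cof : coprimep f (map_poly cc f).
    apply/Pdiv.ClosedField.coprimepP => x hx; apply/negP => /rcj /(h _ hx).
    by rewrite conjcK eqxx.
  have e : \rank (kermxpoly g (map_poly cc f)) = \rank (kermxpoly g f).
    by rewrite -{1}gr -map_kermxpoly mxrank_map.
  have d := mxrank_disjoint_sum (mxdirect_kermxpoly g cof).
  exact: leq_trans (eq_leq (etrans (congr1 (addn _) (esym e)) (esym d))) (rank_leq_col _).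
exists p => //.
have h1 := half p; have h2 := half q.
have {}h1 : (\rank (kermxpoly g p) + \rank (kermxpoly g p) <= k.+1 + k.+1)%N.
  by apply: h1 => z /rp hz w /rp hw; apply: contraTneq hz => ->; rewrite Im_conj oppr_gt0 -leNgt ltW.
have {}h2 : (\rank (kermxpoly g q) + \rank (kermxpoly g q) <= k.+1 + k.+1)%N.
  by apply: h2 => z /rq hz w /rq hw; apply: contraTneq hz => ->; rewrite Im_conj oppr_lt0 -leNgt ltW.
suff halves (a b N : nat) : (N + N <= a + b)%N -> (a + a <= N + N)%N -> (b + b <= N + N)%N -> a = N.
  exact: halves full h1 h2.
rewrite !addnn !leq_double => h a1 b1; apply/eqP; rewrite eqn_leq a1 /=.
by rewrite leqNgt; apply/negP => h3; move: h; rewrite leqNgt -addnn -addSn leq_add.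
Qed.

Section Factor.
Variables (k : nat) (A B P : 'M[C]_k.+1).
Hypotheses (rA : cj A = A) (rB : cj B = B) (rP : cj P = P).
Hypotheses (sA : A^T = A) (sB : B^T = B) (sP : P^T = P).
Hypothesis Ppos : forall x : 'cV[C]_k.+1, x != 0 -> 0 < Re (dot x (P *m x)).
Hypothesis ell : forall z : C, Im z = 0 -> A + z *: B + z ^+ 2 *: P \in unitmx.

Let Pu : P \in unitmx.
Proof.
apply: unitmx_ker => x Px; apply/eqP; apply: contraT => /Ppos.
by rewrite Px dot0r /= ltxx.
Qed.

(* Companion matrix of A + z B + z^2 P, acting on rows: an eigenvector has the
   form (a, z a) with a (A + z B + z^2 P) = 0.  It is symmetric with respect to
   the bilinear form F. *)
Let g : 'M[C]_(k.+1 + k.+1) := block_mx 0 (- (A *m invmx P)) 1%:M (- (B *m invmx P)).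
Let F : 'M[C]_(k.+1 + k.+1) := block_mx B P P 0.

Let gr : cj g = g.
Proof.
have rM (M : 'M[C]_k.+1) : cj M = M -> cj (- (M *m invmx P)) = - (M *m invmx P).
  by move=> h; rewrite map_mxN map_mxM h map_invmx rP.
by rewrite /g map_block_mx map_mx0 map_mx1 !rM.
Qed.

Let gF : g *m F = F *m g^T.
Proof.
rewrite /g /F tr_block_mx !mulmx_block !raddfN /= !trmx_mul trmx_inv sP sA sB trmx0 trmx1.
rewrite !(mul0mx, mulmx0, add0r, addr0, mulmx1, mul1mx, mulNmx, mulmxN).
by rewrite !mulmxKV // !mulKVmx // !subrr oppr0 addr0.
Qed.

Let geig (x : 'rV[C]_(k.+1 + k.+1)) z : x *m g = z *: x -> x != 0 ->
  lsubmx x *m (A + z *: B + z ^+ 2 *: P) = 0 /\ lsubmx x != 0.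
Proof.
move: (lsubmx x) (rsubmx x) (hsubmxK x) => a b <- {x}.
rewrite mul_row_block scale_row_mx => /eq_row_mx[].
rewrite mulmx0 add0r mulmx1 => -> e x0; split.
  move: e => /(congr1 (mulmx^~ P)); rewrite mulmxDl !mulmxN !mulNmx !mulmxA !mulmxKV //.
  rewrite !mulmxDr -!scalemxAr -!scalemxAl scalerA -expr2 => <-.
  by rewrite -opprD subrr.
by apply: contraNneq x0 => ->; rewrite scaler0 row_mx0.
Qed.

Let nor z : eigenvalue g z -> Im z != 0.
Proof.
move=> /eigenvalueP[v hv v0]; apply/eqP => z0; have [e] := geig hv v0.
by rewrite -[lsubmx v](mulmxK (ell z0)) e mul0mx eqxx.
Qed.

Lemma unitmx_kerl n (M : 'M[C]_n) :
  (forall x : 'rV[C]_n, x *m M = 0 -> x = 0) -> M \in unitmx.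
Proof.
move=> h; rewrite -unitmx_tr; apply: unitmx_ker => x e.
apply: trmx_inj; rewrite trmx0; apply: h; apply: trmx_inj.
by rewrite trmx_mul trmxK e trmx0.
Qed.

Let hornerF p : horner_mx g p *m F = F *m (horner_mx g p)^T.
Proof.
elim/poly_ind: p => [|p c IH]; first by rewrite rmorph0 trmx0 mul0mx mulmx0.
rewrite rmorphD rmorphM /= horner_mx_X horner_mx_C raddfD /= mulmxDl mulmxDr.
rewrite tr_scalar_mx scalar_mxC; congr (_ + _).
rewrite -[_ * _]/(_ *m _) -mulmxA gF mulmxA IH -mulmxA -trmx_mul.
congr (_ *m _^T); apply: (@comm_mx_horner _ _ _ _ p); exact: comm_mx_refl.
Qed.

Lemma eigen_horner (y : 'rV[C]_(k.+1 + k.+1)) z f : y *m g = z *: y ->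
  y *m horner_mx g f = f.[z] *: y.
Proof.
move=> yg; elim/poly_ind: f => [|f c IH]; first by rewrite rmorph0 mulmx0 horner0 scale0r.
rewrite rmorphD rmorphM /= horner_mx_X horner_mx_C mulmxDr -[_ * g]/(_ *m g) mulmxA IH.
by rewrite -scalemxAl yg scalerA mul_mx_scalar !hornerE scalerDl.
Qed.

(** The spectral subspace N of g for the upper half plane is isotropic for
    x F adj(y), because g is F-symmetric and p is coprime to its conjugate.  A
    vector (0, b) of N paired with its image under g yields b P adj(b) = 0, so
    b = 0: N is the graph of a matrix Zt, and its invariance under g is the
    quadratic equation. *)
Lemma solvent_rows : exists Zt : 'M[C]_k.+1,
  [/\ A + Zt *m B + Zt *m Zt *m P = 0,
      B + Zt *m P + P *m adj Zt = 0,
      (forall (x : 'rV[C]_k.+1) z, x != 0 -> x *m Zt = z *: x -> 0 < Im z) &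
      (forall x : 'rV[C]_k.+1, x *m Zt = x *m cj Zt -> x = 0)].
Proof.
have [p rp rk] := half_spectrum gr nor.
have [N eN] : exists N : 'M[C]_(k.+1, k.+1 + k.+1), (N :=: kermxpoly g p)%MS.
  by move: (row_base (kermxpoly g p)) (eq_row_base (kermxpoly g p)); rewrite rk => N; exists N.
have rN : row_free N by rewrite /row_free eN rk.
have Np : N *m horner_mx g p = 0.
  by apply/sub_kermxP; rewrite eN submx_refl.
have rcj (f : {poly C}) z : root (map_poly cc f) z -> root f (cc z).
  by rewrite -{1}[z]conjcK fmorph_root.
set q := map_poly cc p.
have cof : coprimep p q.
  apply/Pdiv.ClosedField.coprimepP => x /rp hx; apply/negP => /rcj /rp.
  by rewrite Im_conj oppr_gt0 ltNge ltW.
have pcj : cj (horner_mx g q) = horner_mx g p.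
  rewrite map_horner_mx; congr horner_mx; first exact: gr.
  by apply/polyP => i; rewrite !coef_map /= conjcK.
have [[u w] /= uw] := Bezout_eq1_coprimepP _ _ cof.
have NX : N = (N *m horner_mx g w) *m horner_mx g q.
  have := congr1 (fun f => N *m horner_mx g f) uw.
  rewrite (mulrC u) rmorph1 mulmx1 rmorphD !rmorphM /= => e; rewrite -[LHS]e.
  by rewrite mulmxDr -![_ * _]/(_ *m _) !mulmxA Np mul0mx add0r.
have iso : N *m F *m adj N = 0.
  rewrite {2}NX adjM {1}/adj pcj -mulmxA (mulmxA F) -hornerF !mulmxA Np.
  by rewrite !mul0mx.
have [K eK] : exists K, N *m g = K *m N.
  apply/submxP; rewrite eN (eqmxMr _ eN).
  exact: comm_mx_stable_kermxpoly.
have N1u : lsubmx N \in unitmx.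
  apply: unitmx_kerl => c cN1.
  have cN : c *m N = row_mx 0 (c *m rsubmx N) by rewrite -{1}[N]hsubmxK mul_mx_row cN1.
  set b := c *m rsubmx N in cN.
  have cNg : c *m N *m g = row_mx b (- (b *m (B *m invmx P))).
    by rewrite cN mul_row_block !mul0mx mulmx1 !add0r mulmxN.
  have h : b *m P *m adj b = 0.
    have : c *m N *m F *m adj (c *m N *m g) = 0.
      rewrite -(mulmxA c N g) eK !adjM !mulmxA -(mulmxA c N F) -(mulmxA c) iso.
      by rewrite mulmx0 !mul0mx.
    rewrite cNg cN mul_row_block !mul0mx !mulmx0 !add0r /adj map_row_mx tr_row_mx.
    by rewrite mul_row_col mul0mx addr0.
  have b0 : b = 0.
    apply/eqP; apply: contraT => bn0.
    have an0 : adj b != 0 by apply: contra bn0 => /eqP e; rewrite -[b]adjK e adj0.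
    by have := Ppos an0; rewrite /dot adjK mulmxA h mxE ltxx.
  by apply: (row_free_inj rN); rewrite cN b0 row_mx0 mul0mx.
pose Zt := invmx (lsubmx N) *m rsubmx N.
have eM : row_mx 1%:M Zt = invmx (lsubmx N) *m N.
  by rewrite -{2}[N]hsubmxK mul_mx_row mulVmx.
have Mg : exists K1, row_mx 1%:M Zt *m g = K1 *m row_mx 1%:M Zt.
  exists (invmx (lsubmx N) *m K *m lsubmx N).
  by rewrite eM mulmxA mulmxK // -!mulmxA eK.
have Miso : row_mx 1%:M Zt *m F *m adj (row_mx 1%:M Zt) = 0.
  by rewrite eM adjM !mulmxA -(mulmxA (invmx _)) -(mulmxA (invmx _)) iso mulmx0 mul0mx.
have gZ : Zt *m Zt = - (A *m invmx P) - Zt *m (B *m invmx P).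
  have [K1] := Mg; rewrite mul_row_block mul_mx_row !mulmx1 !mul1mx add0r.
  by move/eq_row_mx => [<- <-]; rewrite mulmxN.
have MgZ : row_mx 1%:M Zt *m g = Zt *m row_mx 1%:M Zt.
  by rewrite mul_row_block mul_mx_row !mulmx1 !mul1mx add0r gZ mulmxN.
have pcj2 : cj (horner_mx g p) = horner_mx g q.
  by rewrite map_horner_mx; congr horner_mx; exact: gr.
exists Zt; split.
- rewrite gZ mulmxBl mulNmx -!mulmxA !mulVmx // !mulmx1.
  by rewrite addrAC addrA subrr add0r addNr.
- move: Miso; rewrite mul_row_block !mul1mx mulmx0 addr0 /adj map_row_mx tr_row_mx mul_row_col.
  by rewrite map_mx1 trmx1 mulmx1.
- move=> x z x0 hx.
  have Vx : (x *m row_mx 1%:M Zt <= kermxpoly g p)%MS.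
    by rewrite eM mulmxA -eN submxMl.
  have yg : x *m row_mx 1%:M Zt *m g = z *: (x *m row_mx 1%:M Zt).
    by rewrite -mulmxA MgZ mulmxA hx scalemxAl.
  apply: rp; apply/rootP.
  move/sub_kermxP: Vx; rewrite (eigen_horner _ yg) => /eqP; rewrite scaler_eq0.
  case/orP => [/eqP //|]; rewrite mul_mx_row mulmx1 row_mx_eq0 (negbTE x0) //.
- move=> x hx.
  have Vx : (x *m row_mx 1%:M Zt <= kermxpoly g p)%MS.
    by rewrite eM mulmxA -eN submxMl.
  have Vx2 : (x *m row_mx 1%:M Zt <= kermxpoly g q)%MS.
    apply/sub_kermxP.
    have -> : x *m row_mx 1%:M Zt = x *m cj (row_mx 1%:M Zt).
      by rewrite map_row_mx map_mx1 !mul_mx_row hx.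
    by rewrite -pcj2 -mulmxA -map_mxM eM -mulmxA Np mulmx0 map_mx0 mulmx0.
  have := conj Vx Vx2 => /andP; rewrite -sub_capmx.
  have -> := mxdirect_kermxpoly g cof.
  by rewrite submx0 mul_mx_row mulmx1 row_mx_eq0 => /andP[/eqP].
Qed.

(** The matrix Y = P (Z0 - cj Z0) / 2i is Hermitian, by isotropy, and satisfies
    Im (Y Z0) = Y P^-1 Y > 0; so lyapunov provides a basis in which
    Y = 1.  There Z0 is dissipative, and the relation adj (Y Z0) = Y cj Z0 says
    that the conjugate solvent is the adjoint. *)
Lemma dissipative_solvent : exists Z0 S : 'M[C]_k.+1,
  [/\ S \in unitmx, A + B *m Z0 + P *m Z0 *m Z0 = 0,
      dissipative (invmx S *m Z0 *m S) &
      adj (invmx S *m Z0 *m S) = invmx S *m cj Z0 *m S].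
Proof.
have [Zt [f1 f2 f3 f4]] := solvent_rows.
pose Z0 := Zt^T; pose W := cj Z0; pose D := Z0 - W.
have e1 : A + B *m Z0 + P *m Z0 *m Z0 = 0.
  have := congr1 trmx f1; rewrite trmx0 !raddfD /= !trmx_mul sA sB sP => <-.
  by rewrite /Z0 mulmxA.
have e2 : B + P *m Z0 + adj Z0 *m P = 0.
  have := congr1 trmx f2; rewrite trmx0 !raddfD /= !trmx_mul sB sP => <-.
  by congr (_ + _ *m _); rewrite /adj /Z0 !map_trmx trmxK.
have aP : adj P = P by rewrite /adj rP sP.
have aA : adj A = A by rewrite /adj rA sA.
have aW : adj W = Z0^T by rewrite /adj /W cjK.
have aT : adj Z0^T = W by rewrite /adj -map_trmx trmxK.
have e2c : B + P *m W + Z0^T *m P = 0.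
  have := congr1 (fun M => cj M) e2; rewrite map_mx0 !map_mxD !map_mxM rB rP => <-.
  by congr (_ + _ *m _); rewrite /adj -map_trmx cjK.
have aPD : adj (P *m D) = - (P *m D).
  rewrite adjM aP adjB aW mulmxBl mulmxBr.
  have -> : adj Z0 *m P = - (B + P *m Z0) by apply/eqP; rewrite -addr_eq0 addrC e2.
  have -> : Z0^T *m P = - (B + P *m W) by apply/eqP; rewrite -addr_eq0 addrC e2c.
  by apply/matrixP => i j; rewrite ![in LHS]mxE ![in RHS]mxE; ring.
have PDZ : P *m D *m Z0 = Z0^T *m P *m Z0 - A.
  rewrite mulmxBr mulmxBl.
  have -> : P *m Z0 *m Z0 = - (A + B *m Z0) by apply/eqP; rewrite -addr_eq0 addrC e1.
  have -> : Z0^T *m P = - (B + P *m W) by apply/eqP; rewrite -addr_eq0 addrC e2c.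
  rewrite mulNmx mulmxDl.
  by apply/matrixP => i j; rewrite ![in LHS]mxE ![in RHS]mxE; ring.
have aPDZ : adj (P *m D *m Z0) = - (P *m D *m W).
  have -> : - (P *m D *m W) = cj (P *m D *m Z0).
    by rewrite !map_mxM rP /D map_mxB /W cjK -mulNmx -mulmxN opprB.
  rewrite PDZ adjB !adjM aP aA aT map_mxB !map_mxM rP rA mulmxA.
  by rewrite -map_trmx; reflexivity.
pose j : C := (2%:R * 'i)^-1.
have cj2 : cc j = - j.
  by rewrite /j cjV -invrN; congr (_^-1); apply/eqP; rewrite eq_complex /=; apply/andP; split; apply/eqP; ring.
have j0 : j != 0.
  by rewrite /j invr_eq0 eq_complex /=; apply/negP => /andP[_ /eqP]; lra.
have [Y [hY aH YD Yker]] : exists Y : 'M[C]_k.+1,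
    [/\ adj Y = Y, adj (Y *m Z0) = Y *m W, Y *m D = j^-1 *: (Y *m (invmx P *m Y)) &
      forall x : 'cV[C]_k.+1, Y *m x = 0 -> D *m x = 0].
  exists (j *: (P *m D)); split.
  - by rewrite adjZ aPD cj2 scaleNr scalerN opprK.
  - by rewrite -!scalemxAl adjZ aPDZ cj2 scaleNr scalerN opprK.
  - rewrite -!scalemxAr !scalerA mulVf // scale1r; congr (_ *m _).
    by rewrite mulKmx.
  move=> x; rewrite -scalemxAl => /eqP; rewrite scaler_eq0 (negbTE j0) /= -mulmxA => /eqP.
  exact: unitmx_inj Pu.
have hH : dissipative (Y *m Z0).
  move=> x x0.
  pose w := invmx P *m (Y *m x).
  have w0 : w != 0.
    apply: contra x0 => /eqP w0.
    have /Yker : Y *m x = 0 by rewrite -(mulKVmx Pu (Y *m x)) -/w w0 mulmx0.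
    rewrite mulmxBl => /eqP; rewrite subr_eq0 => /eqP h.
    apply/eqP; apply: trmx_inj; rewrite trmx0; apply: f4; apply: trmx_inj.
    by rewrite !trmx_mul trmxK map_trmx.
  have h : dot x (Y *m Z0 *m x) - cc (dot x (Y *m Z0 *m x)) = j^-1 * dot w (P *m w).
    rewrite -dotC dotMl aH -dotBr -mulmxBl -mulmxBr YD -scalemxAl dotZr; congr (_ * _).
    by rewrite /w mulKVmx // dotMl adj_inv aP dotMl hY !mulmxA.
  have := Ppos w0; move: h; rewrite /j invrK; move: (dot x _) (dot w _) => z w'.
  case: z w' => a b [c d] /= [] *; lra.
have [] := @lyapunov R _ Z0 Y hY hH.
  move=> x z x0 hx; apply: (f3 x^T); first by rewrite -(trmx0 C) (inj_eq (@trmx_inj _ _ _)).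
  by apply: trmx_inj; rewrite trmx_mul trmxK linearZ /= trmxK.
move=> S Su SY.
have iS : invmx S = adj S *m Y by rewrite -[RHS](mulmxK Su) SY mul1mx.
have eZ : invmx S *m Z0 *m S = adj S *m (Y *m Z0) *m S by rewrite iS !mulmxA.
exists Z0, S; split; [exact: Su|exact: e1| |].
  move=> x x0; rewrite eZ -!mulmxA dotMr adjK mulmxA; apply: hH.
  by apply: contra x0 => /eqP /(unitmx_inj Su) ->.
have -> : adj (invmx S *m Z0 *m S) = adj S *m adj (Y *m Z0) *m S.
  by rewrite eZ adjM (adjM (adj S)) adjK mulmxA.
by rewrite aH iS; congr (_ *m S); exact: mulmxA.
Qed.

End Factor.
End Solvent.

(** * Calculus of complex matrix functions of a real variable *)

Section Calculus.
Variable R : realType.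
Local Notation C := R[i].
Local Notation Re := (@complex.Re R).
Local Notation Im := (@complex.Im R).
Local Notation cc := (@conjc R).

Definition rder (f : R -> R) (t d : R) : Prop := is_derive t (1 : R) f d.

Lemma rder_val f t d d' : rder f t d -> d = d' -> rder f t d'.
Proof. by move=> h <-. Qed.

Lemma rder_ext f g t d : f =1 g -> rder f t d -> rder g t d.
Proof. by move=> /funext ->. Qed.

Lemma rder_cst a t : rder (fun=> a) t 0.
Proof. exact: is_derive_cst. Qed.

Lemma rder_id t : rder (fun x => x) t 1.
Proof. exact: is_derive_id. Qed.

Lemma rderD f g t df dg : rder f t df -> rder g t dg ->
  rder (fun x => f x + g x) t (df + dg).
Proof. exact: is_deriveD. Qed.

Lemma rderN f t df : rder f t df -> rder (fun x => - f x) t (- df).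
Proof. exact: is_deriveN. Qed.

Lemma rderB f g t df dg : rder f t df -> rder g t dg ->
  rder (fun x => f x - g x) t (df - dg).
Proof. exact: is_deriveB. Qed.

Lemma rderM f g t df dg : rder f t df -> rder g t dg ->
  rder (fun x => f x * g x) t (df * g t + f t * dg).
Proof.
move=> hf hg; have h := is_deriveM hf hg.
by apply: (rder_val h); rewrite /GRing.scale /= addrC mulrC (mulrC (f t)) mulrC.
Qed.

Lemma rder_comp f g t a b : rder f (g t) a -> rder g t b ->
  rder (fun x => f (g x)) t (a * b).
Proof. exact: is_derive1_comp. Qed.

Lemma rderV f t d : f t != 0 -> rder f t d -> rder (fun x => (f x)^-1) t (- d / f t ^+ 2).
Proof.
move=> f0 h; apply: (rder_val (is_deriveV f0 h)).
by rewrite /GRing.scale /= mulNr mulrC mulNr.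
Qed.

Lemma rder_uniq f t d d' : rder f t d -> rder f t d' -> d = d'.
Proof. by move=> [_ <-] [_ <-]. Qed.

Lemma rder_derive1 f t d : rder f t d -> derive1 f t = d.
Proof. by rewrite derive1E => -[_ <-]. Qed.

Lemma derivable_rder f t : derivable f t (1 : R) -> rder f t (derive1 f t).
Proof. by move=> h; rewrite derive1E; split. Qed.

Lemma rder_near f g t d : (\forall x \near t, f x = g x) -> rder f t d -> rder g t d.
Proof.
move=> h; exact: near_eq_is_derive.
Qed.

Lemma rder_continuous f t d : rder f t d -> {for t, continuous f}.
Proof. by move=> [h _]; apply/differentiable_continuous/derivable1_diffP. Qed.

Lemma rder_mvt (f df : R -> R) a b : a < b ->
  (forall x, a <= x <= b -> rder f x (df x)) ->
  exists2 c, a < c < b & f b - f a = df c * (b - a).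
Proof.
move=> ab h; have [|//|c] := @MVT R f df a b ab.
- move=> x; rewrite in_itv /= => /andP[ax xb]; apply: h; by rewrite !ltW.
- apply: derivable_within_continuous => x; rewrite in_itv /= => hx.
  by have [] := h x hx.
by rewrite in_itv /= => hc e; exists c.
Qed.

Lemma rder_ge0_le (f df : R -> R) a b : a <= b ->
  (forall x, a <= x <= b -> rder f x (df x)) ->
  (forall x, a < x < b -> 0 <= df x) -> f a <= f b.
Proof.
rewrite le_eqVlt => /predU1P[-> //|ab] h1 h2.
have [c hc e] := rder_mvt ab h1.
by rewrite -subr_ge0 e mulr_ge0 ?h2 // subr_ge0 ltW.
Qed.

Lemma rder_gt0_lt (f df : R -> R) a b : a < b ->
  (forall x, a <= x <= b -> rder f x (df x)) ->
  (forall x, a < x < b -> 0 < df x) -> f a < f b.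
Proof.
move=> ab h1 h2; have [c hc e] := rder_mvt ab h1.
by rewrite -subr_gt0 e mulr_gt0 ?h2 // subr_gt0.
Qed.

Lemma rder_eq0_cst (f df : R -> R) a b : a <= b ->
  (forall x, a <= x <= b -> rder f x (df x)) ->
  (forall x, a < x < b -> df x = 0) -> f a = f b.
Proof.
rewrite le_eqVlt => /predU1P[-> //|ab] h1 h2.
have [c hc e] := rder_mvt ab h1.
by apply/esym/eqP; rewrite -subr_eq0 e h2 // mul0r.
Qed.

(** Differentiation through the real and imaginary parts, as in cV_derive. *)
Definition cder (f : R -> C) (t : R) (d : C) : Prop :=
  rder (fun x => Re (f x)) t (Re d) /\ rder (fun x => Im (f x)) t (Im d).

Lemma cder_val f t d d' : cder f t d -> d = d' -> cder f t d'.
Proof. by move=> h <-. Qed.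

Lemma cder_ext f g t d : f =1 g -> cder f t d -> cder g t d.
Proof. by move=> /funext ->. Qed.

Lemma cder_near f g t d : (\forall x \near t, f x = g x) -> cder f t d -> cder g t d.
Proof.
move=> h [h1 h2]; split; [apply: rder_near h1|apply: rder_near h2];
  by near=> x; rewrite (near h x).
Unshelve. all: end_near. Qed.

Lemma cder_uniq f t d d' : cder f t d -> cder f t d' -> d = d'.
Proof.
move=> [h1 h2] [h3 h4]; have := rder_uniq h1 h3; have := rder_uniq h2 h4.
by case: d d' {h1 h2 h3 h4} => a b [c d] /= -> ->.
Qed.

Lemma cder_cst a t : cder (fun=> a) t 0.
Proof. by split; exact: rder_cst. Qed.

Lemma Re_add (a b : C) : Re (a + b) = Re a + Re b. Proof. by case: a b => ? ? []. Qed.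
Lemma Im_add (a b : C) : Im (a + b) = Im a + Im b. Proof. by case: a b => ? ? []. Qed.
Lemma Re_opp (a : C) : Re (- a) = - Re a. Proof. by case: a. Qed.
Lemma Im_opp (a : C) : Im (- a) = - Im a. Proof. by case: a. Qed.
Lemma Re_mul (a b : C) : Re (a * b) = Re a * Re b - Im a * Im b.
Proof. by case: a b => ? ? []. Qed.
Lemma Im_mul (a b : C) : Im (a * b) = Re a * Im b + Im a * Re b.
Proof. by case: a b => ? ? []. Qed.

Lemma cderD f g t df dg : cder f t df -> cder g t dg ->
  cder (fun x => f x + g x) t (df + dg).
Proof.
move=> [f1 f2] [g1 g2]; split.
  by rewrite Re_add; apply: rder_ext (rderD f1 g1) => x; rewrite Re_add.
by rewrite Im_add; apply: rder_ext (rderD f2 g2) => x; rewrite Im_add.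
Qed.

Lemma cderN f t df : cder f t df -> cder (fun x => - f x) t (- df).
Proof.
move=> [f1 f2]; split.
  by rewrite Re_opp; apply: rder_ext (rderN f1) => x; rewrite Re_opp.
by rewrite Im_opp; apply: rder_ext (rderN f2) => x; rewrite Im_opp.
Qed.

Lemma cderM f g t df dg : cder f t df -> cder g t dg ->
  cder (fun x => f x * g x) t (df * g t + f t * dg).
Proof.
move=> [f1 f2] [g1 g2]; split.
  apply: (rder_ext (f := fun x => Re (f x) * Re (g x) - Im (f x) * Im (g x))).
    by move=> x; rewrite Re_mul.
  apply: rder_val (rderB (rderM f1 g1) (rderM f2 g2)) _.
  by rewrite Re_add !Re_mul; ring.
apply: (rder_ext (f := fun x => Re (f x) * Im (g x) + Im (f x) * Re (g x))).
  by move=> x; rewrite Im_mul.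
apply: rder_val (rderD (rderM f1 g2) (rderM f2 g1)) _.
by rewrite Im_add !Im_mul; ring.
Qed.

Lemma cder_conj f t d : cder f t d -> cder (fun x => cc (f x)) t (cc d).
Proof.
move=> [h1 h2]; split.
  by case: d h1 h2 => a b /= h1 _; apply: rder_ext h1 => x; case: (f x).
case: d h1 h2 => a b /= _ h2.
by apply: rder_ext (rderN h2) => x; case: (f x).
Qed.

Lemma cder_sum I (r : seq I) (f : I -> R -> C) t (d : I -> C) :
  (forall i, cder (f i) t (d i)) ->
  cder (fun x => \sum_(i <- r) f i x) t (\sum_(i <- r) d i).
Proof.
move=> h; elim: r => [|i r IH].
  rewrite big_nil; apply: (cder_ext (f := fun=> 0)) => [x|]; first by rewrite big_nil.
  exact: cder_cst.
rewrite big_cons; apply: (cder_ext (f := fun x => f i x + \sum_(j <- r) f j x)) => [x|].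
  by rewrite big_cons.
exact: cderD.
Qed.

Lemma cder_real f t d : rder f t d -> cder (fun x => (f x)%:C) t d%:C.
Proof. by move=> h; split => //=; exact: rder_cst. Qed.

Lemma cder_prod I (r : seq I) (f : I -> R -> C) t :
  (forall i, exists d, cder (f i) t d) ->
  exists d, cder (fun x => \prod_(i <- r) f i x) t d.
Proof.
move=> h; elim: r => [|i r [d IH]].
  exists 0; apply: (cder_ext (f := fun=> 1)) => [x|]; first by rewrite big_nil.
  exact: cder_cst.
have [d' h'] := h i.
eexists; apply: (cder_ext (f := fun x => f i x * \prod_(j <- r) f j x)) => [x|].
  by rewrite big_cons.
exact: (cderM h' IH).
Qed.

Definition mder m n (F : R -> 'M[C]_(m, n)) (t : R) (D : 'M[C]_(m, n)) : Prop :=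
  forall i j, cder (fun x => F x i j) t (D i j).

Lemma mder_val m n (F : R -> 'M[C]_(m, n)) t d d' : mder F t d -> d = d' -> mder F t d'.
Proof. by move=> h <-. Qed.

Lemma mder_ext m n (F G : R -> 'M[C]_(m, n)) t d : F =1 G -> mder F t d -> mder G t d.
Proof. by move=> /funext ->. Qed.

Lemma mder_uniq m n (F : R -> 'M[C]_(m, n)) t d d' : mder F t d -> mder F t d' -> d = d'.
Proof. by move=> h1 h2; apply/matrixP => i j; apply: cder_uniq (h1 i j) (h2 i j). Qed.

Lemma mder_near m n (F G : R -> 'M[C]_(m, n)) t d :
  (\forall x \near t, F x = G x) -> mder F t d -> mder G t d.
Proof.
move=> h hF i j; apply: cder_near (hF i j).
by near=> x; rewrite (near h x).
Unshelve. all: end_near. Qed.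

Lemma mder_cst m n (A : 'M[C]_(m, n)) t : mder (fun=> A) t 0.
Proof. by move=> i j; rewrite mxE; exact: cder_cst. Qed.

Lemma mderD m n (F G : R -> 'M[C]_(m, n)) t f g : mder F t f -> mder G t g ->
  mder (fun x => F x + G x) t (f + g).
Proof.
move=> hF hG i j; rewrite mxE; apply: cder_ext (cderD (hF i j) (hG i j)) => x.
by rewrite mxE.
Qed.

Lemma mderN m n (F : R -> 'M[C]_(m, n)) t f : mder F t f -> mder (fun x => - F x) t (- f).
Proof.
by move=> hF i j; rewrite mxE; apply: cder_ext (cderN (hF i j)) => x; rewrite mxE.
Qed.

Lemma mderB m n (F G : R -> 'M[C]_(m, n)) t f g : mder F t f -> mder G t g ->
  mder (fun x => F x - G x) t (f - g).
Proof. by move=> hF hG; apply: mderD => //; exact: mderN. Qed.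

Lemma mderM m n p (F : R -> 'M[C]_(m, n)) (G : R -> 'M[C]_(n, p)) t f g :
  mder F t f -> mder G t g ->
  mder (fun x => F x *m G x) t (f *m G t + F t *m g).
Proof.
move=> hF hG i j; rewrite !mxE -big_split /=.
apply: cder_ext (cder_sum (f := fun k x => F x i k * G x k j) _ _) => [x|k].
  by rewrite mxE.
exact: cderM.
Qed.

Lemma mderZ m n (a : R -> C) (F : R -> 'M[C]_(m, n)) t da f :
  cder a t da -> mder F t f ->
  mder (fun x => a x *: F x) t (da *: F t + a t *: f).
Proof.
move=> ha hF i j; rewrite !mxE; apply: cder_ext (cderM ha (hF i j)) => x.
by rewrite mxE.
Qed.

Lemma mderMl m n p (A : 'M[C]_(m, n)) (G : R -> 'M[C]_(n, p)) t g :
  mder G t g -> mder (fun x => A *m G x) t (A *m g).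
Proof.
by move=> h; apply: mder_val (mderM (mder_cst A t) h) _; rewrite mul0mx add0r.
Qed.

Lemma mderMr m n p (F : R -> 'M[C]_(m, n)) (A : 'M[C]_(n, p)) t f :
  mder F t f -> mder (fun x => F x *m A) t (f *m A).
Proof.
by move=> h; apply: mder_val (mderM h (mder_cst A t)) _; rewrite mulmx0 addr0.
Qed.

Lemma mder_adj m n (F : R -> 'M[C]_(m, n)) t f :
  mder F t f -> mder (fun x => adj (F x)) t (adj f).
Proof.
move=> h i j; rewrite adjE; apply: cder_ext (cder_conj (h j i)) => x.
by rewrite adjE.
Qed.

Lemma cder_dot n (f g : R -> 'cV[C]_n) t df dg : mder f t df -> mder g t dg ->
  cder (fun x => dot (f x) (g x)) t (dot df (g t) + dot (f t) dg).
Proof.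
by move=> hf hg; have := mderM (mder_adj hf) hg => /(_ 0 0); rewrite mxE.
Qed.

Lemma mder_eq0_cst m n (F dF : R -> 'M[C]_(m, n)) a b : a <= b ->
  (forall x, a <= x <= b -> mder F x (dF x)) ->
  (forall x, a < x < b -> dF x = 0) -> F a = F b.
Proof.
move=> ab h1 h2; apply/matrixP => i j; apply/eqP; rewrite eq_complex; apply/andP; split; apply/eqP.
  apply: (rder_eq0_cst (f := fun x => Re (F x i j)) (df := fun x => Re (dF x i j)) ab) => x hx; first by have [] := h1 x hx i j.
  by rewrite h2 // mxE.
apply: (rder_eq0_cst (f := fun x => Im (F x i j)) (df := fun x => Im (dF x i j)) ab) => x hx; first by have [] := h1 x hx i j.
by rewrite h2 // mxE.
Qed.

Lemma cderV f t d : f t != 0 -> cder f t d -> exists d', cder (fun x => (f x)^-1) t d'.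
Proof.
move=> f0 [h1 h2].
have h3 := rderD (rderM h1 h1) (rderM h2 h2).
have n0 : Re (f t) * Re (f t) + Im (f t) * Im (f t) != 0.
  rewrite -!expr2 paddr_eq0 ?sqr_ge0 // !sqrf_eq0; apply: contra f0.
  by case: (f t) => a b /= /andP[/eqP -> /eqP ->].
have h4 := rderV (f := fun x => Re (f x) * Re (f x) + Im (f x) * Im (f x)) n0 h3.
have ex u v : rder (fun x => Re (f x)^-1) t u -> rder (fun x => Im (f x)^-1) t v ->
    exists d', cder (fun x => (f x)^-1) t d' by move=> hu hv; exists (u +i* v).
apply: (ex _ _ (rder_ext _ (rderM h1 h4)) (rder_ext _ (rderM (rderN h2) h4))) => x;
  by case: (f x) => a b /=; rewrite -!expr2 ?mulNr.
Qed.

Lemma cder_det n (F : R -> 'M[C]_n) t f : mder F t f ->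
  exists d, cder (fun x => \det (F x)) t d.
Proof.
move=> h; rewrite /determinant.
have hd (s : {perm 'I_n}) : exists d, cder (fun x => (-1) ^+ s * \prod_i F x i (s i)) t d.
  have [|d hd] := @cder_prod _ (index_enum 'I_n) (fun i x => F x i (s i)) t.
    by move=> i; eexists; exact: h.
  by eexists; apply: cderM; [exact: cder_cst|exact: hd].
have [d hd'] := boolp.choice hd.
by exists (\sum_s d s); apply: cder_sum.
Qed.

(** The entries of the inverse are differentiable by Cramer's formula; the value
    of the derivative then follows from F^-1 F = 1. *)
Lemma mder_inv n (F : R -> 'M[C]_n) t f : (forall x, F x \in unitmx) ->
  mder F t f -> mder (fun x => invmx (F x)) t (- (invmx (F t) *m f *m invmx (F t))).
Proof.
move=> Fu hF.
have [D hD] : exists D, mder (fun x => invmx (F x)) t D.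
  have [dd hdd] := cder_det hF.
  have d0 : \det (F t) != 0 by rewrite -unitfE -unitmxE.
  have [d1 hd1] := cderV (f := fun x => \det (F x)) d0 hdd.
  suff h i j : exists d, cder (fun x => invmx (F x) i j) t d.
    have h2 (ij : 'I_n * 'I_n) := h ij.1 ij.2.
    have [g hg] := boolp.choice h2.
    by exists (\matrix_(i, j) g (i, j)) => i j; rewrite mxE; exact: (hg (i, j)).
  have [d2 hd2] : exists d, cder (fun x => \det (row' j (col' i (F x)))) t d.
    by apply: (@cder_det _ _ _ (row' j (col' i f))) => k l; rewrite !mxE;
      apply: cder_ext (hF _ _) => x; rewrite !mxE.
  eexists; apply: cder_ext (cderM hd1 (cderM (cder_cst ((-1) ^+ (j + i)) t) hd2)) => x.
  by rewrite /invmx Fu !mxE.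
have e : D *m F t + invmx (F t) *m f = 0.
  apply: mder_uniq (mderM hD hF) _.
  by apply: mder_ext (mder_cst 1%:M t) => x; rewrite mulVmx.
apply: mder_val hD _.
have -> : D = D *m F t *m invmx (F t) by rewrite mulmxK.
by move/eqP: e; rewrite addr_eq0 => /eqP ->; rewrite mulNmx.
Qed.

End Calculus.

(** * Limits with a geometric error bound *)

Section GeometricLimits.
Variable R : realType.

Lemma geo_small (K rho eps : R) : 0 <= rho < 1 -> 0 < eps ->
  exists N, `|K| * rho ^+ N <= eps.
Proof.
move=> /andP[r0 r1] e0.
have : (fun n => `|K| * rho ^+ n) @ \oo --> `|K| * 0.
  apply: cvgMr; by apply: cvg_expr; rewrite ger0_norm.
rewrite mulr0 => /cvgrPdist_le /(_ _ e0) [N _ /(_ N (leqnn N))].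
rewrite sub0r normrN /= => h; exists N.
by apply: le_trans h; rewrite ler_norm.
Qed.

Lemma le_geo_eq (K rho a b : R) : 0 <= rho < 1 ->
  (forall N, `|a - b| <= K * rho ^+ N) -> a = b.
Proof.
move=> hr h; apply/eqP; rewrite -subr_eq0 -normr_le0; apply/ler_addgt0Pr => e e0; rewrite add0r.
have [N hN] := geo_small K hr e0.
apply: le_trans (h N) (le_trans _ hN).
by rewrite ler_wpM2r ?ler_norm // exprn_ge0 //; case/andP: hr.
Qed.

(** The sequences u n -+ K rho^n / (1 - rho) are monotone and enclose the limit. *)
Lemma geo_cvg (u : nat -> R) (K rho : R) : 0 <= rho < 1 ->
  (forall n, `|u n.+1 - u n| <= K * rho ^+ n) ->
  exists l, forall n, `|l - u n| <= K / (1 - rho) * rho ^+ n.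
Proof.
move=> /andP[r0 r1] h.
have d0 : 0 < 1 - rho by rewrite subr_gt0.
set K' := K / (1 - rho).
have eK : K = K' - K' * rho by rewrite /K'; field; rewrite gt_eqF.
pose w n := u n - K' * rho ^+ n; pose v n := u n + K' * rho ^+ n.
have step n : K' * rho ^+ n.+1 = K' * rho ^+ n - K * rho ^+ n.
  by rewrite exprS eK; ring.
have K0 : 0 <= K.
  by have := h 0; rewrite expr0 mulr1; apply: le_trans.
have K'0 : 0 <= K' by rewrite divr_ge0 // ltW.
have wS n : w n <= w n.+1.
  by rewrite /w step; have := h n; rewrite ler_norml => /andP[h1 h2]; lra.
have vS n : v n.+1 <= v n.
  by rewrite /v step; have := h n; rewrite ler_norml => /andP[h1 h2]; lra.
have wv n : w n <= v n.
  have p : 0 <= K' * rho ^+ n by rewrite mulr_ge0 // exprn_ge0.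
  by rewrite /w /v; lra.
have wm : {homo w : n m / (n <= m)%N >-> n <= m} by apply/nondecreasing_seqP.
have vm : {homo v : n m / (n <= m)%N >-> m <= n} by apply/nonincreasing_seqP.
have wv2 n m : w n <= v m.
  apply: (le_trans (wm _ _ (leq_maxl n m))); apply: (le_trans (wv _)).
  exact/vm/leq_maxr.
have hs : has_sup (range w).
  split; first by exists (w 0); exists 0.
  by exists (v 0) => _ [n _ <-].
exists (sup (range w)) => n.
have h1 : w n <= sup (range w) by apply: ub_le_sup => //; case: hs.
have h2 : sup (range w) <= v n.
  by apply: ge_sup; [case: hs|move=> _ [m _ <-]].
by rewrite ler_norml; move: h1 h2; rewrite /w /v => h1 h2; apply/andP; split; lra.
Qed.

(** By the mean value theorem the difference quotients of f - u n are bounded by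
    the uniform distance of the derivatives, which tends to 0. *)
Lemma geo_rder (u du : nat -> R -> R) (f df : R -> R) (K rho : R) : 0 <= rho < 1 ->
  (forall n x, rder (u n) x (du n x)) ->
  (forall n x, `|f x - u n x| <= K * rho ^+ n) ->
  (forall n x, `|df x - du n x| <= K * rho ^+ n) ->
  forall x, rder f x (df x).
Proof.
move=> hr hu hf hdf x.
have K0 : 0 <= K.
  by have := hf 0 0; rewrite expr0 mulr1; apply: le_trans.
have p0 n : 0 <= K * rho ^+ n by rewrite mulr_ge0 // exprn_ge0; case/andP: hr.
have lip0 n a b : a < b ->
    `|(f b - f a) - (u n b - u n a)| <= 2 * (K * rho ^+ n) * (b - a).
  move=> ab; apply/ler_addgt0Pr => e e0.
  have e20 : 0 < e / 2 by rewrite divr_gt0.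
  have [m0 hm0] := geo_small K hr e20.
  pose m := maxn m0 n.
  have hm : K * rho ^+ m <= e / 2.
    apply: le_trans hm0; rewrite ger0_norm // ler_wpM2l //.
    by apply: ler_wiXn2l; [case/andP: hr|case/andP: hr => _ /ltW|exact: leq_maxl].
  have hmn : K * rho ^+ m <= K * rho ^+ n.
    by rewrite ler_wpM2l //; apply: ler_wiXn2l; [case/andP: hr|case/andP: hr => _ /ltW|exact: leq_maxr].
  have [c _] := rder_mvt ab (fun y _ => rderB (hu m y) (hu n y)).
  move=> ec.
  have := hf m a; have := hf m b; have := hdf m c; have := hdf n c.
  rewrite !ler_norml => /andP[a1 a2] /andP[a3 a4] /andP[a5 a6] /andP[a7 a8].
  have ba : 0 <= b - a by rewrite subr_ge0 ltW.
  have k1 : (du m c - du n c) * (b - a) <= 2 * (K * rho ^+ n) * (b - a).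
    by apply: ler_wpM2r => //; lra.
  have k2 : - (2 * (K * rho ^+ n)) * (b - a) <= (du m c - du n c) * (b - a).
    by apply: ler_wpM2r => //; lra.
  apply/andP; split; lra.
have lip n a b : a != b ->
    `|(f b - f a) - (u n b - u n a)| <= 2 * (K * rho ^+ n) * `|b - a|.
  case: (ltgtP a b) => // ab _.
    by rewrite (gtr0_norm (x := b - a)) ?subr_gt0 //; exact: lip0.
  rewrite (ltr0_norm (x := b - a)) ?subr_lt0 // (opprB b a).
  have -> : f b - f a - (u n b - u n a) = - (f a - f b - (u n a - u n b)) by ring.
  by rewrite normrN; exact: lip0.
have cv : (fun h => h^-1 *: (f (h *: 1 + x) - f x)) @ 0^' --> df x.
  apply/cvgrPdist_le => e e0.
  have e40 : 0 < e / 4 by rewrite divr_gt0.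
  have [n hn] := geo_small K hr e40; rewrite ger0_norm // in hn.
  have [hd hv] := hu n x.
  have : (fun h => h^-1 *: (u n (h *: 1 + x) - u n x)) @ 0^' --> du n x.
    by rewrite -hv.
  move=> /cvgrPdist_le /(_ _ e40) hq.
  near=> h.
  have h0 : h != 0 by near: h; exact: nbhs_dnbhs_neq.
  have q1 : `|du n x - h^-1 *: (u n (h *: 1 + x) - u n x)| <= e / 4.
    by near: h.
  have xh : x != h *: 1 + x.
    by rewrite eq_sym addrC -subr_eq0 addrAC subrr add0r /GRing.scale /= mulr1.
  have := lip n _ _ xh.
  have -> : h *: 1 + x - x = h by rewrite addrK /GRing.scale /= mulr1.
  move=> q2.
  have q3 : `|h^-1 * (f (h *: 1 + x) - f x) - h^-1 * (u n (h *: 1 + x) - u n x)| <= 2 * (K * rho ^+ n).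
    rewrite -mulrBr normrM normfV ler_pdivrMl ?normr_gt0 // mulrC //.
  have q4 := hdf n x.
  rewrite /GRing.scale /= in q1 q3 *.
  move: q1 q3 q4; rewrite !ler_norml => /andP[a1 a2] /andP[a3 a4] /andP[a5 a6].
  apply/andP; split; lra.
by split; [apply/cvg_ex; exists (df x)|apply/cvg_lim].
Unshelve. all: end_near. Qed.
End GeometricLimits.

(** * Squared norms *)

Section Norms.
Variable R : realType.
Local Notation C := R[i].
Local Notation Re := (@complex.Re R).
Local Notation Im := (@complex.Im R).
Local Notation cc := (@conjc R).

Definition csq (a : C) : R := Re a ^+ 2 + Im a ^+ 2.
Definition nrm2 n (x : 'cV[C]_n) : R := Re (dot x x).

Lemma csq_ge0 a : 0 <= csq a.
Proof. by rewrite addr_ge0 ?sqr_ge0. Qed.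

Lemma csqM a b : csq (a * b) = csq a * csq b.
Proof. by rewrite /csq Re_mul Im_mul; ring. Qed.

Lemma nrm2E n (x : 'cV[C]_n) : nrm2 x = \sum_i csq (x i 0).
Proof.
rewrite /nrm2 dotE Re_sum; apply: eq_bigr => i _; rewrite Re_mul /csq.
by case: (x i 0) => a b /=; ring.
Qed.

Lemma nrm2_ge0 n (x : 'cV[C]_n) : 0 <= nrm2 x.
Proof. exact: dot_ge0. Qed.

Lemma nrm2_gt0 n (x : 'cV[C]_n) : x != 0 -> 0 < nrm2 x.
Proof. exact: dot_gt0. Qed.

Lemma nrm20 n : nrm2 (0 : 'cV[C]_n) = 0.
Proof. by rewrite /nrm2 dot0r. Qed.

Lemma csq_le_nrm2 n (x : 'cV[C]_n) i : csq (x i 0) <= nrm2 x.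
Proof.
by rewrite nrm2E (bigD1 i) //= lerDl sumr_ge0 // => j _; exact: csq_ge0.
Qed.

Lemma nrm2Z n a (x : 'cV[C]_n) : nrm2 (a *: x) = csq a * nrm2 x.
Proof.
by rewrite !nrm2E mulr_sumr; apply: eq_bigr => i _; rewrite mxE csqM.
Qed.

Lemma Re_dotC n (x y : 'cV[C]_n) : Re (dot y x) = Re (dot x y).
Proof. by rewrite dotC; case: (dot x y). Qed.

Lemma nrm2D n (x y : 'cV[C]_n) : nrm2 (x + y) = nrm2 x + nrm2 y + 2 * Re (dot x y).
Proof. by rewrite /nrm2 dotDl !dotDr !Re_add (Re_dotC y x); ring. Qed.

Lemma nrm2N n (x : 'cV[C]_n) : nrm2 (- x) = nrm2 x.
Proof. by rewrite /nrm2 dotNl dotNr opprK. Qed.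

Lemma dot_le_nrm2 n (x y : 'cV[C]_n) : 2 * Re (dot x y) <= nrm2 x + nrm2 y.
Proof.
have := nrm2_ge0 (x - y); rewrite nrm2D nrm2N dotNr Re_opp; lra.
Qed.

Lemma nrm2D_le n (x y : 'cV[C]_n) : nrm2 (x + y) <= 2 * nrm2 x + 2 * nrm2 y.
Proof. by rewrite nrm2D; have := dot_le_nrm2 x y; lra. Qed.

Lemma nrm2_sum_le n I (r : seq I) (y : I -> 'cV[C]_n) :
  nrm2 (\sum_(i <- r) y i) <= 2 ^+ size r * \sum_(i <- r) nrm2 (y i).
Proof.
elim: r => [|i r IH]; first by rewrite !big_nil nrm20 mulr0.
rewrite !big_cons /= exprS -mulrA mulrDr mulrDr.
apply: le_trans (nrm2D_le _ _) _; apply: lerD; last by rewrite ler_pM2l.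
rewrite ler_pM2l // ler_peMl ?nrm2_ge0 //; apply: exprn_ege1; lra.
Qed.

Lemma nrm2_bounded n m (M : 'M[C]_(m, n)) :
  exists2 K, 0 < K & forall x : 'cV[C]_n, nrm2 (M *m x) <= K * nrm2 x.
Proof.
pose S := \sum_j nrm2 (col j M).
have S0 : 0 <= S by rewrite sumr_ge0 // => j _; exact: nrm2_ge0.
exists (2 ^+ size (index_enum 'I_n) * S + 1).
  by rewrite ltr_wpDl // mulr_ge0 // exprn_ge0.
move=> x.
have -> : M *m x = \sum_j x j 0 *: col j M.
  by apply/colP => i; rewrite mxE summxE; apply: eq_bigr => j _; rewrite !mxE mulrC.
apply: le_trans (nrm2_sum_le _ _) _.
rewrite mulrDl mul1r; apply: ler_wpDr; first exact: nrm2_ge0.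
rewrite -mulrA ler_wpM2l ?exprn_ge0 // mulr_suml; apply: ler_sum => j _.
by rewrite nrm2Z mulrC ler_wpM2l ?nrm2_ge0 ?csq_le_nrm2.
Qed.

(** The Hermitian part of M is adj (S^-1) S^-1 for an invertible S, by lyapunov
    applied to Z = i, and S is bounded. *)
Lemma posdef_bound n (M : 'M[C]_n) :
  (forall x : 'cV[C]_n, x != 0 -> 0 < Re (dot x (M *m x))) ->
  exists2 k, 0 < k & forall x : 'cV[C]_n, k * nrm2 x <= Re (dot x (M *m x)).
Proof.
move=> h; pose H := (2^-1 : C) *: (M + adj M).
have hH x : dot x (H *m x) = (Re (dot x (M *m x)))%:C.
  rewrite /H -scalemxAl dotZr mulmxDl dotDr (dotMr (adj M)) adjK (dotC x).
  have -> (z : C) : z + cc z = 2 * (Re z)%:C.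
    case: z => a b; apply/eqP; rewrite eq_complex /=.
    by apply/andP; split; apply/eqP; ring.
  by rewrite mulKf // pnatr_eq0.
have aH : adj H = H.
  rewrite /H adjZ adjD adjK addrC; congr (_ *: _).
  by rewrite cjV -[2]/(2%:R) rmorph_nat.
have [] := @lyapunov R n ('i%:M) H aH.
- move=> x x0; rewrite mul_mx_scalar -scalemxAl dotZr hH Im_mul /= mul0r add0r mul1r.
  exact: h.
- move=> x z x0; rewrite mul_scalar_mx => /eqP.
  rewrite -subr_eq0 -scalerBl scaler_eq0 (negbTE x0) orbF subr_eq0 => /eqP <-.
  exact: ltr01.
move=> S Su SH; have [K K0 hK] := nrm2_bounded S.
exists K^-1; first by rewrite invr_gt0.
move=> x; rewrite ler_pdivrMl //.
pose y := invmx S *m x; have ex : x = S *m y by rewrite /y mulKVmx.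
have -> : Re (dot x (M *m x)) = nrm2 y.
  rewrite -[LHS]/(Re (Re (dot x (M *m x)))%:C) -hH ex dotMl mulmxA.
  by rewrite (mulmxA (adj S *m H)) SH mul1mx.
by rewrite {1}ex.
Qed.
End Norms.

(** * Points of the unit circle and generalized binomial coefficients *)

Section BinomialSeries.
Variable R : realType.
Local Notation C := R[i].
Local Notation Re := (@complex.Re R).
Local Notation Im := (@complex.Im R).

Definition cis (x : R) : C := cos x +i* sin x.

Lemma cisD x y : cis (x + y) = cis x * cis y.
Proof.
apply/eqP; rewrite eq_complex /= cosD sinD; apply/andP; split; apply/eqP; ring.
Qed.

Lemma cis0 : cis 0 = 1.
Proof. by rewrite /cis cos0 sin0. Qed.

Lemma csq_cis x : csq (cis x) = 1.
Proof. exact: cos2Dsin2. Qed.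

Lemma cder_cis (a : R) x : cder (fun y => cis (a * y)) x ('i * a%:C * cis (a * x)).
Proof.
have h : rder (fun y => a * y) x a.
  by apply: rder_val (rderM (rder_cst a x) (rder_id x)) _; rewrite mul0r add0r mulr1.
split.
  by apply: rder_val (rder_comp (is_derive_cos _) h) _ => /=; ring.
by apply: rder_val (rder_comp (is_derive_sin _) h) _ => /=; ring.
Qed.

Definition mclose m n (A B : 'M[C]_(m, n)) (e : R) : Prop :=
  forall i j, `|Re (A i j - B i j)| <= e /\ `|Im (A i j - B i j)| <= e.

Lemma mclose_tr m n (A B : 'M[C]_(m, n)) e : mclose A B e -> mclose A^T B^T e.
Proof. by move=> h i j; rewrite !mxE; exact: h. Qed.

Lemma mcloseM m n (M : 'M[C]_(m, n)) : exists c : R, forall p (A B : 'M[C]_(n, p)) e,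
  mclose A B e -> mclose (M *m A) (M *m B) (c * e).
Proof.
pose w i k := `|Re (M i k)| + `|Im (M i k)|.
exists (\sum_i \sum_k w i k) => p A B e h i j.
have w0 i0 k : 0 <= w i0 k by rewrite addr_ge0.
have e0 (k : 'I_n) : 0 <= e by have [h1 _] := h k j; apply: le_trans h1.
have le1 : (\sum_k w i k) * e <= (\sum_i \sum_k w i k) * e.
  case: (pickP (fun _ : 'I_n => true)) => [k _|no]; last first.
    have z i0 : \sum_k w i0 k = 0 by rewrite big1 // => k; have := no k.
    by rewrite z big1 // mul0r.
  rewrite ler_wpM2r ?(e0 k) // [leRHS](bigD1 i) //= lerDl sumr_ge0 // => i0 _.
  by rewrite sumr_ge0.
have eMM : (M *m A) i j - (M *m B) i j = \sum_k M i k * (A k j - B k j).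
  by rewrite !mxE -sumrB; apply: eq_bigr => k _; rewrite mulrBr.
have key (f : C -> R) : {morph f : x y / x + y} -> f 0 = 0 ->
    (forall x y, `|f (x * y)| <= `|Re x| * `|Re y| + `|Im x| * `|Im y| \/
      `|f (x * y)| <= `|Re x| * `|Im y| + `|Im x| * `|Re y|) ->
    `|f ((M *m A) i j - (M *m B) i j)| <= (\sum_i \sum_k w i k) * e.
  move=> fD f0 hf; apply: le_trans le1; rewrite eMM (big_morph f fD f0).
  apply: le_trans (ler_norm_sum _ _ _) _; rewrite mulr_suml; apply: ler_sum => k _.
  have [h1 h2] := h k j; rewrite /w mulrDl.
  by case: (hf (M i k) (A k j - B k j)) => /le_trans; apply; apply: lerD; apply: ler_wpM2l.
split; apply: key => //.
- by move=> x y; rewrite Re_add.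
- by move=> x y; left; rewrite Re_mul -!normrM; exact: ler_normB.
- by move=> x y; rewrite Im_add.
- by move=> x y; right; rewrite Im_mul -!normrM; exact: ler_normD.
Qed.

Lemma mcloseMr m n (M : 'M[C]_(m, n)) : exists c : R, forall p (A B : 'M[C]_(p, m)) e,
  mclose A B e -> mclose (A *m M) (B *m M) (c * e).
Proof.
have [c hc] := mcloseM M^T; exists c => p A B e /mclose_tr /hc /mclose_tr.
by rewrite !trmx_mul !trmxK.
Qed.

Lemma mclose_eq m n (A B : 'M[C]_(m, n)) K rho : 0 <= rho < 1 ->
  (forall N, mclose A B (K * rho ^+ N)) -> A = B.
Proof.
move=> hr h; apply/matrixP => i j; apply/eqP; rewrite -subr_eq0 eq_complex /=.
apply/andP; split; apply/eqP; apply: (le_geo_eq (K := K) hr) => N; rewrite subr0.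
  by have [] := h N i j.
by have [_] := h N i j.
Qed.

Lemma mcloseD m n (A B A' B' : 'M[C]_(m, n)) e e' : mclose A B e -> mclose A' B' e' ->
  mclose (A + A') (B + B') (e + e').
Proof.
move=> h1 h2 i j; rewrite !mxE; have [a1 a2] := h1 i j; have [b1 b2] := h2 i j.
rewrite opprD addrACA Re_add Im_add; split; apply: le_trans (ler_normD _ _) _; exact: lerD.
Qed.

Lemma csq_small (z : C) r : 0 <= r -> csq z <= r ^+ 2 -> `|Re z| <= r /\ `|Im z| <= r.
Proof.
move=> r0 h; rewrite /csq in h.
by split; rewrite -(ler_pXn2r (n := 2)) // ?nnegrE // ?real_normK ?num_real //;
  apply: le_trans h; rewrite ?lerDl ?lerDr sqr_ge0.
Qed.

Lemma mgeo m n (X : nat -> R -> 'M[C]_(m, n)) K rho : 0 <= rho < 1 -> 0 <= K ->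
  (forall N x i j, csq (X N.+1 x i j - X N x i j) <= (K * rho ^+ N) ^+ 2) ->
  exists L : R -> 'M[C]_(m, n), forall N x, mclose (L x) (X N x) (K / (1 - rho) * rho ^+ N).
Proof.
move=> hr K0 h.
have p0 N : 0 <= K * rho ^+ N by rewrite mulr_ge0 // exprn_ge0; case/andP: hr.
have ex (t : R * ('I_m * 'I_n)) : exists l : C, forall N,
    `|Re l - Re (X N t.1 t.2.1 t.2.2)| <= K / (1 - rho) * rho ^+ N /\
    `|Im l - Im (X N t.1 t.2.1 t.2.2)| <= K / (1 - rho) * rho ^+ N.
  have [|l1 h1] := @geo_cvg R (fun N => Re (X N t.1 t.2.1 t.2.2)) K rho hr.
    by move=> N; rewrite -Re_opp -Re_add; have [] := csq_small (p0 N) (h N t.1 t.2.1 t.2.2).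
  have [|l2 h2] := @geo_cvg R (fun N => Im (X N t.1 t.2.1 t.2.2)) K rho hr.
    by move=> N; rewrite -Im_opp -Im_add; have [] := csq_small (p0 N) (h N t.1 t.2.1 t.2.2).
  by exists (l1 +i* l2) => N; split; [exact: h1|exact: h2].
have [l hl] := boolp.choice ex.
exists (fun x => \matrix_(i, j) l (x, (i, j))) => N x i j; rewrite mxE.
by have := hl (x, (i, j)) N; rewrite /= Re_add Im_add Re_opp Im_opp.
Qed.

Lemma mgeo_mder m n (X dX : nat -> R -> 'M[C]_(m, n)) (L dL : R -> 'M[C]_(m, n)) K rho :
  0 <= rho < 1 -> (forall N x, mder (X N) x (dX N x)) ->
  (forall N x, mclose (L x) (X N x) (K * rho ^+ N)) ->
  (forall N x, mclose (dL x) (dX N x) (K * rho ^+ N)) ->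
  forall x, mder L x (dL x).
Proof.
move=> hr hX h1 h2 x i j; split.
  apply: (@geo_rder R (fun N y => Re (X N y i j)) (fun N y => Re (dX N y i j))
    (fun y => Re (L y i j)) (fun y => Re (dL y i j)) K rho hr).
  - by move=> N y; have [] := hX N y i j.
  - by move=> N y; rewrite -Re_opp -Re_add; have [] := h1 N y i j.
  - by move=> N y; rewrite -Re_opp -Re_add; have [] := h2 N y i j.
apply: (@geo_rder R (fun N y => Im (X N y i j)) (fun N y => Im (dX N y i j))
  (fun y => Im (L y i j)) (fun y => Im (dL y i j)) K rho hr).
- by move=> N y; have [] := hX N y i j.
- by move=> N y; rewrite -Im_opp -Im_add; have [] := h1 N y i j.
- by move=> N y; rewrite -Im_opp -Im_add; have [] := h2 N y i j.
Qed.

Fixpoint gbin (s : R) (k : nat) : R :=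
  if k is k'.+1 then (s - k'%:R) / k'.+1%:R * gbin s k' else 1.

(** For 0 < s < 1 this product is 1 - |binomial(s, 1)| - ... - |binomial(s, k)|,
    see gbin_sum. *)
Fixpoint gbin_tail (s : R) (k : nat) : R :=
  if k is k'.+1 then gbin_tail s k' * (1 - s / k'.+1%:R) else 1.

Lemma gbinS s k : gbin s k.+1 = (s - k%:R) / k.+1%:R * gbin s k.
Proof. by []. Qed.

Lemma gbin_tailS s k : gbin_tail s k.+1 = gbin_tail s k * (1 - s / k.+1%:R).
Proof. by []. Qed.

Lemma gbin_tail_bounds s k : 0 < s < 1 -> 0 <= gbin_tail s k <= 1.
Proof.
move=> /andP[s0 s1]; elim: k => [|k /andP[h0 h1]]; first by rewrite /= ler01 lexx.
rewrite gbin_tailS.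
have p : 0 < k.+1%:R :> R by rewrite ltr0n.
have h2 : 0 <= s / k.+1%:R by rewrite divr_ge0 // ltW.
have h3 : s / k.+1%:R <= 1.
  rewrite ler_pdivrMr // mul1r; apply: le_trans (ltW s1) _.
  by rewrite ler1n.
have h4 : 0 <= 1 - s / k.+1%:R by rewrite subr_ge0.
rewrite mulr_ge0 //=; apply: mulr_ile1 => //.
by rewrite gerBl.
Qed.

Lemma gbinE s k : gbin s k.+1 = (-1) ^+ k * (s * gbin_tail s k / k.+1%:R).
Proof.
elim: k => [|k IH]; first by rewrite /= expr0 !divr1 subr0 !mulr1 mul1r.
rewrite gbinS IH exprS.
rewrite gbin_tailS.
have p : k.+1%:R != 0 :> R by rewrite pnatr_eq0.
have p2 : k.+2%:R != 0 :> R by rewrite pnatr_eq0.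
move: p p2; rewrite -(natr1 k.+1); move: (k.+1%:R) (_ ^+ k) => x y p p2.
by field; rewrite p p2.
Qed.

Lemma gbin_abs s k : 0 < s < 1 -> `|gbin s k.+1| = gbin_tail s k - gbin_tail s k.+1.
Proof.
move=> hs; rewrite gbinE normrM normrX normrN1 expr1n mul1r.
have /andP[h0 _] := gbin_tail_bounds k hs; case/andP: hs => s0 _.
rewrite ger0_norm; last by rewrite divr_ge0 // mulr_ge0 // ltW.
by rewrite gbin_tailS; ring.
Qed.

(** After the first one the coefficients have alternating signs, so that the
    partial sums of their absolute values are those of 1 - (1 - 1)^s. *)
Lemma gbin_sum s N : 0 < s < 1 -> \sum_(k < N) `|gbin s k.+1| <= 1.
Proof.
move=> hs; suff -> : \sum_(k < N) `|gbin s k.+1| = 1 - gbin_tail s N.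
  by have /andP[] := gbin_tail_bounds N hs; lra.
elim: N => [|N IH]; first by rewrite big_ord0 /= subrr.
by rewrite big_ord_recr [LHS]/= IH gbin_abs //; ring.
Qed.

Lemma gbin_le1 s k : 0 < s < 1 -> (k%:R * gbin s k) ^+ 2 <= 1 /\ gbin s k ^+ 2 <= 1.
Proof.
move=> hs; have hsq x : `|x| <= 1 :> R -> x ^+ 2 <= 1.
  by move=> h; rewrite -real_normK ?num_real // expr_le1.
case: k => [|k]; first by split; apply: hsq; rewrite /= ?mul0r ?normr0 ?normr1 ?ler01.
have p : 0 < k.+1%:R :> R by rewrite ltr0n.
have h1 : `|k.+1%:R * gbin s k.+1| <= 1.
  rewrite gbinE; have -> : k.+1%:R * ((-1) ^+ k * (s * gbin_tail s k / k.+1%:R)) = (-1) ^+ k * (s * gbin_tail s k).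
    by field; rewrite gt_eqF.
  rewrite normrM normrX normrN1 expr1n mul1r.
  have /andP[h0 h1] := gbin_tail_bounds k hs; case/andP: hs => s0 s1.
  by rewrite ger0_norm ?mulr_ge0 // ?mulr_ile1 // ltW.
split; apply: hsq => //; apply: le_trans h1.
by rewrite (normrM k.+1%:R) ler_peMl // ger0_norm ?ler1n.
Qed.

End BinomialSeries.

(** * The binomial series of a contraction *)

Section BinomialMatrix.
Variable R : realType.
Local Notation C := R[i].
Local Notation Re := (@complex.Re R).
Local Notation Im := (@complex.Im R).

Variables (n : nat) (G : 'M[C]_n) (q s : R).
Hypotheses (hq : 0 <= q < 1) (hG : forall x : 'cV[C]_n, nrm2 (G *m x) <= q * nrm2 x).
Hypothesis hs : 0 < s < 1.

Let rho := Num.sqrt q.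

Let hrho : 0 <= rho < 1.
Proof.
rewrite sqrtr_ge0 /=; have /andP[q0 q1] := hq.
by rewrite -(ltr_pXn2r (n := 2)) ?nnegrE ?sqrtr_ge0 // sqr_sqrtr // expr1n.
Qed.

Let rho2 : rho ^+ 2 = q.
Proof. by rewrite sqr_sqrtr; case/andP: hq. Qed.

Definition mxpow k : 'M[C]_n := iter k (mulmx G) 1%:M.

Lemma mxpowS k : mxpow k.+1 = G *m mxpow k. Proof. by []. Qed.

Lemma mxpow_comm (M : 'M[C]_n) k : G *m M = M *m G -> mxpow k *m M = M *m mxpow k.
Proof.
move=> h; elim: k => [|k IH]; first by rewrite mul1mx mulmx1.
by rewrite mxpowS -mulmxA IH !mulmxA h.
Qed.

Lemma nrm2_mxpow k x : nrm2 (mxpow k *m x) <= q ^+ k * nrm2 x.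
Proof.
have /andP[q0 q1] := hq.
elim: k => [|k IH]; first by rewrite mul1mx expr0 mul1r.
rewrite mxpowS -mulmxA; apply: le_trans (hG _) _.
by rewrite exprS -mulrA ler_wpM2l.
Qed.

Lemma csq_mxpow k i j : csq (mxpow k i j) <= (rho ^+ k) ^+ 2.
Proof.
rewrite -exprM mulnC exprM rho2.
have := nrm2_mxpow k (delta_mx j 0).
have -> : nrm2 (delta_mx j 0 : 'cV[C]_n) = 1.
  rewrite nrm2E (bigD1 j) //= big1 => [|i0 /negbTE i0j].
    by rewrite mxE !eqxx /csq /= expr1n expr0n addr0 addr0.
  by rewrite mxE i0j /csq /= expr0n addr0.
rewrite mulr1; apply: le_trans; apply: le_trans (csq_le_nrm2 _ i).
by rewrite -colE mxE.
Qed.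

Let ph (k : nat) : R := - (2 * k%:R).
(** bterm k x times G^k is the k-th term of (1 + e^(-2ix) G)^s. *)
Definition bterm k x : C := (gbin s k)%:C * cis (ph k * x).
Definition dbterm k x : C := (gbin s k)%:C * ('i * (ph k)%:C * cis (ph k * x)).

Definition Phi_partial N x : 'M[C]_n := \sum_(k < N) bterm k x *: mxpow k.
Definition dPhi_partial N x : 'M[C]_n := \sum_(k < N) dbterm k x *: mxpow k.

Lemma csqR (r : R) : csq r%:C = r ^+ 2.
Proof. by rewrite /csq /= expr0n addr0. Qed.

Lemma csqi : csq 'i = 1 :> R.
Proof. by rewrite /csq /= expr0n expr1n add0r. Qed.

Lemma csq_bterm k x : csq (bterm k x) <= 1.
Proof. by rewrite csqM csqR csq_cis mulr1; have [] := gbin_le1 k hs. Qed.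

Lemma csq_dbterm k x : csq (dbterm k x) <= 2 ^+ 2.
Proof.
rewrite !csqM !csqR csq_cis csqi mulr1 mul1r.
have [h _] := gbin_le1 k hs.
have -> : gbin s k ^+ 2 * ph k ^+ 2 = 2 ^+ 2 * (k%:R * gbin s k) ^+ 2.
  by rewrite /ph sqrrN !exprMn; ring.
by rewrite ler_piMr // exprn_ge0.
Qed.

Lemma mder_Phi_partial N x : mder (Phi_partial N) x (dPhi_partial N x).
Proof.
elim: N => [|N IH].
  rewrite /dPhi_partial big_ord0; apply: mder_ext (mder_cst 0 x) => y.
  by rewrite /Phi_partial big_ord0.
rewrite /dPhi_partial big_ord_recr /= -/(dPhi_partial N x).
have hb : cder (bterm N) x (dbterm N x).
  by apply: cder_val (cderM (cder_cst _ x) (cder_cis _ x)) _; rewrite mul0r add0r.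
have h : mder (fun y => bterm N y *: mxpow N) x (dbterm N x *: mxpow N).
  by apply: mder_val (mderZ hb (mder_cst (mxpow N) x)) _; rewrite scaler0 addr0.
by apply: mder_ext (mderD IH h) => y; rewrite /Phi_partial big_ord_recr.
Qed.

(** The function (1 + z G)^s with z = e^(-2ix) satisfies
    (1 + z G) Phi' = - 2 i s z G Phi; truncation leaves the first omitted term. *)
Lemma Phi_partial_ode N x : dPhi_partial N x + cis (- (2 * x)) *: (G *m dPhi_partial N x)
   + (2 * 'i * s%:C * cis (- (2 * x))) *: (G *m Phi_partial N x) = - dbterm N x *: mxpow N.
Proof.
elim: N => [|N IH].
  rewrite /dPhi_partial /Phi_partial !big_ord0 mulmx0 !scaler0 !addr0.
  by rewrite /dbterm /ph mulr0 oppr0 !(mulr0, mul0r) oppr0 scale0r.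
rewrite /dPhi_partial /Phi_partial !big_ord_recr /= -/(dPhi_partial N x) -/(Phi_partial N x).
rewrite !mulmxDr !scalerDr -!scalemxAr !scalerA -mxpowS.
have -> (a b c d e f : 'M[C]_n) : a + b + (c + d) + (e + f) = (a + c + e) + (b + d + f).
  by apply/matrixP => i j; rewrite !mxE; ring.
have cancel (X Y : 'M[C]_n) (u v w d : C) : v + w = d ->
    - u *: X + (u *: X + v *: Y + w *: Y) = d *: Y.
  by move=> <-; rewrite scaleNr -addrA addKr scalerDl.
apply: (etrans (f_equal2 +%R IH erefl)); apply: cancel.
have ez : cis (ph N.+1 * x) = cis (- (2 * x)) * cis (ph N * x).
  by rewrite -cisD; congr cis; rewrite /ph -natr1; ring.
have hb : N.+1%:R * gbin s N.+1 = (s - N%:R) * gbin s N.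
  by rewrite gbinS mulrA mulrCA mulfV ?mulr1 // pnatr_eq0.
rewrite /dbterm /bterm ez.
set z := cis (- (2 * x)); set w := cis (ph N * x).
have e1 : (gbin s N.+1)%:C * ('i * (ph N.+1)%:C * (z * w)) =
    - (2 * 'i * z * w) * (N.+1%:R * gbin s N.+1)%:C.
  rewrite /ph rmorphN /= !rmorphM /=; rewrite -[2%:C]/(2%:R%:C); ring.
rewrite e1 hb rmorphM rmorphB /= /ph rmorphN rmorphM /= -[2%:C]/(2%:R%:C).
ring.
Qed.

Lemma Phi_exists : exists Phi dPhi : R -> 'M[C]_n, exists K,
  [/\ forall x, mder Phi x (dPhi x),
      forall N x, mclose (Phi x) (Phi_partial N x) (K * rho ^+ N) &
      forall N x, mclose (dPhi x) (dPhi_partial N x) (K * rho ^+ N)].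
Proof.
have csqs (a : nat -> R -> C) K : (forall k x, csq (a k x) <= K ^+ 2) ->
    forall N x i j, csq ((\sum_(k < N.+1) a k x *: mxpow k) i j - (\sum_(k < N) a k x *: mxpow k) i j)
      <= (K * rho ^+ N) ^+ 2.
  move=> ha N x i j; rewrite big_ord_recr /= mxE addrAC subrr add0r mxE csqM exprMn.
  by apply: ler_pM; rewrite ?csq_ge0 ?csq_mxpow.
have [|Phi hPhi] := mgeo (X := Phi_partial) (K := 2) hrho (ler0n R 2).
  by apply: csqs => k x; apply: le_trans (csq_bterm k x) _; rewrite -natrX ler1n.
have [|dPhi hdPhi] := mgeo (X := dPhi_partial) (K := 2) hrho (ler0n R 2).
  by apply: csqs => k x; exact: csq_dbterm.
exists Phi, dPhi, (2 / (1 - rho)); split => //.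
exact: (mgeo_mder hrho mder_Phi_partial hPhi hdPhi).
Qed.

Lemma mclose_trans (A B D : 'M[C]_n) e e' : mclose A B e -> mclose B D e' -> mclose A D (e + e').
Proof.
move=> h1 h2 i j; have [a1 a2] := h1 i j; have [b1 b2] := h2 i j.
have -> : A i j - D i j = (A i j - B i j) + (B i j - D i j) by ring.
by rewrite Re_add Im_add; split; apply: le_trans (ler_normD _ _) _; exact: lerD.
Qed.

(** Invertibility: as the moduli of the coefficients of degree at least 1 add up
    to at most 1, Re (a, Phi a) is at least (1 - q) / 2 times |a|^2, where q is
    the contraction ratio. *)
Lemma mx_binomial_series : exists Phi dPhi : R -> 'M[C]_n,
  [/\ forall x, mder Phi x (dPhi x),
      forall x, dPhi x + cis (- (2 * x)) *: (G *m dPhi x)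
        + (2 * 'i * s%:C * cis (- (2 * x))) *: (G *m Phi x) = 0,
      forall M x, G *m M = M *m G -> Phi x *m M = M *m Phi x,
      forall x, Phi (x + pi) = Phi x &
      forall x, Phi x \in unitmx].
Proof.
have [Phi [dPhi [K [hd h1 h2]]]] := Phi_exists.
have /andP[q0 q1] := hq.
exists Phi, dPhi; split=> //.
- move=> x; set z := cis _; set w := _ * z.
  pose M1 := 1%:M + z *: G; pose M2 := w *: G.
  have e (A B : 'M[C]_n) : B + z *: (G *m B) + w *: (G *m A) = M1 *m B + M2 *m A.
    by rewrite /M1 /M2 mulmxDl mul1mx -!scalemxAl.
  have [c1 hc1] := mcloseM M1; have [c2 hc2] := mcloseM M2.
  apply: (@mclose_eq R n n _ _ (c1 * K + c2 * K + 2) rho hrho) => N.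
  rewrite e.
  have hN : mclose (M1 *m dPhi_partial N x + M2 *m Phi_partial N x) 0 (2 * rho ^+ N).
    rewrite -e Phi_partial_ode => i j; rewrite !mxE subr0; apply: csq_small.
      by rewrite mulr_ge0 // exprn_ge0; case/andP: hrho.
    rewrite csqM exprMn -[X in csq X]opprK; apply: ler_pM; rewrite ?csq_ge0 ?csq_mxpow //.
    rewrite opprK; have -> : csq (- dbterm N x) = csq (dbterm N x).
      by rewrite /csq Re_opp Im_opp !sqrrN.
    exact: csq_dbterm.
  rewrite mulrDl; apply: mclose_trans hN.
  by rewrite mulrDl -!mulrA; apply: mcloseD; [exact: hc1|exact: hc2].
- move=> M x hM; have [c1 hc1] := mcloseM M; have [c2 hc2] := mcloseMr M.
  apply: (@mclose_eq R n n _ _ (c2 * K + c1 * K) rho hrho) => N.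
  have e : Phi_partial N x *m M = M *m Phi_partial N x.
    rewrite /Phi_partial mulmx_suml mulmx_sumr; apply: eq_bigr => k _.
    by rewrite -scalemxAl -scalemxAr mxpow_comm.
  rewrite mulrDl -!mulrA; apply: (@mclose_trans _ (Phi_partial N x *m M)); first exact: hc2.
  rewrite e => i j; have [a1 a2] := hc1 _ _ _ _ (h1 N x) i j.
  by rewrite -opprB Re_opp Im_opp !normrN.
- move=> x; apply: (@mclose_eq R n n _ _ (K + K) rho hrho) => N.
  rewrite mulrDl; apply: mclose_trans (h1 N (x + pi)) _.
  have -> : Phi_partial N (x + pi) = Phi_partial N x.
    apply: eq_bigr => k _; congr (_ *: _); rewrite /bterm; congr (_ * _).
    rewrite mulrDr cisD -[RHS]mulr1; congr (_ * _).
    rewrite /ph mulNr /cis cosN sinN.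
    have -> : 2 * k%:R * pi = pi *+ 2 *+ k :> R.
      by rewrite -[RHS]mulr_natr -[pi *+ 2]mulr_natr; ring.
    elim: (val k) => [|m IH]; first by rewrite mulr0n cos0 sin0 oppr0.
    move: IH => [c s0]; have {}s0 : sin (pi *+ 2 *+ m) = 0 :> R by apply: oppr_inj; rewrite oppr0.
    rewrite (mulrS (pi *+ 2)) (cosD (pi *+ 2)) (sinD (pi *+ 2)) cos2pi sin2pi c s0.
    by rewrite !mulr1 mul1r !mul0r subr0 addr0 oppr0.
  by move=> i j; have [a1 a2] := h1 N x i j; rewrite -opprB Re_opp Im_opp !normrN.
- move=> x; apply: unitmx_ker => a ha; apply/eqP; apply: contraT => a0.
  have p := nrm2_gt0 a0.
  have low N : (1 - q) / 2 * nrm2 a <= Re (dot a (Phi_partial N.+1 x *m a)).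
    have -> : Phi_partial N.+1 x *m a = a + \sum_(k < N) bterm k.+1 x *: (mxpow k.+1 *m a).
      rewrite /Phi_partial big_ord_recl mulmxDl mulmx_suml; congr (_ + _).
        by rewrite /bterm /ph mulr0 oppr0 mul0r cis0 mulr1 scale1r mul1mx.
      by apply: eq_bigr => k _; rewrite -scalemxAl.
    rewrite dotDr Re_add -/(nrm2 a).
    have term k : - (`|gbin s k.+1| * ((1 + q) / 2 * nrm2 a)) <= Re (dot a (bterm k.+1 x *: (mxpow k.+1 *m a))).
      set b := gbin s k.+1.
      have -> : bterm k.+1 x = (`|b|)%:C * ((Num.sg b)%:C * cis (ph k.+1 * x)).
        by rewrite mulrA -rmorphM /= [`|b| * _]mulrC -numEsg.
      rewrite -scalerA dotZr Re_mul /= mul0r subr0 -mulrN ler_wpM2l //.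
      set w := _ *: _.
      have hw : nrm2 w <= q * nrm2 a.
        rewrite nrm2Z csqM csqR csq_cis mulr1.
        have hsg : Num.sg b ^+ 2 <= 1.
          by rewrite sqr_sg; case: (b != 0).
        apply: (@le_trans _ _ (1 * nrm2 (mxpow k.+1 *m a))).
          by rewrite ler_wpM2r ?nrm2_ge0.
        rewrite mul1r mxpowS -mulmxA; apply: le_trans (hG _) _; rewrite ler_wpM2l //.
        apply: le_trans (nrm2_mxpow k a) _; rewrite ler_piMl ?nrm2_ge0 //.
        by rewrite exprn_ile1 // ltW.
      have := dot_le_nrm2 a (- w); rewrite dotNr Re_opp nrm2N; lra.
    have : - ((1 + q) / 2 * nrm2 a) <= Re (dot a (\sum_(k < N) bterm k.+1 x *: (mxpow k.+1 *m a))).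
      have -> : dot a (\sum_(k < N) bterm k.+1 x *: (mxpow k.+1 *m a)) =
          \sum_(k < N) dot a (bterm k.+1 x *: (mxpow k.+1 *m a)).
        by rewrite (big_morph (dot a) (@dotDr _ _ a) (dot0r a)).
      rewrite Re_sum; apply: le_trans (ler_sum _ (fun (k : 'I_N) _ => term k)).
      rewrite sumrN lerN2 -mulr_suml ler_piMl ?gbin_sum //.
      by rewrite mulr_ge0 ?nrm2_ge0 // divr_ge0 // addr_ge0.
    move=> h; lra.
  have [c1 hc1] := mcloseMr a; have [c2 hc2] := mcloseM (adj a).
  have pos : 0 < (1 - q) / 2 * nrm2 a by rewrite mulr_gt0 // divr_gt0 // subr_gt0.
  have pos2 : 0 < (1 - q) / 2 * nrm2 a / 2 by rewrite divr_gt0.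
  have [N hN] := geo_small (c2 * (c1 * K)) hrho pos2.
  have := hc2 _ _ _ _ (hc1 _ _ _ _ (h1 N.+1 x)) 0 0.
  rewrite ha mulmx0 mxE sub0r Re_opp normrN -/(dot a _) => -[h3 _].
  have h4 : c2 * (c1 * (K * rho ^+ N.+1)) <= (1 - q) / 2 * nrm2 a / 2.
    apply: le_trans hN; rewrite !mulrA -!mulrA (mulrA c1) mulrA.
    apply: (@le_trans _ _ (`|c2 * (c1 * K)| * rho ^+ N.+1)).
      by rewrite ler_wpM2r ?ler_norm // exprn_ge0; case/andP: hrho.
    by rewrite ler_wpM2l // exprS ler_piMl ?exprn_ge0 //; case/andP: hrho => ? /ltW.
  have := low N; have := le_trans (ler_norm _) (le_trans h3 h4); lra.
Qed.

End BinomialMatrix.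

(** * Real powers of cos + sin Z *)

Section Powers.
Variable R : realType.
Local Notation C := R[i].
Local Notation Re := (@complex.Re R).
Local Notation Im := (@complex.Im R).

Variables (n : nat) (Z : 'M[C]_n).

(** r Tm x is the value of x1 + x2 Z at the point of polar coordinates r, x, and
    Tm' is the derivative of Tm. *)
Definition Tm (x : R) : 'M[C]_n := (cos x)%:C%:M + (sin x)%:C *: Z.
Definition Tm' (x : R) : 'M[C]_n := (- sin x)%:C%:M + (cos x)%:C *: Z.

Lemma mder_Tm x : mder Tm x (Tm' x).
Proof.
apply: mderD.
  apply: mder_ext (_ : mder (fun y => (cos y)%:C *: 1%:M) x _) => [y|].
    by rewrite scalemx1.
  apply: mder_val (mderZ (cder_real (is_derive_cos _)) (mder_cst _ _)) _.
  by rewrite scaler0 addr0 scalemx1.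
apply: mder_val (mderZ (cder_real (is_derive_sin _)) (mder_cst _ _)) _.
by rewrite scaler0 addr0.
Qed.

Lemma mder_Tm' x : mder Tm' x (- Tm x).
Proof.
have h : rder (fun y => - sin y) x (- cos x) by apply: rderN; exact: is_derive_sin.
rewrite /Tm opprD; apply: mderD.
  apply: mder_ext (_ : mder (fun y => (- sin y)%:C *: 1%:M) x _) => [y|].
    by rewrite scalemx1.
  apply: mder_val (mderZ (cder_real h) (mder_cst _ _)) _.
  by rewrite scaler0 addr0 scalemx1 raddfN /= raddfN.
apply: mder_val (mderZ (cder_real (is_derive_cos _)) (mder_cst _ _)) _.
by rewrite scaler0 addr0 rmorphN /= scaleNr.
Qed.

Lemma Tm_comm (M : 'M[C]_n) x : M *m Z = Z *m M -> M *m Tm x = Tm x *m M.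
Proof.
by move=> h; rewrite /Tm mulmxDr mulmxDl scalar_mxC -scalemxAr -scalemxAl h.
Qed.

Lemma Tm'_comm (M : 'M[C]_n) x : M *m Z = Z *m M -> M *m Tm' x = Tm' x *m M.
Proof.
by move=> h; rewrite /Tm' mulmxDr mulmxDl scalar_mxC -scalemxAr -scalemxAl h.
Qed.

Lemma Tm_pi x : Tm (x + pi) = - Tm x.
Proof.
by rewrite /Tm cosDpi sinDpi !rmorphN /= scaleNr opprD.
Qed.

Lemma Tm0 : Tm 0 = 1%:M.
Proof. by rewrite /Tm cos0 sin0 scale0r addr0. Qed.

Lemma mul_invmx_comm (A B : 'M[C]_n) : A \in unitmx -> B *m A = A *m B ->
  B *m invmx A = invmx A *m B.
Proof.
by move=> Au h; rewrite -[LHS](mulKmx Au) (mulmxA A) -h mulmxK.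
Qed.

Hypothesis hZ : dissipative Z.

Lemma Tm_unit x : Tm x \in unitmx.
Proof.
apply: unitmx_ker => a; rewrite /Tm mulmxDl mul_scalar_mx -scalemxAl => h.
apply/eqP; apply: contraT => a0; have := hZ a0.
have e : (cos x)%:C * dot a a + (sin x)%:C * dot a (Z *m a) = 0.
  by rewrite -!dotZr -dotDr h dot0r.
have p := dot_gt0 a0.
move: e p; rewrite dotxxE; case: (dot a (Z *m a)) => u v; move: (Re (dot a a)) => w.
move=> /eqP; rewrite eq_complex /= => /andP[/eqP e1 /eqP e2] w0 v0.
have s0 : sin x = 0.
  have : sin x * v = 0 by lra.
  by move/eqP; rewrite mulf_eq0 (gt_eqF v0) orbF => /eqP.
have c0 : cos x = 0.
  have : cos x * w = 0 by move: e1; rewrite s0; lra.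
  by move/eqP; rewrite mulf_eq0 (gt_eqF w0) orbF => /eqP.
by have := cos2Dsin2 x; rewrite s0 c0 !expr0n addr0 => /eqP; rewrite eq_sym oner_eq0.
Qed.

Let J : 'M[C]_n := 1%:M - 'i *: Z.
Let J' : 'M[C]_n := 1%:M + 'i *: Z.

Let nrm2J x : nrm2 (J *m x) = nrm2 x + nrm2 (Z *m x) + 2 * Im (dot x (Z *m x)).
Proof.
rewrite /J mulmxBl mul1mx -scalemxAl nrm2D nrm2N nrm2Z csqi mul1r dotNr dotZr.
by rewrite Re_opp Re_mul /=; ring.
Qed.

Let nrm2J' x : nrm2 (J' *m x) = nrm2 x + nrm2 (Z *m x) - 2 * Im (dot x (Z *m x)).
Proof.
rewrite /J' mulmxDl mul1mx -scalemxAl nrm2D nrm2Z csqi mul1r dotZr.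
by rewrite Re_mul /=; ring.
Qed.

Let Im_ge0 x : 0 <= Im (dot x (Z *m x)).
Proof.
by have [->|/hZ /ltW //] := eqVneq x 0; rewrite mulmx0 dot0r.
Qed.

Let Ju : J \in unitmx.
Proof.
apply: unitmx_ker => a h; apply/eqP; apply: contraT => a0.
have := nrm2J a; rewrite h nrm20 => e.
by have := nrm2_gt0 a0; have := nrm2_ge0 (Z *m a); have := Im_ge0 a; lra.
Qed.

(* The Cayley transform of Z.  Dissipativity makes it a strict contraction, as
   |J d|^2 - |J' d|^2 = 4 Im (d, Z d). *)
Let G : 'M[C]_n := J' *m invmx J.

Let GJ : G *m J = J'.
Proof. by rewrite /G mulmxKV. Qed.

Let G_contr : exists2 q, 0 <= q < 1 & forall x : 'cV[C]_n, nrm2 (G *m x) <= q * nrm2 x.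
Proof.
have [|k k0 hk] := @posdef_bound R n (- 'i *: Z).
  by move=> x x0; rewrite -scalemxAl dotZr Re_mul /=; have := hZ x0; lra.
have [K K0 hK] := nrm2_bounded J.
exists (Num.max 0 (1 - 4 * k / K)).
  rewrite le_max lexx /= gt_max ltr01 /= gtrBl divr_gt0 // mulr_gt0 //.
move=> x; pose d := invmx J *m x; have ex : x = J *m d by rewrite /d mulKVmx.
have -> : nrm2 (G *m x) = nrm2 x - 4 * Im (dot d (Z *m d)).
  by rewrite ex mulmxA GJ nrm2J nrm2J'; ring.
have h1 := hk d; rewrite -scalemxAl dotZr Re_mul /= in h1.
have h2 := hK d; rewrite -ex in h2.
have h3 : k / K * nrm2 x <= k * nrm2 d.
  by rewrite -mulrA ler_wpM2l ?(ltW k0) // mulrC ler_pdivrMr // mulrC.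
have e4 : (1 - 4 * k / K) * nrm2 x = nrm2 x - 4 * (k / K * nrm2 x) by ring.
apply: (@le_trans _ _ ((1 - 4 * k / K) * nrm2 x)); first by rewrite e4; lra.
by rewrite ler_wpM2r ?nrm2_ge0 // le_max lexx orbT.
Qed.

(** E is the branch of Tm^s that is 1 at 0: it solves Tm E' = s Tm' E.  The last
    clause is the s-th power of Tm (x + pi) = e^(i pi) Tm x. *)
Definition is_power (s : R) (E : R -> 'M[C]_n) : Prop :=
  [/\ E 0 = 1%:M,
      forall x, mder E x (s%:C *: (Tm' x *m invmx (Tm x) *m E x)),
      forall x, E x *m Z = Z *m E x,
      forall x, E x \in unitmx &
      forall x, E (x + pi) = cis (s * pi) *: E x].

Let TTm x : invmx (Tm x) *m Tm' x = Tm' x *m invmx (Tm x).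
Proof.
apply/esym/mul_invmx_comm; first exact: Tm_unit.
by apply: Tm_comm; apply/esym/Tm'_comm.
Qed.

Let ZJ : G *m Z = Z *m G.
Proof.
rewrite /G -mulmxA -mul_invmx_comm //; last first.
  by rewrite /J mulmxBl mulmxBr mul1mx mulmx1 -scalemxAl -scalemxAr.
rewrite !mulmxA; congr (_ *m _).
by rewrite /J' mulmxDl mulmxDr mul1mx mulmx1 -scalemxAl -scalemxAr.
Qed.

Let cJ (M : 'M[C]_n) : M *m Z = Z *m M -> M *m J = J *m M.
Proof.
by move=> h; rewrite /J mulmxBl mulmxBr mul1mx mulmx1 -scalemxAl -scalemxAr h.
Qed.

Let TmE x : Tm x = (2^-1 * cis x) *: (J + cis (- (2 * x)) *: J').
Proof.
have -> : cis (- (2 * x)) = cis (- x) * cis (- x) by rewrite -cisD; congr cis; ring.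
have e : cis x * cis (- x) = 1 by rewrite -cisD subrr cis0.
rewrite scalerDr scalerA -!mulrA (mulrA (cis x)) e mul1r.
rewrite /J /J' scalerBr scalerDr !scalerA addrACA -scalerDl -scaleNr -scalerDl scalemx1 /Tm.
have h1 : cis x + cis (- x) = 2 * (cos x)%:C.
  rewrite /cis cosN sinN; apply/eqP; rewrite eq_complex /=.
  by apply/andP; split; apply/eqP; ring.
have h2 : cis (- x) - cis x = - (2 * 'i * (sin x)%:C).
  rewrite /cis cosN sinN; apply/eqP; rewrite eq_complex /=.
  by apply/andP; split; apply/eqP; ring.
have ii : 'i * 'i = -1 :> C by rewrite -expr2 sqr_i.
congr (_%:M + _ *: _).
  by rewrite -mulrDr h1 mulKf // pnatr_eq0.
have -> : - (2^-1 * cis x * 'i) + 2^-1 * cis (- x) * 'i = 2^-1 * ((cis (- x) - cis x) * 'i) by ring.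
rewrite h2; have -> : - (2 * 'i * (sin x)%:C) * 'i = - (2 * (sin x)%:C * ('i * 'i)) by ring.
by rewrite ii mulrN1 opprK mulKf // pnatr_eq0.
Qed.

Let Tm'E x : Tm' x = (2^-1 * 'i * cis x) *: (J - cis (- (2 * x)) *: J').
Proof.
have -> : cis (- (2 * x)) = cis (- x) * cis (- x) by rewrite -cisD; congr cis; ring.
have e : cis x * cis (- x) = 1 by rewrite -cisD subrr cis0.
rewrite scalerBr scalerA -!mulrA (mulrA (cis x)) e mul1r.
rewrite /J /J' scalerBr scalerDr !scalerA opprD addrACA -!scaleNr -!scalerDl scalemx1 /Tm'.
have h1 : cis x + cis (- x) = 2 * (cos x)%:C.
  rewrite /cis cosN sinN; apply/eqP; rewrite eq_complex /=.
  by apply/andP; split; apply/eqP; ring.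
have h2 : cis (- x) - cis x = - (2 * 'i * (sin x)%:C).
  rewrite /cis cosN sinN; apply/eqP; rewrite eq_complex /=.
  by apply/andP; split; apply/eqP; ring.
have ii : 'i * 'i = -1 :> C by rewrite -expr2 sqr_i.
congr (_%:M + _ *: _).
  have -> : 2^-1 * ('i * cis x) - 2^-1 * ('i * cis (- x)) = 2^-1 * (- ((cis (- x) - cis x) * 'i)) by ring.
  rewrite h2 rmorphN /=; have -> : - (- (2 * 'i * (sin x)%:C) * 'i) = 2 * (sin x)%:C * ('i * 'i) by ring.
  by rewrite ii mulrN1 mulrN mulKf // pnatr_eq0.
have -> : - (2^-1 * ('i * cis x) * 'i) - 2^-1 * ('i * cis (- x)) * 'i = - (2^-1 * ((cis x + cis (- x)) * ('i * 'i))) by ring.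
by rewrite ii h1 mulrN1 mulrN opprK mulKf // pnatr_eq0.
Qed.

Lemma is_power0 : is_power 0 (fun=> 1%:M).
Proof.
split; [by []| | |by move=> x; exact: unitmx1|].
- by move=> x; rewrite scale0r; exact: mder_cst.
- by move=> x; rewrite mul1mx mulmx1.
- by move=> x; rewrite mul0r cis0 scale1r.
Qed.

(** Tm x is e^(ix) / 2 times (1 - iZ) (1 + e^(-2ix) G), so its power is e^(isx)
    times the binomial series, normalized at 0. *)
Lemma is_power_frac s : 0 < s < 1 -> exists E, is_power s E.
Proof.
move=> hs; have [q hq hG] := G_contr.
have [Phi [dPhi [hd hode hcomm hper hu]]] := mx_binomial_series hq hG hs.
pose K := invmx (Phi 0).
exists (fun x => cis (s * x) *: (Phi x *m K)).
have ZPhi x : Phi x *m Z = Z *m Phi x by apply: hcomm; exact: ZJ.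
have ZK : K *m Z = Z *m K by apply/esym/mul_invmx_comm.
split.
- by rewrite mulr0 cis0 scale1r mulmxV.
- move=> x.
  apply: mder_val (mderZ (cder_cis s x) (mderMr K (hd x))) _.
  have Tu := Tm_unit x.
  rewrite -[LHS](mulKmx Tu) -TTm -!mulmxA [RHS]scalemxAr; congr (_ *m _).
  set z := cis (- (2 * x)).
  have eT : Tm x = (2^-1 * cis x) *: (J *m (1%:M + z *: G)).
    by rewrite TmE mulmxDr mulmx1 -scalemxAr -(cJ ZJ) GJ.
  have eT' : Tm' x = (2^-1 * 'i * cis x) *: (J *m (1%:M - z *: G)).
    by rewrite Tm'E mulmxBr mulmx1 -scalemxAr -(cJ ZJ) GJ.
  have main : Tm x *m (('i * s%:C) *: Phi x + dPhi x) = s%:C *: (Tm' x *m Phi x).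
    rewrite eT eT' -!scalemxAl scalerA -!mulmxA.
    have -> : s%:C * (2^-1 * 'i * cis x) = 2^-1 * cis x * (s%:C * 'i) by ring.
    rewrite -[RHS]scalerA; congr (_ *: _); rewrite [RHS]scalemxAr; congr (_ *m _).
    rewrite mulmxDl mulmxBl !mul1mx -!scalemxAl mulmxDr -!scalemxAr.
    move: (hode x); rewrite -/z.
    move: (G *m Phi x) (G *m dPhi x) (Phi x) (dPhi x) => P Q A B h.
    apply/matrixP => i j; move/matrixP/(_ i j): h; rewrite !mxE => h.
    by apply: subr0_eq; rewrite -[RHS]h; ring.
  have -> : ('i * s%:C * cis (s * x)) *: (Phi x *m K) + cis (s * x) *: (dPhi x *m K)
     = cis (s * x) *: ((('i * s%:C) *: Phi x + dPhi x) *m K).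
    by rewrite mulmxDl scalerDr -scalemxAl scalerA mulrC.
  rewrite -scalemxAr mulmxA main -!scalemxAl -!scalemxAr scalerA.
  by rewrite mulrC -scalerA mulmxA.
- by move=> x; rewrite -scalemxAl -scalemxAr -mulmxA ZK !mulmxA ZPhi.
- move=> x; rewrite unitmxZ ?unitmx_mul ?hu ?unitmx_inv ?hu //.
  by rewrite unitfE; apply/eqP => c0; have := csq_cis (s * x); rewrite c0 /csq /= !expr0n addr0 => /eqP; rewrite eq_sym oner_eq0.
- by move=> x; rewrite hper mulrDr cisD scalerA; congr (_ *: _); rewrite mulrC.
Qed.

Let cisDpi (a : R) : cis (a + pi) = - cis a.
Proof. by rewrite cisD /cis cospi sinpi; apply/eqP; rewrite eq_complex /=; apply/andP; split; apply/eqP; ring. Qed.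

Lemma is_power_succ s E : is_power s E -> is_power (s + 1) (fun x => Tm x *m E x).
Proof.
move=> [e0 ed ec eu ep]; split.
- by rewrite Tm0 e0 mul1mx.
- move=> x; apply: mder_val (mderM (mder_Tm x) (ed x)) _.
  have c : Tm' x *m Tm x = Tm x *m Tm' x by apply/Tm_comm/esym/Tm'_comm.
  move: (Tm x) (Tm' x) (E x) (Tm_unit x) c => T T' X Tu c.
  have e1 : T' *m invmx T *m (T *m X) = T' *m X by rewrite mulmxA mulmxKV.
  have e2 : T *m (s%:C *: (T' *m invmx T *m X)) = s%:C *: (T' *m X).
    by rewrite -scalemxAr !mulmxA -c mulmxK.
  by rewrite e1 e2 rmorphD rmorph1 scalerDl scale1r addrC.
- by move=> x; rewrite -mulmxA ec !mulmxA -(Tm_comm x (erefl (Z *m Z))).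
- by move=> x; rewrite unitmx_mul Tm_unit eu.
- move=> x; rewrite Tm_pi ep mulrDl mul1r cisDpi scaleNr mulNmx.
  by rewrite -scalemxAr.
Qed.

Lemma is_power_pred s E : is_power s E -> is_power (s - 1) (fun x => invmx (Tm x) *m E x).
Proof.
move=> [e0 ed ec eu ep]; split.
- by rewrite Tm0 e0 mulmx1 invmx1.
- move=> x; apply: mder_val (mderM (mder_inv Tm_unit (mder_Tm x)) (ed x)) _.
  move: (Tm x) (Tm' x) (E x) (TTm x) => T T' X c.
  have e1 : invmx T *m T' *m invmx T *m X = T' *m invmx T *m (invmx T *m X).
    by rewrite c !mulmxA.
  have e2 : invmx T *m (s%:C *: (T' *m invmx T *m X)) = s%:C *: (invmx T *m T' *m invmx T *m X).
    by rewrite -scalemxAr !mulmxA.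
  by rewrite e2 mulNmx e1 rmorphB rmorph1 scalerBl scale1r addrC.
- move=> x; rewrite -mulmxA ec !mulmxA; congr (_ *m _).
  apply/esym/mul_invmx_comm; first exact: Tm_unit.
  by rewrite -(Tm_comm x (erefl (Z *m Z))).
- by move=> x; rewrite unitmx_mul unitmx_inv Tm_unit eu.
- move=> x; have Nu : -1 *: Tm x \in unitmx by rewrite scaleN1r -Tm_pi Tm_unit.
  rewrite Tm_pi ep -(scaleN1r (Tm x)) (invmxZ Nu) invrN1 scaleN1r -scalemxAr mulNmx.
  rewrite scalerN -scaleNr; congr (_ *: _).
  by rewrite -[s in LHS](subrK 1) mulrDl mul1r cisDpi opprK.
Qed.

Lemma is_power_exists s : exists E, is_power s E.
Proof.
have up k : forall t, (exists E, is_power t E) -> exists E, is_power (t + k%:R) E.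
  elim: k => [|k IH] t [E hE]; first by exists E; rewrite addr0.
  have [F hF] := IH t (ex_intro _ E hE).
  by exists (fun x => Tm x *m F x); rewrite -natr1 addrA; exact: is_power_succ.
have down k : forall t, (exists E, is_power t E) -> exists E, is_power (t - k%:R) E.
  elim: k => [|k IH] t [E hE]; first by exists E; rewrite subr0.
  have [F hF] := IH t (ex_intro _ E hE).
  by exists (fun x => invmx (Tm x) *m F x); rewrite -natr1 opprD addrA; exact: is_power_pred.
pose f := s - (Num.floor s)%:~R.
have hf : exists E, is_power f E.
  have [f0|f0] := eqVneq f 0; first by exists (fun=> 1%:M); rewrite f0; exact: is_power0.
  apply: is_power_frac; rewrite lt_neqAle eq_sym f0 /=.
  rewrite subr_ge0 floor_le_tmp /= ltrBlDl.
  by have := floorD1_gt s; rewrite intrD.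
have -> : s = f + (Num.floor s)%:~R by rewrite subrK.
by case: (Num.floor s) => k; [exact: up|rewrite NegzE rmorphN; exact: down].
Qed.

(** The derivative of H^-1 E F vanishes. *)
Lemma is_power_mul s t u E F H : is_power s E -> is_power t F -> is_power u H -> u = s + t ->
  forall x, E x *m F x = H x.
Proof.
move=> [e0 ed ec eu _] [f0 fd fc fu _] + eust; rewrite eust => -[h0 hd hc hu _].
have d x : mder (fun y => invmx (H y) *m (E y *m F y)) x 0.
  apply: mder_val (mderM (mder_inv hu (hd x)) (mderM (ed x) (fd x))) _.
  have cT : E x *m (Tm' x *m invmx (Tm x)) = Tm' x *m invmx (Tm x) *m E x.
    rewrite mulmxA (Tm'_comm _ (ec x)) -!mulmxA; congr (_ *m _).
    by apply: mul_invmx_comm; [exact: Tm_unit|exact: Tm_comm].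
  move: (Tm' x *m invmx (Tm x)) cT => B cT.
  have -> : invmx (H x) *m ((s + t)%:C *: (B *m H x)) *m invmx (H x) = (s + t)%:C *: (invmx (H x) *m B).
    by rewrite -scalemxAr -scalemxAl !mulmxA mulmxK.
  rewrite mulNmx -scalemxAl -mulmxA mulmxDr -scalemxAl -!scalemxAr (mulmxA (E x)) cT.
  by rewrite !mulmxA rmorphD /= scalerDl addNr.
move=> x; suff e : invmx (H x) *m (E x *m F x) = 1%:M.
  by rewrite -[LHS](mulKVmx (hu x)) e mulmx1.
have e00 : invmx (H 0) *m (E 0 *m F 0) = 1%:M by rewrite h0 e0 f0 invmx1 !mulmx1.
rewrite -e00; have [x0|x0] := leP 0 x.
  by apply/esym; apply: (mder_eq0_cst (F := fun y => invmx (H y) *m (E y *m F y)) (dF := fun=> 0) x0).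
exact: (mder_eq0_cst (F := fun y => invmx (H y) *m (E y *m F y)) (dF := fun=> 0) (ltW x0)).
Qed.
End Powers.

(** * Dissipativity of the powers *)

Section Positivity.
Variable R : realType.
Local Notation C := R[i].
Local Notation Re := (@complex.Re R).
Local Notation Im := (@complex.Im R).
Local Notation cc := (@conjc R).

Lemma near_forall_fin T (I : finType) (f : I -> T -> Prop) (Q : T -> Prop)
    (F : set_system T) : Filter F -> (forall i, \forall x \near F, f i x) ->
  (forall x, (forall i, f i x) -> Q x) -> \forall x \near F, Q x.
Proof.
move=> FF h hQ; have h2 : \forall x \near F, forall i, f i x by exact: filter_forall.
by near=> x; apply: hQ; near: x.
Unshelve. all: end_near. Qed.

Lemma mder_taylor m n (M : R -> 'M[C]_(m, n)) t D eps : 0 < eps -> mder M t D ->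
  \forall x \near t, mclose (M x) (M t + (x - t)%:C *: D) (eps * `|x - t|).
Proof.
move=> e0 hM.
have key f d : rder f t d -> \forall x \near t, `|f x - (f t + (x - t) * d)| <= eps * `|x - t|.
  move/is_derive1_caratheodory => [g [fg gc gtd]].
  have gc' : g @ t --> d by rewrite -gtd.
  move/cvgrPdist_le: gc' => /(_ _ e0) h.
  near=> x.
  have -> : f x - (f t + (x - t) * d) = (g x - d) * (x - t).
    by rewrite opprD addrA fg; ring.
  rewrite normrM ler_wpM2r // distrC; near: x; exact: h.
have q (ij : 'I_m * 'I_n) : \forall x \near t,
   `|Re (M x ij.1 ij.2) - (Re (M t ij.1 ij.2) + (x - t) * Re (D ij.1 ij.2))| <= eps * `|x - t|
  /\ `|Im (M x ij.1 ij.2) - (Im (M t ij.1 ij.2) + (x - t) * Im (D ij.1 ij.2))| <= eps * `|x - t|.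
  case: ij => i j /=; have [h1 h2] := hM i j.
  by apply: filterS2 (key _ _ h1) (key _ _ h2) => x a b; split.
apply: near_forall_fin q _ => x h i j; have [a b] := h (i, j); rewrite /= in a b.
by rewrite !mxE Re_add Im_add Re_opp Im_opp Re_add Im_add Re_mul Im_mul /= !mul0r subr0 addr0.
Unshelve. all: end_near. Qed.

Lemma Im_dot_small n (W : 'M[C]_n) e (x : 'cV[C]_n) : mclose W 0 e ->
  `|Im (dot x (W *m x))| <= n%:R * n%:R * (2 * e) * nrm2 x.
Proof.
move=> h.
have -> : dot x (W *m x) = \sum_i \sum_j cc (x i 0) * (W i j * x j 0).
  by rewrite dotE; apply: eq_bigr => i _; rewrite mxE mulr_sumr.
have t i j : `|Im (cc (x i 0) * (W i j * x j 0))| <= 2 * e * nrm2 x.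
  have [h1 h2] := h i j; rewrite mxE subr0 in h1 h2.
  have c1 := csq_le_nrm2 x i; have c2 := csq_le_nrm2 x j.
  have e0 : 0 <= e by apply: le_trans h1.
  apply: (@le_trans _ _ (e * (csq (x i 0) + csq (x j 0)))); last first.
    have a1 : e * csq (x i 0) <= e * nrm2 x by rewrite ler_wpM2l.
    have a2 : e * csq (x j 0) <= e * nrm2 x by rewrite ler_wpM2l.
    have -> : 2 * e * nrm2 x = e * nrm2 x + e * nrm2 x by ring.
    by rewrite mulrDr lerD.
  move: h1 h2; rewrite /csq; case: (x i 0) (x j 0) (W i j) => a b [c d] [u v] /= h1 h2.
  have -> : a * (u * d + v * c) + - b * (u * c - v * d) =
    u * (a * d - b * c) + v * (a * c + b * d) by ring.
  apply: le_trans (ler_normD _ _) _; rewrite !normrM.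
  have p1 : `|a * d - b * c| <= (a ^+ 2 + b ^+ 2 + (c ^+ 2 + d ^+ 2)) / 2.
    by rewrite ler_norml; have := sqr_ge0 (a - d); have := sqr_ge0 (a + d);
      have := sqr_ge0 (b - c); have := sqr_ge0 (b + c); rewrite !sqrrD !sqrrN;
      move=> *; apply/andP; split; lra.
  have p2 : `|a * c + b * d| <= (a ^+ 2 + b ^+ 2 + (c ^+ 2 + d ^+ 2)) / 2.
    by rewrite ler_norml; have := sqr_ge0 (a - c); have := sqr_ge0 (a + c);
      have := sqr_ge0 (b - d); have := sqr_ge0 (b + d); rewrite !sqrrD !sqrrN;
      move=> *; apply/andP; split; lra.
  apply: (@le_trans _ _ (e * ((a ^+ 2 + b ^+ 2 + (c ^+ 2 + d ^+ 2)) / 2)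
    + e * ((a ^+ 2 + b ^+ 2 + (c ^+ 2 + d ^+ 2)) / 2))).
    by apply: lerD; apply: ler_pM.
  by rewrite -mulrDr; lra.
rewrite Im_sum; apply: le_trans (ler_norm_sum _ _ _) _.
apply: (@le_trans _ _ (\sum_(i < n) n%:R * (2 * e * nrm2 x))).
  apply: ler_sum => i _; rewrite Im_sum; apply: le_trans (ler_norm_sum _ _ _) _.
  apply: (@le_trans _ _ (\sum_(j < n) (2 * e * nrm2 x))); first by apply: ler_sum => j _; exact: t.
  by rewrite sumr_const card_ord -[leLHS]mulr_natl lexx.
have -> : n%:R * n%:R * (2 * e) * nrm2 x = n%:R * (n%:R * (2 * e * nrm2 x)) by ring.
by rewrite sumr_const card_ord -[leLHS]mulr_natl lexx.
Qed.

Lemma dissipative_bound n (M : 'M[C]_n) : dissipative M ->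
  exists2 k, 0 < k & forall x : 'cV[C]_n, k * nrm2 x <= Im (dot x (M *m x)).
Proof.
move=> h; have [|k k0 hk] := @posdef_bound R n (- 'i *: M).
  by move=> x x0; rewrite -scalemxAl dotZr Re_mul /=; have := h x x0; lra.
exists k => // x; have := hk x; rewrite -scalemxAl dotZr Re_mul /=; lra.
Qed.

Lemma dissipative_near n (M : R -> 'M[C]_n) t D : mder M t D -> dissipative (M t) ->
  \forall x \near t, dissipative (M x).
Proof.
move=> hM hd; have [k k0 hk] := dissipative_bound hd.
pose c : R := n%:R * n%:R * 2 + 1.
have c0 : 0 < c by rewrite ltr_wpDl // !mulr_ge0.
pose D0 : 'M[C]_n := D.
have hMe : \forall x \near t, mclose (M x) (M t) (k / 2 / c).
  have e20 : 0 < k / 2 / c by rewrite !divr_gt0.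
  have key f d : rder f t d -> \forall x \near t, `|f x - f t| <= k / 2 / c.
    move=> /rder_continuous fc; have fc' : f @ t --> f t by exact: fc.
    move/cvgrPdist_le: fc' => /(_ _ e20).
    by apply: filterS => x; rewrite distrC.
  have q (ij : 'I_n * 'I_n) : \forall x \near t,
     `|Re (M x ij.1 ij.2) - Re (M t ij.1 ij.2)| <= k / 2 / c
    /\ `|Im (M x ij.1 ij.2) - Im (M t ij.1 ij.2)| <= k / 2 / c.
    case: ij => i j /=; have [h1 h2] := hM i j.
    by apply: filterS2 (key _ _ h1) (key _ _ h2) => x a b; split.
  apply: near_forall_fin q _ => x h i j; have [a b] := h (i, j); rewrite /= in a b.
  by rewrite Re_add Im_add Re_opp Im_opp.
near=> x => y y0.
have h : mclose (M x) (M t) (k / 2 / c) by near: x.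
have hs : mclose (M x - M t) 0 (k / 2 / c).
  by move=> i j; have := h i j; rewrite !mxE subr0.
have := Im_dot_small y hs.
have p := nrm2_gt0 y0; have := hk y.
rewrite mulmxBl dotBr Im_add Im_opp => h1.
have h2 : n%:R * n%:R * (2 * (k / 2 / c)) * nrm2 y <= k / 2 * nrm2 y.
  rewrite ler_pM2r // mulrA (mulrA _ _ c^-1) ler_pdivrMr // mulrC ler_wpM2l ?divr_ge0 ?(ltW k0) //.
  by rewrite /c lerDl.
rewrite ler_norml => /andP[h3 _].
have : 0 < k * nrm2 y by rewrite mulr_gt0.
lra.
Unshelve. all: end_near. Qed.

(** M x = 1 + x D + o(x), and 1 has no imaginary part. *)
Lemma dissipative_start n (M : R -> 'M[C]_n) D : mder M 0 D -> M 0 = 1%:M -> dissipative D ->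
  \forall x \near 0, 0 < x -> dissipative (M x).
Proof.
move=> hM h1 hd; have [k k0 hk] := dissipative_bound hd.
pose c : R := n%:R * n%:R * 2 + 1.
have c0 : 0 < c by rewrite ltr_wpDl // !mulr_ge0.
have e20 : 0 < k / 2 / c by rewrite !divr_gt0.
have := mder_taylor e20 hM; apply: filterS => x h x0 y y0.
have hs : mclose (M x - (1%:M + x%:C *: D)) 0 (k / 2 / c * x).
  by move=> i j; have := h i j; rewrite h1 !mxE !subr0 (gtr0_norm x0).
have := Im_dot_small y hs.
have p := nrm2_gt0 y0; have := hk y.
rewrite mulmxBl mulmxDl mul1mx dotBr dotDr Im_add Im_opp Im_add Im_dotxx add0r -scalemxAl dotZr.
rewrite Im_mul /= mul0r addr0 => a1.
have h2 : n%:R * n%:R * (2 * (k / 2 / c * x)) * nrm2 y <= k / 2 * x * nrm2 y.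
  rewrite ler_pM2r //.
  have -> : n%:R * n%:R * (2 * (k / 2 / c * x)) = (n%:R * n%:R * 2 * (k / 2)) / c * x by ring.
  rewrite ler_pM2r // ler_pdivrMr // mulrC ler_wpM2l ?divr_ge0 ?(ltW k0) //.
  by rewrite /c lerDl.
rewrite ler_norml => /andP[h3 _].
have := ler_wpM2l (ltW x0) a1.
have : 0 < k * x * nrm2 y by rewrite !mulr_gt0.
lra.
Qed.

Section PowerPositivity.
Variables (n : nat) (Z : 'M[C]_n).
Hypothesis hZ : dissipative Z.

Lemma Tm_dissipative x : 0 < x < pi -> dissipative (Tm Z x).
Proof.
move=> hx y y0; rewrite /Tm mulmxDl mul_scalar_mx -scalemxAl dotDr !dotZr Im_add !Im_mul Im_dotxx /=.
by rewrite mulr0 !mul0r !addr0 add0r mulr_gt0 ?sin_gt0_pi ?hZ.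
Qed.

(** As sin Tm' = cos Tm - 1, the function X = sin^-s Tm^s satisfies
    X' = - (s sin^(-s-1)) F^-1 with F = Tm^(1-s), and the imaginary part of
    - F^-1 is positive where that of F is. *)
Lemma power_mono s E F a b x : 0 < s -> is_power Z s E -> is_power Z (1 - s) F ->
  0 < a -> a <= b -> b < pi -> (forall t, a < t < b -> dissipative (F t)) ->
  expR (- s * ln (sin a)) * Im (dot x (E a *m x)) <=
  expR (- s * ln (sin b)) * Im (dot x (E b *m x)).
Proof.
move=> s0 hE hF a0 ab bpi hFd.
pose w t := expR (- s * ln (sin t)).
pose dE t := s%:C *: (Tm' Z t *m invmx (Tm Z t) *m E t).
pose dw t := w t * (- s * ((sin t)^-1 * cos t)).
have [e0 ed ec eu _] := hE; have [f0 fd fc fu _] := hF.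
have EF t : E t *m F t = Tm Z t.
  have h1 := is_power_succ hZ (is_power0 Z); rewrite add0r in h1.
  have e1 : 1 = s + (1 - s) by ring.
  by rewrite (is_power_mul hZ hE hF h1 e1) mulmx1.
have sp t : a <= t <= b -> 0 < sin t.
  by move=> /andP[h1 h2]; apply: sin_gt0_pi; rewrite (lt_le_trans a0 h1) (le_lt_trans h2 bpi).
apply: (@rder_ge0_le R (fun t => w t * Im (dot x (E t *m x)))
   (fun t => dw t * Im (dot x (E t *m x)) + w t * Im (dot x (dE t *m x))) a b ab).
- move=> t ht; apply: rderM.
    apply: rder_val (rder_comp (is_derive_expR _) (rderM (rder_cst (- s) t)
      (rder_comp (is_derive1_ln (sp t ht)) (is_derive_sin t)))) _.
    by rewrite /dw /w mul0r add0r.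
  have [_ h] := cder_dot (mder_cst x t) (mderMr x (ed t)).
  by rewrite dot0l add0r in h.
move=> t ht; have hs : 0 < sin t by apply: sp; case/andP: ht => *; rewrite !ltW.
pose y := invmx (F t) *m x.
have -> : dw t * Im (dot x (E t *m x)) + w t * Im (dot x (dE t *m x)) =
   w t * s / sin t * Im (dot y (F t *m y)).
  have eT' : (sin t)%:C *: Tm' Z t = (cos t)%:C *: Tm Z t - 1%:M.
    rewrite /Tm /Tm' !scalerDr !scale_scalar_mx !scalerA addrAC.
    congr (_ + _); last by rewrite mulrC.
    rewrite -raddfB /=; congr (_%:M).
    rewrite -!rmorphM /= -[1]/(1%:C) -rmorphB /=; congr (_%:C).
    by rewrite mulrN -!expr2 -[in RHS](cos2Dsin2 t); ring.
  have eTE : invmx (Tm Z t) *m E t = invmx (F t).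
    by rewrite -[RHS](mulKmx (Tm_unit hZ t)) -EF -mulmxA mulmxV // mulmx1.
  have eX : (sin t)%:C *: (Tm' Z t *m invmx (Tm Z t) *m E t) = (cos t)%:C *: E t - invmx (F t).
    rewrite !scalemxAl eT' !mulmxBl mul1mx eTE -!scalemxAl mulmxV ?Tm_unit //.
    by rewrite mul1mx.
  have eI : sin t * Im (dot x (dE t *m x)) = s * (cos t * Im (dot x (E t *m x)) - Im (dot x (invmx (F t) *m x))).
    have -> : sin t * Im (dot x (dE t *m x)) = Im ((sin t)%:C * dot x (dE t *m x)).
      by rewrite Im_mul /= mul0r addr0.
    rewrite -dotZr scalemxAl /dE scalerA mulrC -scalerA eX -scalemxAl mulmxBl -scalemxAl.
    by rewrite dotZr dotBr dotZr !Im_mul /= !mul0r !addr0 Im_add Im_opp Im_mul /= mul0r addr0.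
  have eY : Im (dot x (invmx (F t) *m x)) = - Im (dot y (F t *m y)).
    rewrite -/y; have {1}-> : x = F t *m y by rewrite /y mulKVmx.
    by rewrite dotC; case: (dot y _).
  have s0' : sin t != 0 by rewrite gt_eqF.
  have -> : Im (dot x (dE t *m x)) = (sin t)^-1 * (sin t * Im (dot x (dE t *m x))) by rewrite mulKf.
  by rewrite eI eY /dw; ring.
rewrite mulr_ge0 //; first by rewrite divr_ge0 ?ltW // mulr_gt0 ?expR_gt0.
have [->|y0] := eqVneq y 0; first by rewrite mulmx0 dot0r.
exact/ltW/hFd.
Qed.

(** By power_mono the powers s and 1 - s keep each other dissipative: both are
    near 0, and the supremum of the a such that both are on ]0, a] is at least
    every x < pi. *)
Lemma power_dissipative s E : 0 < s <= 1 -> is_power Z s E ->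
  forall x, 0 < x < pi -> dissipative (E x).
Proof.
move=> /andP[s0]; rewrite le_eqVlt => /predU1P[->|s1] hE x hx.
  have h1 := is_power_succ hZ (is_power0 Z); rewrite add0r in h1.
  have e1 : 1 = 0 + 1 :> R by rewrite add0r.
  have := is_power_mul hZ (is_power0 Z) hE h1 e1 x.
  by rewrite mul1mx mulmx1 => ->; exact: Tm_dissipative.
have [F hF] := is_power_exists hZ (1 - s).
have t0 : 0 < 1 - s by rewrite subr_gt0.
have hE' : is_power Z (1 - (1 - s)) E by rewrite subKr.
pose P t := dissipative (E t) /\ dissipative (F t).
have start (r : R) (H : R -> 'M[C]_n) : 0 < r -> is_power Z r H -> \forall t \near 0, 0 < t -> dissipative (H t).
  move=> r0 [h0 hd _ _ _]; apply: (dissipative_start (hd 0) h0).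
  move=> y y0; rewrite h0 mulmx1 Tm0 invmx1 mulmx1 -scalemxAl dotZr Im_mul /= mul0r addr0.
  rewrite mulr_gt0 // /Tm' sin0 cos0 oppr0 scale1r; have -> : (0%:C)%:M = 0 :> 'M[C]_n by exact: raddf0.
  by rewrite add0r; exact: hZ.
have [d d0 hd] : exists2 d, 0 < d & forall t, 0 < t < d -> P t.
  have : \forall t \near (0 : R), 0 < t -> P t.
    have := start _ _ s0 hE; have := start _ _ t0 hF.
    by apply: filterS2 => t h1 h2 tp; split; [exact: h2|exact: h1].
  move=> /nbhs_ballP[d d0 hd]; exists d; [exact: d0|move=> t /andP[t1 t2]].
  by apply: hd => //; rewrite /ball /= sub0r normrN gtr0_norm.
have right_open t : P t -> exists2 e, 0 < e & forall u, t <= u < t + e -> P u.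
  move=> [h1 h2]; have [_ ed _ _ _] := hE; have [_ fd _ _ _] := hF.
  have : \forall u \near t, P u.
    have := dissipative_near (ed t) h1; have := dissipative_near (fd t) h2.
    by apply: filterS2 => u a b; split.
  move=> /nbhs_ballP[e e0 he]; exists e; [exact: e0|move=> u /andP[u1 u2]].
  by apply: he; rewrite /ball /= distrC ger0_norm ?subr_ge0 // ltrBlDl.
have step a b : 0 < a -> a <= b -> b < pi -> P a -> (forall t, a < t < b -> P t) -> P b.
  move=> a0 ab bpi [Ea Fa] h.
  split => y y0.
    have h1 := power_mono y s0 hE hF a0 ab bpi (fun t ht => (h t ht).2).
    have := lt_le_trans (mulr_gt0 (expR_gt0 _) (Ea y y0)) h1.
    by rewrite pmulr_rgt0 ?expR_gt0.
  have h1 := power_mono y t0 hF hE' a0 ab bpi (fun t ht => (h t ht).1).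
  have := lt_le_trans (mulr_gt0 (expR_gt0 _) (Fa y y0)) h1.
  by rewrite pmulr_rgt0 ?expR_gt0.
have /andP[x0 xpi] := hx.
pose S := [set a | 0 < a <= x /\ forall t, 0 < t <= a -> P t].
have S0 : S (Num.min x (d / 2)).
  split; first by rewrite lt_min x0 divr_gt0 //= ge_min lexx.
  move=> t /andP[t1]; rewrite le_min => /andP[_ t2]; apply: hd; rewrite t1 /=.
  by apply: le_lt_trans t2 _; rewrite ltr_pdivrMr // ltr_pMr // ltr1n.
have hsup : has_sup S.
  by split; [exists (Num.min x (d / 2))|exists x => a [/andP[_ ?] _]].
set g := sup S.
have g0 : 0 < g.
  apply: (lt_le_trans _ (ub_le_sup hsup.2 S0)).
  by case: S0 => /andP[].
have gx : g <= x by apply: ge_sup; [exact: hsup.1|move=> a [/andP[_ ?] _]].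
have gpi : g < pi by apply: le_lt_trans gx xpi.
have below t : 0 < t < g -> P t.
  move=> /andP[t1 t2]; have [a [Sa ha] ta] := sup_gt hsup.1 t2.
  by apply: ha; rewrite t1 ltW.
have Pg : P g.
  have ag := ub_le_sup hsup.2 S0; have [/andP[a0 _] ha] := S0.
  apply: (step _ g a0 ag gpi); first by apply: ha; rewrite a0 lexx.
  by move=> t /andP[t1 t2]; apply: below; rewrite (lt_trans a0 t1).
have [e e0 he] := right_open g Pg.
have [xg|gx'] := leP x g.
  have -> : x = g by apply/eqP; rewrite eq_le xg gx.
  by case: Pg.
have : S (Num.min x (g + e / 2)).
  have e2 : e / 2 < e by rewrite ltr_pdivrMr // ltr_pMr // ltr1n.
  split; first by rewrite lt_min x0 addr_gt0 ?divr_gt0 //= ge_min lexx.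
  move=> t /andP[t1]; rewrite le_min => /andP[_ t2].
  have [tg|gle] := ltP t g; first by apply: below; rewrite t1.
  by apply: he; rewrite gle /=; apply: le_lt_trans t2 _; rewrite ltrD2l.
move=> /(ub_le_sup hsup.2); rewrite -/g leNgt lt_min gx' ltrDl divr_gt0 //.
Qed.
End PowerPositivity.

End Positivity.

(** * A first order two-point boundary value problem *)

Section FirstOrder.
Variable R : realType.
Local Notation C := R[i].
Local Notation Re := (@complex.Re R).
Local Notation Im := (@complex.Im R).
Local Notation cc := (@conjc R).

Variables (n : nat) (Z : 'M[C]_n).
Hypothesis hZ : dissipative Z.

(** The logarithmic derivative of Tm. *)
Definition Bm t : 'M[C]_n := Tm' Z t *m invmx (Tm Z t).

(** With k = Tm d, Im (k, Bm k) = Im (Tm d, Tm' d) = Im (d, Z d). *)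
Lemma Bm_dissipative t : dissipative (Bm t).
Proof.
move=> k k0; pose d := invmx (Tm Z t) *m k.
have ek : k = Tm Z t *m d by rewrite /d mulKVmx ?Tm_unit.
have d0 : d != 0 by apply: contra k0 => /eqP d0; rewrite ek d0 mulmx0.
have -> : Bm t *m k = Tm' Z t *m d by rewrite /Bm -mulmxA.
rewrite {1}ek /Tm /Tm' !mulmxDl !mul_scalar_mx -!scalemxAl.
rewrite !dotDl !dotDr !dotZl !dotZr !cjR.
have := hZ d0; rewrite (dotC d (Z *m d)) (dotxxE d) (dotxxE (Z *m d)).
case: (dot d (Z *m d)) => u v; move: (Re _) (Re _) => a b /= v0.
have h E : E = (cos t ^+ 2 + sin t ^+ 2) * v -> 0 < E by move=> ->; rewrite cos2Dsin2 mul1r.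
by apply: h; ring.
Qed.

Lemma Bm_comm (M : 'M[C]_n) t : M *m Z = Z *m M -> M *m Bm t = Bm t *m M.
Proof.
move=> h; rewrite /Bm mulmxA (Tm'_comm t h) -!mulmxA; congr (_ *m _).
by apply: mul_invmx_comm; [exact: Tm_unit|exact: Tm_comm].
Qed.

Lemma rder_nrm2 (k : R -> 'cV[C]_n) t dk : mder k t dk ->
  rder (fun x => nrm2 (k x)) t (2 * Re (dot (k t) dk)).
Proof.
move=> h; have [h1 _] := cder_dot h h.
by apply: rder_val h1 _; rewrite Re_add (Re_dotC (k t) dk); ring.
Qed.

Variables (lam : C) (alpha : R) (f g df dg : R -> 'cV[C]_n) (c y : 'cV[C]_n).
Hypothesis alpha0 : 0 < alpha.
Hypothesis hf : forall t, 0 <= t <= alpha -> mder f t (df t).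
Hypothesis hg : forall t, 0 <= t <= alpha -> mder g t (dg t).
Hypothesis hdf : forall t, 0 < t < alpha -> df t = lam *: (Bm t *m f t).
Hypothesis hdg : forall t, 0 < t < alpha -> dg t = lam *: (adj (Bm t) *m g t).
Hypotheses (f0 : f 0 = c) (g0 : g 0 = c) (fa : f alpha = y) (ga : g alpha = y).

Let s := Re lam.
Let gam := Im lam.

Let Hlam : lam = s%:C + 'i * gam%:C.
Proof. by rewrite /s /gam; case: (lam) => a b; apply/eqP; rewrite eq_complex /=; apply/andP; split; apply/eqP; ring. Qed.

Lemma Re_igam (w : C) : Re ('i * gam%:C * w) = - gam * Im w.
Proof. by case: w => a b /=; ring. Qed.

Section WithE.
Variable E : R -> 'M[C]_n.
Hypothesis hE : is_power Z (- s) E.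

(* Removing the modulus of Tm^lam leaves k1' = i gam Bm k1 and
   k2' = i gam adj(Bm) k2, so |k1| and |k2| are monotone, in opposite directions. *)
Let k1 t := E t *m f t.
Let k2 t := adj (E t) *m g t.
Let dk1 t := (- s)%:C *: (Bm t *m E t) *m f t + E t *m df t.
Let dk2 t := adj ((- s)%:C *: (Bm t *m E t)) *m g t + adj (E t) *m dg t.

Let hk1 t : 0 <= t <= alpha -> mder k1 t (dk1 t).
Proof. by move=> ht; case: hE => _ ed _ _ _; apply: mderM; [exact: ed|exact: hf]. Qed.

Let hk2 t : 0 <= t <= alpha -> mder k2 t (dk2 t).
Proof. by move=> ht; case: hE => _ ed _ _ _; apply: mderM; [apply: mder_adj; exact: ed|exact: hg]. Qed.

Let dk1E t : 0 < t < alpha -> dk1 t = ('i * gam%:C) *: (Bm t *m k1 t).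
Proof.
move=> ht; case: hE => _ _ ec _ _; rewrite /dk1 hdf // /k1.
rewrite -scalemxAl -scalemxAr [E t *m (_ *m _)]mulmxA (Bm_comm t (ec t)) -!mulmxA -scalerDl.
by rewrite [in LHS]Hlam rmorphN /= addrA addNr add0r.
Qed.

Let dk2E t : 0 < t < alpha -> dk2 t = ('i * gam%:C) *: (adj (Bm t) *m k2 t).
Proof.
move=> ht; case: hE => _ _ ec _ _; rewrite /dk2 hdg // /k2.
rewrite adjZ cjR adjM -scalemxAl -scalemxAr.
have h : adj (Bm t) *m adj (E t) = adj (E t) *m adj (Bm t) by rewrite -!adjM (Bm_comm t (ec t)).
rewrite [adj (Bm t) *m (_ *m _)]mulmxA h -!mulmxA -scalerDl.
by rewrite [in LHS]Hlam rmorphN /= addrA addNr add0r.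
Qed.

Let rk1 t : 0 <= t <= alpha -> rder (fun x => nrm2 (k1 x)) t (2 * Re (dot (k1 t) (dk1 t))).
Proof. by move=> ht; exact/rder_nrm2/hk1. Qed.
Let rk2 t : 0 <= t <= alpha -> rder (fun x => nrm2 (k2 x)) t (2 * Re (dot (k2 t) (dk2 t))).
Proof. by move=> ht; exact/rder_nrm2/hk2. Qed.

Let vk1 t : 0 < t < alpha -> Re (dot (k1 t) (dk1 t)) = - gam * Im (dot (k1 t) (Bm t *m k1 t)).
Proof. by move=> ht; rewrite dk1E // dotZr Re_igam. Qed.

Let vk2 t : 0 < t < alpha -> Re (dot (k2 t) (dk2 t)) = gam * Im (dot (k2 t) (Bm t *m k2 t)).
Proof.
move=> ht; rewrite dk2E // dotZr Re_igam dotMr adjK (dotC (k2 t)).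
by case: (dot _ _) => a b /=; ring.
Qed.

Let B0 t k : 0 <= Im (dot k (Bm t *m k)).
Proof. by have [->|/(Bm_dissipative t) /ltW //] := eqVneq k 0; rewrite mulmx0 dot0r. Qed.

Lemma k1_mono a b : 0 <= a -> a <= b -> b <= alpha -> 
  (0 <= gam -> nrm2 (k1 b) <= nrm2 (k1 a)) /\ (gam <= 0 -> nrm2 (k1 a) <= nrm2 (k1 b)).
Proof.
move=> a0 ab ba; have sub t : a <= t <= b -> 0 <= t <= alpha.
  by move=> /andP[h1 h2]; rewrite (le_trans a0 h1) (le_trans h2 ba).
have sub2 t : a < t < b -> 0 < t < alpha.
  by move=> /andP[h1 h2]; rewrite (le_lt_trans a0 h1) (lt_le_trans h2 ba).
split=> hgam.
  rewrite -lerN2; apply: (rder_ge0_le (f := fun x => - nrm2 (k1 x)) (df := fun t => - (2 * Re (dot (k1 t) (dk1 t)))) ab).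
    by move=> t /sub ht; apply/rderN/rk1.
  move=> t /sub2 ht; rewrite vk1 // mulNr mulrN opprK.
  by rewrite !mulr_ge0.
apply: (rder_ge0_le (f := fun x => nrm2 (k1 x)) (df := fun t => (2 * Re (dot (k1 t) (dk1 t)))) ab).
  by move=> t /sub ht; exact/rk1.
move=> t /sub2 ht; rewrite vk1 // !mulr_ge0 // oppr_ge0 //.
Qed.

Lemma k2_mono a b : 0 <= a -> a <= b -> b <= alpha -> 
  (gam <= 0 -> nrm2 (k2 b) <= nrm2 (k2 a)) /\ (0 <= gam -> nrm2 (k2 a) <= nrm2 (k2 b)).
Proof.
move=> a0 ab ba; have sub t : a <= t <= b -> 0 <= t <= alpha.
  by move=> /andP[h1 h2]; rewrite (le_trans a0 h1) (le_trans h2 ba).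
have sub2 t : a < t < b -> 0 < t < alpha.
  by move=> /andP[h1 h2]; rewrite (le_lt_trans a0 h1) (lt_le_trans h2 ba).
split=> hgam.
  rewrite -lerN2; apply: (rder_ge0_le (f := fun x => - nrm2 (k2 x)) (df := fun t => - (2 * Re (dot (k2 t) (dk2 t)))) ab).
    by move=> t /sub ht; apply/rderN/rk2.
  move=> t /sub2 ht; rewrite vk2 // -mulrN -mulNr.
  by rewrite !mulr_ge0 // oppr_ge0.
apply: (rder_ge0_le (f := fun x => nrm2 (k2 x)) (df := fun t => (2 * Re (dot (k2 t) (dk2 t)))) ab).
  by move=> t /sub ht; exact/rk2.
by move=> t /sub2 ht; rewrite vk2 // !mulr_ge0.
Qed.

Let E0 : E 0 = 1%:M. Proof. by case: hE. Qed.
Let k10 : k1 0 = c. Proof. by rewrite /k1 E0 mul1mx. Qed.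
Let k20 : k2 0 = c. Proof. by rewrite /k2 E0 adj1 mul1mx. Qed.

Lemma nrm2_eq0 m (x : 'cV[C]_m) : nrm2 x <= 0 -> x = 0.
Proof. by move=> h; apply/eqP; apply: contraTT h => /nrm2_gt0; rewrite ltNge. Qed.

(** The decreasing one of |k1| and |k2| vanishes since it does at 0; hence f = g
    vanishes at alpha, and the increasing one is 0 there, hence everywhere. *)
Lemma first_order_zero : c = 0 -> forall t, 0 <= t <= alpha -> f t = 0 /\ g t = 0.
Proof.
move=> c0 t /andP[t0 ta]; have [_ _ _ eu _] := hE.
have k1f x : k1 x = 0 -> f x = 0 by exact: unitmx_inj.
have k2g x : k2 x = 0 -> g x = 0 by apply: unitmx_inj; rewrite adj_unit.
case: (leP 0 gam) => [gp|/ltW gn].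
  have z1 x : 0 <= x -> x <= alpha -> f x = 0.
    move=> x0 xa; apply: k1f; apply: nrm2_eq0.
    by have [h _] := k1_mono (lexx 0) x0 xa; have := h gp; rewrite k10 c0 nrm20.
  split; first exact: z1.
  apply: k2g; apply: nrm2_eq0.
  have [_ h] := k2_mono t0 ta (lexx _); apply: le_trans (h gp) _.
  by rewrite /k2 ga -fa z1 ?lexx ?(ltW alpha0) // mulmx0 nrm20.
have z1 x : 0 <= x -> x <= alpha -> g x = 0.
  move=> x0 xa; apply: k2g; apply: nrm2_eq0.
  by have [h _] := k2_mono (lexx 0) x0 xa; have := h gn; rewrite k20 c0 nrm20.
split; last exact: z1.
apply: k1f; apply: nrm2_eq0.
have [_ h] := k1_mono t0 ta (lexx _); apply: le_trans (h gn) _.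
by rewrite /k1 fa -ga z1 ?lexx ?(ltW alpha0) // mulmx0 nrm20.
Qed.

(** Both |k1| and |k2| start at |c| and move in opposite directions, the
    increasing one strictly. *)
Lemma first_order_norm : c != 0 -> gam != 0 -> nrm2 (E alpha *m y) != nrm2 (adj (E alpha) *m y).
Proof.
move=> c0 gam0; have cp := nrm2_gt0 c0.
have e1 : nrm2 (E alpha *m y) = nrm2 (k1 alpha) by rewrite /k1 fa.
have e2 : nrm2 (adj (E alpha) *m y) = nrm2 (k2 alpha) by rewrite /k2 ga.
have a0 := ltW alpha0.
have [m1 m2] := k1_mono (lexx 0) a0 (lexx _); have [m3 m4] := k2_mono (lexx 0) a0 (lexx _).
rewrite k10 in m1 m2; rewrite k20 in m3 m4.
case: (ltgtP gam 0) gam0 => // hgam _.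
  have : nrm2 (k1 0) < nrm2 (k1 alpha).
    apply: (rder_gt0_lt (f := fun x => nrm2 (k1 x)) alpha0 rk1) => t ht.
    rewrite vk1 // !mulr_gt0 ?oppr_gt0 //; apply: Bm_dissipative.
    apply: contraTneq cp => kt; have /andP[t0 ta] := ht.
    have [_ h] := k1_mono (lexx 0) (ltW t0) (ltW ta); have := h (ltW hgam).
    by rewrite kt nrm20 k10 -leNgt.
  rewrite k10 e1 e2 => h; rewrite gt_eqF //; apply: le_lt_trans h.
  exact/m3/ltW.
have : nrm2 (k2 0) < nrm2 (k2 alpha).
  apply: (rder_gt0_lt (f := fun x => nrm2 (k2 x)) alpha0 rk2) => t ht.
  rewrite vk2 // !mulr_gt0 //; apply: Bm_dissipative.
  apply: contraTneq cp => kt; have /andP[t0 ta] := ht.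
  have [_ h] := k2_mono (lexx 0) (ltW t0) (ltW ta); have := h (ltW hgam).
  by rewrite kt nrm20 k20 -leNgt.
rewrite k20 e1 e2 => h; rewrite lt_eqF //; apply: le_lt_trans h.
exact/m1/ltW.
Qed.

Lemma first_order_real : gam = 0 -> E alpha *m y = c /\ adj (E alpha) *m y = c.
Proof.
move=> hgam; split.
  rewrite -[RHS]k10 -[LHS]/(E alpha *m y) -fa -/(k1 alpha); apply/esym.
  apply: (mder_eq0_cst (F := k1) (ltW alpha0) hk1) => t ht.
  by rewrite dk1E // hgam mulr0 scale0r.
rewrite -[RHS]k20 -ga -/(k2 alpha); apply/esym.
apply: (mder_eq0_cst (F := k2) (ltW alpha0) hk2) => t ht.
by rewrite dk2E // hgam mulr0 scale0r.
Qed.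
End WithE.

(** The pairing of g with X = E h f is constant: its logarithmic derivative along
    Bm is conj(lam) + lam - 2 s = 0. *)
Lemma first_order_pairing E h : is_power Z (- (2 * s)) E -> h *m Z = Z *m h ->
  dot y (E alpha *m (h *m y)) = dot c (h *m c).
Proof.
move=> [e0 ed ec _ _] hh.
pose X t := E t *m (h *m f t).
pose dX t := (- (2 * s))%:C *: (Bm t *m E t) *m (h *m f t) + E t *m (h *m df t).
have hX t : 0 <= t <= alpha -> mder X t (dX t).
  by move=> ht; apply: mderM; [exact: ed|apply: mderMl; exact: hf].
have hd t : 0 <= t <= alpha -> cder (fun x => dot (g x) (X x)) t (dot (dg t) (X t) + dot (g t) (dX t)).
  by move=> ht; apply: cder_dot; [exact: hg|exact: hX].
have z t : 0 < t < alpha -> dot (dg t) (X t) + dot (g t) (dX t) = 0.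
  move=> ht; rewrite hdg // dotZl dotMl adjK.
  have -> : dX t = (lam - (2 * s)%:C) *: (Bm t *m X t).
    rewrite /dX hdf // /X; move: (Bm t) (Bm_comm t (ec t)) (Bm_comm t hh) => B hB hB2.
    rewrite -!scalemxAr -scalemxAl (mulmxA h) hB2 !mulmxA hB -!mulmxA -scalerDl.
    congr (_ *: _).
    by rewrite rmorphN addrC.
  rewrite dotZr -mulrDl; have -> : cc lam + (lam - (2 * s)%:C) = 0.
    rewrite /s; case: (lam) => a b; apply/eqP; rewrite eq_complex /=.
    by apply/andP; split; apply/eqP; ring.
  by rewrite mul0r.
have cst (p : C -> R) (hp : p = Re \/ p = Im) : p (dot (g 0) (X 0)) = p (dot (g alpha) (X alpha)).
  apply: (@rder_eq0_cst R (fun x => p (dot (g x) (X x)))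
     (fun t => p (dot (dg t) (X t) + dot (g t) (dX t))) 0 alpha (ltW alpha0)).
    by move=> t ht; have [h1 h2] := hd t ht; case: hp => ->.
  by move=> t ht; rewrite z //; case: hp => ->.
have : dot (g 0) (X 0) = dot (g alpha) (X alpha).
  apply/eqP; rewrite eq_complex; apply/andP.
  by split; apply/eqP; [apply: (cst Re); left|apply: (cst Im); right].
by rewrite /X e0 mul1mx f0 g0 fa ga.
Qed.

End FirstOrder.

(** * Exponents of the first order problem *)

Section Spectrum.
Variable R : realType.
Local Notation C := R[i].
Local Notation Re := (@complex.Re R).
Local Notation Im := (@complex.Im R).
Local Notation cc := (@conjc R).

Lemma cis_int (x : R) : cis (2 * x * pi) = 1 -> exists m : int, x = m%:~R.
Proof.
move=> h; exists (Num.floor x).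
pose d := x - (Num.floor x)%:~R.
have d0 : 0 <= d by rewrite subr_ge0 floor_le_tmp.
have d1 : d < 1 by rewrite ltrBlDl; have := floorD1_gt x; rewrite intrD.
have per (k : nat) (a : R) : cis (a + 2 * k%:R * pi) = cis a.
  elim: k => [|k IH]; first by rewrite mulr0 mul0r addr0.
  have -> : a + 2 * k.+1%:R * pi = (a + 2 * k%:R * pi) + pi *+ 2.
    by rewrite -natr1 mulr2n; ring.
  by rewrite cisD IH /(cis (pi *+ 2)) cos2pi sin2pi mulr1.
have hd : cis (2 * d * pi) = 1.
  rewrite /d -h; case: (Num.floor x) => k.
    rewrite -pmulrn; have -> : 2 * x * pi = 2 * (x - k%:R) * pi + 2 * k%:R * pi by ring.
    by rewrite per.
  rewrite NegzE rmorphN /= opprK -pmulrn; have -> : 2 * (x + k.+1%:R) * pi = 2 * x * pi + 2 * k.+1%:R * pi by ring.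
  by rewrite per.
have [d00|dn0] := eqVneq d 0; first by apply/eqP; rewrite -subr_eq0 -/d d00.
have dp : 0 < d by rewrite lt_neqAle eq_sym dn0.
have sp : 0 < sin (d * pi).
  by apply: sin_gt0_pi; rewrite mulr_gt0 ?pi_gt0 //= -{2}[pi]mul1r ltr_pM2r ?pi_gt0.
move: hd => [+ _]; have -> : 2 * d * pi = (d * pi) *+ 2 by rewrite mulr2n; ring.
rewrite cos_mulr2n => e.
have e2 := cos2Dsin2 (d * pi).
have : sin (d * pi) ^+ 2 = 0 by move: e; rewrite mulr2n; lra.
by move/eqP; rewrite sqrf_eq0 gt_eqF.
Qed.

Variables (n : nat) (Z : 'M[C]_n).
Hypothesis hZ : dissipative Z.
Variables (lam : C) (alpha : R) (f g df dg : R -> 'cV[C]_n) (c y : 'cV[C]_n).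
Hypothesis alpha0 : 0 < alpha.
Hypothesis hf : forall t, 0 <= t <= alpha -> mder f t (df t).
Hypothesis hg : forall t, 0 <= t <= alpha -> mder g t (dg t).
Hypothesis hdf : forall t, 0 < t < alpha -> df t = lam *: (Bm Z t *m f t).
Hypothesis hdg : forall t, 0 < t < alpha -> dg t = lam *: (adj (Bm Z t) *m g t).
Hypotheses (f0 : f 0 = c) (g0 : g 0 = c) (fa : f alpha = y) (ga : g alpha = y).
Hypotheses (c0 : c != 0) (lam0 : lam != 0).

Let s := Re lam.
Let pairing := first_order_pairing hZ alpha0 hf hg hdf hdg f0 g0 fa ga.
Let norm := first_order_norm hZ alpha0 hf hg hdf hdg f0 g0 fa ga.
Let real_case := first_order_real hZ alpha0 hf hg hdf hdg f0 g0 fa ga.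

Let s0_false : s != 0.
Proof.
apply/eqP => s0.
have gam0 : Im lam != 0.
  apply: contra lam0 => /eqP h; rewrite eq_complex -[Re lam]/s s0 h eqxx //.
have hE : is_power Z (- s) (fun=> 1%:M) by rewrite s0 oppr0; exact: is_power0.
by have := norm hE c0 gam0; rewrite adj1 !mul1mx eqxx.
Qed.

Lemma power_fun_inj t E F : is_power Z t E -> is_power Z t F -> forall x, E x = F x.
Proof.
move=> hE hF x; have := is_power_mul hZ (is_power0 Z) hE hF (esym (add0r t)) x.
by rewrite mul1mx.
Qed.

Lemma Im_dot_power_opp t E F x k : 0 < t <= 1 -> is_power Z t E -> is_power Z (- t) F -> 0 < x < pi ->
  Im (dot k (F x *m k)) <= 0 /\ (k != 0 -> Im (dot k (F x *m k)) < 0).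
Proof.
move=> ht hE hF hx.
have EF : E x *m F x = 1%:M by apply: (is_power_mul hZ hE hF (is_power0 Z)); rewrite subrr.
pose d := F x *m k; have ek : k = E x *m d by rewrite /d mulmxA EF mul1mx.
have -> : Im (dot k (F x *m k)) = - Im (dot d (E x *m d)).
  by rewrite -/d {1}ek dotC; case: (dot d _).
have hd := power_dissipative hZ ht hE hx.
have hneg : d != 0 -> - Im (dot d (E x *m d)) < 0 by move=> d0; rewrite oppr_lt0; exact: hd.
split.
  have [->|/hneg /ltW //] := eqVneq d 0; by rewrite mulmx0 dot0r oppr0.
move=> k0; apply: hneg; apply: contra k0 => /eqP d0; by rewrite ek d0 mulmx0.
Qed.

(** The pairing with h = Tm^s at alpha reads (y, Tm^-s y) = (c, Tm^s c); for
    0 < |s| <= 1 the imaginary parts of the two sides have opposite signs. *)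
Lemma spectrum_convex : alpha < pi -> 1 < `|s|.
Proof.
move=> api; rewrite ltNge; apply/negP => s1.
have ha : 0 < alpha < pi by rewrite alpha0.
have [E hE] := is_power_exists hZ s; have [F hF] := is_power_exists hZ (- s).
have [H hH] := is_power_exists hZ (- (2 * s)).
have hc : E alpha *m Z = Z *m E alpha by case: hE.
have HE : H alpha *m E alpha = F alpha.
  by apply: (is_power_mul hZ hH hE hF); ring.
have := pairing hH hc; rewrite mulmxA HE => e.
case: (ltgtP s 0) s0_false => // hs _.
  have ht : 0 < - s <= 1 by rewrite oppr_gt0 hs /=; move: s1; rewrite ltr0_norm.
  have hE' : is_power Z (- - s) E by rewrite opprK.
  have [_ h] := Im_dot_power_opp c ht hF hE' ha; have := h c0; rewrite -e.
  have [->|y0] := eqVneq y 0; first by rewrite mulmx0 dot0r ltxx.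
  by have := power_dissipative hZ ht hF ha y0; lra.
have ht : 0 < s <= 1 by rewrite hs /=; move: s1; rewrite gtr0_norm.
have [h _] := Im_dot_power_opp y ht hE hF ha; rewrite e in h.
by have := power_dissipative hZ ht hE ha c0; lra.
Qed.

(** Tm^t at alpha is e^(i pi t) times Tm^t at alpha - pi, and a point of the upper
    half plane rotated by an angle in ]0, pi] is not a nonnegative real. *)
Lemma dot_power_reentrant_neq t E k : 0 < t <= 1 -> is_power Z t E -> pi < alpha < 2 * pi ->
  k != 0 -> forall r : R, 0 <= r -> dot k (E alpha *m k) != r%:C.
Proof.
move=> ht hE /andP[a1 a2] k0 r r0.
have hb : 0 < alpha - pi < pi by rewrite subr_gt0 a1 /= ltrBlDr; lra.
have -> : alpha = (alpha - pi) + pi by rewrite subrK.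
have [_ _ _ _ ->] := hE; rewrite -scalemxAl dotZr.
have := power_dissipative hZ ht hE hb k0.
case: (dot k _) => u v /= v0; apply/eqP => -[e1 e2].
have /andP[t0 t1] := ht.
have sn : 0 <= sin (t * pi).
  by apply: sin_ge0_pi; rewrite mulr_ge0 ?pi_ge0 ?(ltW t0) //= -{2}[pi]mul1r ler_pM2r ?pi_gt0.
have := cos2Dsin2 (t * pi) => e.
have ev : v = - sin (t * pi) * r.
  rewrite -[v]mul1r -e -e1.
  have -> : - sin (t * pi) * (cos (t * pi) * u - sin (t * pi) * v) = 
     sin (t * pi) ^+ 2 * v - cos (t * pi) * (sin (t * pi) * u) by ring.
  have -> : sin (t * pi) * u = - (cos (t * pi) * v) by lra.
  by ring.
by move: v0; rewrite ev mulNr oppr_gt0 ltNge mulr_ge0.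
Qed.

(** The pairing with h = Tm^(2s) at alpha if s > 0, and with h = 1 if s < 0,
    equates a squared norm with a value excluded by dot_power_reentrant_neq. *)
Lemma spectrum_reentrant : pi < alpha < 2 * pi -> 2^-1 < `|s|.
Proof.
move=> ha; rewrite ltNge; apply/negP => s1.
have [E hE] := is_power_exists hZ (2 * s).
have [H hH] := is_power_exists hZ (- (2 * s)).
have hc : E alpha *m Z = Z *m E alpha by case: hE.
have HE : H alpha *m E alpha = 1%:M.
  by apply: (is_power_mul hZ hH hE (is_power0 Z)); ring.
case: (ltgtP s 0) s0_false => // hs _.
  have ht : 0 < - (2 * s) <= 1.
    by rewrite oppr_gt0 pmulr_rlt0 // hs /=; move: s1; rewrite ltr0_norm //; lra.
  have := pairing hH (esym (etrans (mulmx1 Z) (esym (mul1mx Z)))).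
  rewrite !mul1mx => e.
  have y0 : y != 0.
    apply/eqP => y0; move: e; rewrite y0 mulmx0 dot0r dotxxE => -[e1].
    by have := nrm2_gt0 c0; rewrite /nrm2 -e1 ltxx.
  by have := dot_power_reentrant_neq ht hH ha y0 (dot_ge0 c); rewrite e -dotxxE eqxx.
have ht : 0 < 2 * s <= 1.
  by rewrite mulr_gt0 //=; move: s1; rewrite gtr0_norm //; lra.
have := pairing hH hc; rewrite mulmxA HE mul1mx => e.
by have := dot_power_reentrant_neq ht hE ha c0 (dot_ge0 y); rewrite -e -dotxxE eqxx.
Qed.

Lemma nrm2_cis t (x : 'cV[C]_n) : nrm2 (cis t *: x) = nrm2 x.
Proof. by rewrite nrm2Z csq_cis mul1r. Qed.

Lemma cc_cis t : cc (cis t) = cis (- t).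
Proof. by rewrite /cis cosN sinN. Qed.

(** A scalar of modulus 1 and its adjoint preserve norms, which first_order_norm
    forbids unless lam is real; then e^(-it) y = c = e^(it) y. *)
Lemma spectrum_unimodular t E : is_power Z (- s) E -> E alpha = cis (- t) *: 1%:M ->
  Im lam = 0 /\ cis (t + t) = 1.
Proof.
move=> hE eE.
have h1 x : E alpha *m x = cis (- t) *: x by rewrite eE -scalemxAl mul1mx.
have h2 x : adj (E alpha) *m x = cis t *: x by rewrite eE adjZ adj1 -scalemxAl mul1mx cc_cis opprK.
have lr : Im lam = 0.
  apply/eqP; apply: contraT => gam0.
  by have := norm hE c0 gam0; rewrite h1 h2 !nrm2_cis eqxx.
split=> //; have [] := real_case hE lr; rewrite h1 h2 => e1 e2.
have y0 : y != 0 by apply: contra c0 => /eqP y0; rewrite -e1 y0 scaler0.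
have : (cis t - cis (- t)) *: y = 0 by rewrite scalerBl e1 e2 subrr.
move/eqP; rewrite scaler_eq0 (negbTE y0) orbF subr_eq0 => /eqP e.
by rewrite cisD {1}e -cisD addNr cis0.
Qed.

Lemma spectrum_flat : alpha = pi -> exists m : int, lam = m%:~R.
Proof.
move=> ea; have [E hE] := is_power_exists hZ (- s).
have eE : E alpha = cis (- (s * pi)) *: 1%:M.
  by have [e0 _ _ _ ep] := hE; have := ep 0; rewrite add0r -ea e0 mulNr.
have [lr h] := spectrum_unimodular hE eE.
have [|m em] := @cis_int s; first by rewrite -h; congr cis; ring.
exists m; have -> : lam = s%:C by rewrite /s; case: (lam) lr => a b /= ->.
by rewrite em; exact: rmorph_int.
Qed.

Lemma spectrum_crack : alpha = 2 * pi -> exists m : int, lam = m%:~R / 2.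
Proof.
move=> ea; have [E hE] := is_power_exists hZ (- s).
have eE : E alpha = cis (- (2 * s * pi)) *: 1%:M.
  have [e0 _ _ _ ep] := hE; have := ep pi; have := ep 0; rewrite add0r => -> e.
  rewrite ea; have -> : 2 * pi = pi + pi :> R by ring.
  by rewrite e scalerA -cisD e0; congr (cis _ *: _); ring.
have [lr h] := spectrum_unimodular hE eE.
have [|m em] := @cis_int (2 * s); first by rewrite -h; congr cis; ring.
exists m; have -> : lam = s%:C by rewrite /s; case: (lam) lr => a b /= ->.
have -> : s = m%:~R / 2 by rewrite -em mulrC mulKf // pnatr_eq0.
by rewrite rmorphM fmorphV /= rmorph_int rmorph_nat.
Qed.

End Spectrum.

(** * Reduction of the model problem to first order *)

Section Reduction.
Variable R : realType.
Local Notation C := R[i].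
Local Notation Re := (@complex.Re R).
Local Notation Im := (@complex.Im R).

(** The first partial derivatives of r^mu w(phi), up to the factor r^(mu - 1);
    dw stands for the derivative of w. *)
Definition polar1 n (mu : C) (w dw : R -> 'cV[C]_n) (t : R) : 'cV[C]_n :=
  (mu * (cos t)%:C) *: w t - (sin t)%:C *: dw t.
Definition polar2 n (mu : C) (w dw : R -> 'cV[C]_n) (t : R) : 'cV[C]_n :=
  (mu * (sin t)%:C) *: w t + (cos t)%:C *: dw t.
Definition dpolar1 n (mu : C) (w dw ddw : R -> 'cV[C]_n) (t : R) : 'cV[C]_n :=
  (- (mu * (sin t)%:C)) *: w t + (mu * (cos t)%:C) *: dw t
  - ((cos t)%:C *: dw t + (sin t)%:C *: ddw t).
Definition dpolar2 n (mu : C) (w dw ddw : R -> 'cV[C]_n) (t : R) : 'cV[C]_n :=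
  (mu * (cos t)%:C) *: w t + (mu * (sin t)%:C) *: dw t
  + ((- sin t)%:C *: dw t + (cos t)%:C *: ddw t).

Lemma cder_cosC (t : R) : cder (fun x => (cos x)%:C) t (- sin t)%:C.
Proof. exact/cder_real/is_derive_cos. Qed.
Lemma cder_sinC (t : R) : cder (fun x => (sin x)%:C) t (cos t)%:C.
Proof. exact/cder_real/is_derive_sin. Qed.

Lemma mder_polar1 n mu (w dw ddw : R -> 'cV[C]_n) t : mder w t (dw t) -> mder dw t (ddw t) ->
  mder (polar1 mu w dw) t (dpolar1 mu w dw ddw t).
Proof.
move=> h1 h2.
apply: mder_val (mderB (mderZ (cderM (cder_cst mu t) (cder_cosC t)) h1) (mderZ (cder_sinC t) h2)) _.
by rewrite /dpolar1 mul0r add0r rmorphN /= mulrN.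
Qed.

Lemma mder_polar2 n mu (w dw ddw : R -> 'cV[C]_n) t : mder w t (dw t) -> mder dw t (ddw t) ->
  mder (polar2 mu w dw) t (dpolar2 mu w dw ddw t).
Proof.
move=> h1 h2.
apply: mder_val (mderD (mderZ (cderM (cder_cst mu t) (cder_sinC t)) h1) (mderZ (cder_cosC t) h2)) _.
by rewrite /dpolar2 mul0r add0r.
Qed.

Lemma cos2Dsin2C (t : R) : (cos t)%:C ^+ 2 + (sin t)%:C ^+ 2 = 1 :> C.
Proof. by rewrite -!rmorphXn -rmorphD /= cos2Dsin2. Qed.

Lemma scale_pred m n (a : C) (x : 'M[C]_(m, n)) : x + (a - 1) *: x = a *: x.
Proof. by rewrite scalerBl scale1r addrC subrK. Qed.

Section Generic.
Variables (n : nat) (Z : 'M[C]_n) (t : R).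

Lemma Tm_mul (x : 'cV[C]_n) : Tm Z t *m x = (cos t)%:C *: x + (sin t)%:C *: (Z *m x).
Proof. by rewrite /Tm mulmxDl mul_scalar_mx -scalemxAl. Qed.

Lemma Tm'_mul (x : 'cV[C]_n) : Tm' Z t *m x = - (sin t)%:C *: x + (cos t)%:C *: (Z *m x).
Proof. by rewrite /Tm' mulmxDl mul_scalar_mx -scalemxAl rmorphN. Qed.

Lemma adj_Tm_mul (x : 'cV[C]_n) :
  adj (Tm Z t) *m x = (cos t)%:C *: x + (sin t)%:C *: (adj Z *m x).
Proof.
by rewrite /Tm adjD adjZ cjR -scalemx1 adjZ adj1 cjR mulmxDl -!scalemxAl mul1mx.
Qed.

Lemma adj_Tm'_mul (x : 'cV[C]_n) :
  adj (Tm' Z t) *m x = - (sin t)%:C *: x + (cos t)%:C *: (adj Z *m x).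
Proof.
by rewrite /Tm' adjD adjZ cjR -scalemx1 adjZ adj1 cjR mulmxDl -!scalemxAl mul1mx rmorphN.
Qed.

Lemma adj_Bm_mul (x : 'cV[C]_n) : dissipative Z ->
  adj (Bm Z t) *m (adj (Tm Z t) *m x) = adj (Tm' Z t) *m x.
Proof.
move=> hZ; have -> : Bm Z t = invmx (Tm Z t) *m Tm' Z t.
  rewrite /Bm; apply: mul_invmx_comm; first exact: Tm_unit.
  by apply: Tm_comm; apply/esym/Tm'_comm.
by rewrite mulmxA -adjM mulKVmx ?Tm_unit.
Qed.

Lemma Tm_pair (x y : 'cV[C]_n) : Tm Z t *m x - adj (Tm Z t) *m y =
  (cos t)%:C *: (x - y) + (sin t)%:C *: (Z *m x - adj Z *m y).
Proof. by rewrite Tm_mul adj_Tm_mul opprD addrACA -!scalerBr. Qed.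

Lemma Tm'_pair (x y : 'cV[C]_n) : Tm' Z t *m x - adj (Tm' Z t) *m y =
  - (sin t)%:C *: (x - y) + (cos t)%:C *: (Z *m x - adj Z *m y).
Proof. by rewrite Tm'_mul adj_Tm'_mul opprD addrACA -!scalerBr. Qed.

Lemma polar_radial mu (w dw : R -> 'cV[C]_n) :
  (cos t)%:C *: polar1 mu w dw t + (sin t)%:C *: polar2 mu w dw t = mu *: w t.
Proof.
rewrite /polar1 /polar2; have := cos2Dsin2C t.
move: (cos t)%:C (sin t)%:C (w t) (dw t) => c s x y e.
rewrite -[RHS]scale1r -e; apply/matrixP => i j; rewrite !mxE; ring.
Qed.

Lemma polar_angular mu (w dw : R -> 'cV[C]_n) :
  - (sin t)%:C *: polar1 mu w dw t + (cos t)%:C *: polar2 mu w dw t = dw t.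
Proof.
rewrite /polar1 /polar2; have := cos2Dsin2C t.
move: (cos t)%:C (sin t)%:C (w t) (dw t) => c s x y e.
rewrite -[RHS]scale1r -e; apply/matrixP => i j; rewrite !mxE; ring.
Qed.

(** Up to a power of r, the right-hand side is the operator d2 - Z d1 applied to
    r^mu F: it vanishes when F behaves as Tm^mu. *)
Lemma defectE mu (F dF : R -> 'cV[C]_n) :
  Tm Z t *m dF t - mu *: (Tm' Z t *m F t) = polar2 mu F dF t - Z *m polar1 mu F dF t.
Proof.
rewrite Tm_mul Tm'_mul /polar2 /polar1 mulmxBr -!scalemxAr.
move: (cos t)%:C (sin t)%:C (F t) (dF t) (Z *m _) (Z *m _) => c s x y a b.
apply/matrixP => i j; rewrite !mxE; ring.
Qed.

Lemma adj_defectE mu (F dF : R -> 'cV[C]_n) :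
  adj (Tm Z t) *m dF t - mu *: (adj (Tm' Z t) *m F t) =
  polar2 mu F dF t - adj Z *m polar1 mu F dF t.
Proof.
rewrite (adj_Tm_mul (dF t)) (adj_Tm'_mul (F t)) /polar2 /polar1 mulmxBr -!scalemxAr.
move: (cos t)%:C (sin t)%:C (F t) (dF t) (adj Z *m _) (adj Z *m _) => c s x y a b.
apply/matrixP => i j; rewrite !mxE; ring.
Qed.

Lemma polar_linear1 mu (A : 'M[C]_n) (w dw : R -> 'cV[C]_n) :
  A *m polar1 mu w dw t = polar1 mu (fun x => A *m w x) (fun x => A *m dw x) t.
Proof. by rewrite /polar1 mulmxBr -!scalemxAr. Qed.

Lemma polar_linear2 mu (A : 'M[C]_n) (w dw : R -> 'cV[C]_n) :
  A *m polar2 mu w dw t = polar2 mu (fun x => A *m w x) (fun x => A *m dw x) t.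
Proof. by rewrite /polar2 mulmxDr -!scalemxAr. Qed.

Lemma polarB1 mu (w dw w' dw' x dx : R -> 'cV[C]_n) :
  x t = w t - w' t -> dx t = dw t - dw' t ->
  polar1 mu x dx t = polar1 mu w dw t - polar1 mu w' dw' t.
Proof.
by rewrite /polar1 => -> ->; apply/matrixP => i j; rewrite !mxE; ring.
Qed.

Lemma polarB2 mu (w dw w' dw' x dx : R -> 'cV[C]_n) :
  x t = w t - w' t -> dx t = dw t - dw' t ->
  polar2 mu x dx t = polar2 mu w dw t - polar2 mu w' dw' t.
Proof.
by rewrite /polar2 => -> ->; apply/matrixP => i j; rewrite !mxE; ring.
Qed.

Lemma polar_compat mu (v v1 v2 : R -> 'cV[C]_n) :
  polar2 (mu - 1) (polar1 mu v v1) (dpolar1 mu v v1 v2) t =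
  polar1 (mu - 1) (polar2 mu v v1) (dpolar2 mu v v1 v2) t.
Proof.
rewrite /polar2 /polar1 /dpolar1 /dpolar2 rmorphN /=.
move: (cos t)%:C (sin t)%:C (v t) (v1 t) (v2 t) => c s x x1 x2.
by apply/matrixP => i j; rewrite !mxE; ring.
Qed.

(** A gradient p = F - G, q = Z F - adj(Z) G satisfies d2 p = d1 q, which makes
    the defects of F and of G equal to one vector X; as Z and adj Z solve the
    quadratic equation, the differential equation becomes a22 (Z - adj Z) X = 0. *)
Lemma polar_defect_zero mu (a11 a12 a22 : 'M[C]_n) (F dF G dG p dp q dq : R -> 'cV[C]_n) :
  (forall x : 'cV[C]_n, (Z - adj Z) *m x = 0 -> x = 0) -> a22 \in unitmx ->
  a11 + (a12 + a12) *m Z + a22 *m Z *m Z = 0 ->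
  a11 + (a12 + a12) *m adj Z + a22 *m adj Z *m adj Z = 0 ->
  p t = F t - G t -> dp t = dF t - dG t ->
  q t = Z *m F t - adj Z *m G t -> dq t = Z *m dF t - adj Z *m dG t ->
  polar2 mu p dp t = polar1 mu q dq t ->
  a11 *m polar1 mu p dp t + a12 *m polar1 mu q dq t
  + a12 *m polar2 mu p dp t + a22 *m polar2 mu q dq t = 0 ->
  Tm Z t *m dF t = mu *: (Tm' Z t *m F t) /\
  adj (Tm Z t) *m dG t = mu *: (adj (Tm' Z t) *m G t).
Proof.
move=> ZZ a22u eZ eZ' pE dpE qE dqE compat h.
have pF1 := polarB1 mu pE dpE; have pF2 := polarB2 mu pE dpE.
have qF1 : polar1 mu q dq t = Z *m polar1 mu F dF t - adj Z *m polar1 mu G dG t.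
  by rewrite !polar_linear1; apply: polarB1.
have qF2 : polar2 mu q dq t = Z *m polar2 mu F dF t - adj Z *m polar2 mu G dG t.
  by rewrite !polar_linear2; apply: polarB2.
have eF := defectE mu F dF; have eG := adj_defectE mu G dG.
suff [h1 h2] : polar2 mu F dF t - Z *m polar1 mu F dF t = 0 /\
    polar2 mu G dG t - adj Z *m polar1 mu G dG t = 0.
  by split; apply/eqP; rewrite -subr_eq0; apply/eqP; rewrite ?eF ?eG.
move: compat h; rewrite qF1 qF2 pF1 pF2 => {eF eG qF1 qF2 pF1 pF2}.
move: (polar1 mu F dF t) (polar1 mu G dG t) (polar2 mu F dF t) (polar2 mu G dG t).
move=> F1 G1 F2 G2 compat h.
have eX : F2 - Z *m F1 = G2 - adj Z *m G1.
  have -> : F2 = Z *m F1 - adj Z *m G1 + G2 by rewrite -compat subrK.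
  by move: (Z *m F1) (adj Z *m G1) => a b; apply/matrixP => i j; rewrite !mxE; ring.
suff X0 : F2 - Z *m F1 = 0 by rewrite -eX.
have eF2 : F2 = F2 - Z *m F1 + Z *m F1 by rewrite subrK.
have eG2 : G2 = F2 - Z *m F1 + adj Z *m G1 by rewrite eX subrK.
move: eF2 eG2 h; move: (F2 - Z *m F1) => X -> ->.
have h1 : a11 *m F1 + (a12 + a12) *m (Z *m F1) + a22 *m (Z *m (Z *m F1)) = 0.
  by rewrite -[RHS](mul0mx _ F1) -eZ !mulmxDl !mulmxA.
have h2 : a11 *m G1 + (a12 + a12) *m (adj Z *m G1) + a22 *m (adj Z *m (adj Z *m G1)) = 0.
  by rewrite -[RHS](mul0mx _ G1) -eZ' !mulmxDl !mulmxA.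
move=> h; apply: ZZ; apply: (unitmx_inj a22u).
rewrite -[RHS]h -[LHS]addr0 -[X in _ + X]subr0 -{1}h1 -{}h2 {h h1 compat eX}.
rewrite mulmxBl !(mulmxDr, mulmxN, mulmxDl).
move: (a11 *m F1) (a11 *m G1) (a12 *m X) (a22 *m (Z *m X)) (a22 *m (adj Z *m X)).
move: (a12 *m (Z *m F1)) (a12 *m (adj Z *m G1)) (a22 *m _) (a22 *m _) => *.
by apply/matrixP => i j; rewrite !mxE; ring.
Qed.
End Generic.

Variables (n : nat) (Z : 'M[C]_n).
Hypothesis hZ : dissipative Z.
Variables a11 a12 a22 : 'M[C]_n.
Hypothesis a22u : a22 \in unitmx.
Hypothesis eZ : a11 + (a12 + a12) *m Z + a22 *m Z *m Z = 0.
Hypothesis eZ' : a11 + (a12 + a12) *m adj Z + a22 *m adj Z *m adj Z = 0.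
Variables (lam : C) (alpha : R) (V dV ddV : R -> 'cV[C]_n).
Hypothesis alpha0 : 0 < alpha.
Hypothesis hV : forall t, mder V t (dV t).
Hypothesis hdV : forall t, mder dV t (ddV t).
Let p := polar1 lam V dV.
Let q := polar2 lam V dV.
Let dp := dpolar1 lam V dV ddV.
Let dq := dpolar2 lam V dV ddV.
Hypothesis pde : forall t, 0 < t < alpha ->
  a11 *m polar1 (lam - 1) p dp t + a12 *m polar1 (lam - 1) q dq t
  + a12 *m polar2 (lam - 1) p dp t + a22 *m polar2 (lam - 1) q dq t = 0.
Hypotheses (V0 : V 0 = 0) (Va : V alpha = 0).
Hypothesis Vn0 : exists2 t, 0 <= t <= alpha & V t != 0.

Let hp t : mder p t (dp t). Proof. exact: mder_polar1. Qed.
Let hq t : mder q t (dq t). Proof. exact: mder_polar2. Qed.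

Lemma unit_sub_adj : Z - adj Z \in unitmx.
Proof.
apply: unitmx_ker => x h; apply/eqP; apply: contraT => /hZ.
have : dot x ((Z - adj Z) *m x) = 0 by rewrite h dot0r.
rewrite mulmxBl dotBr (dotMr (adj Z)) adjK (dotC x).
case: (dot _ _) => a b [_ +] /=; rewrite opprK -mulr2n => /eqP.
by rewrite mulrn_eq0 /= => /eqP ->; rewrite ltxx.
Qed.

(* F and G decompose the gradient (p, q) as (F - G, Z F - adj(Z) G). *)
Let D := invmx (Z - adj Z).
Let F t := D *m (q t - adj Z *m p t).
Let G t := D *m (q t - Z *m p t).
Let dF t := D *m (dq t - adj Z *m dp t).
Let dG t := D *m (dq t - Z *m dp t).

Let hF t : mder F t (dF t).
Proof. by apply/mderMl/mderB; [exact: hq|apply: mderMl; exact: hp]. Qed.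
Let hG t : mder G t (dG t).
Proof. by apply/mderMl/mderB; [exact: hq|apply: mderMl; exact: hp]. Qed.

Let FG (x y : 'cV[C]_n) : D *m (y - adj Z *m x) - D *m (y - Z *m x) = x.
Proof.
rewrite -mulmxBr; have -> : y - adj Z *m x - (y - Z *m x) = (Z - adj Z) *m x.
  by rewrite mulmxBl; apply/matrixP => i j; rewrite ![in LHS]mxE ![in RHS]mxE; ring.
by rewrite mulKmx // unit_sub_adj.
Qed.

Let ZFG (x y : 'cV[C]_n) : Z *m (D *m (y - adj Z *m x)) - adj Z *m (D *m (y - Z *m x)) = y.
Proof.
have e : D *m (y - adj Z *m x) = x + D *m (y - Z *m x).
  by apply/eqP; rewrite -subr_eq; apply/eqP; exact: FG.
rewrite e mulmxDr -addrA -mulmxBl /D mulKVmx ?unit_sub_adj //.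
by rewrite addrC subrK.
Qed.

Let pE t : p t = F t - G t. Proof. by rewrite /F /G FG. Qed.
Let qE t : q t = Z *m F t - adj Z *m G t. Proof. by rewrite /F /G ZFG. Qed.
Let dpE t : dp t = dF t - dG t. Proof. by rewrite /dF /dG FG. Qed.
Let dqE t : dq t = Z *m dF t - adj Z *m dG t. Proof. by rewrite /dF /dG ZFG. Qed.

Let lamV t : lam *: V t = Tm Z t *m F t - adj (Tm Z t) *m G t.
Proof. by rewrite Tm_pair -pE -qE polar_radial. Qed.

Let dVE t : dV t = Tm' Z t *m F t - adj (Tm' Z t) *m G t.
Proof. by rewrite Tm'_pair -pE -qE polar_angular. Qed.

Let DF0 t : 0 < t < alpha -> Tm Z t *m dF t = (lam - 1) *: (Tm' Z t *m F t) /\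
  adj (Tm Z t) *m dG t = (lam - 1) *: (adj (Tm' Z t) *m G t).
Proof.
move=> ht; apply: (polar_defect_zero _ a22u eZ eZ' (pE t) (dpE t) (qE t) (dqE t) _ (pde ht)).
  by move=> x; exact: unitmx_inj unit_sub_adj.
exact: polar_compat.
Qed.

Let f t := Tm Z t *m F t.
Let g t := adj (Tm Z t) *m G t.
Let df t := Tm' Z t *m F t + Tm Z t *m dF t.
Let dg t := adj (Tm' Z t) *m G t + adj (Tm Z t) *m dG t.

Let hf t : 0 <= t <= alpha -> mder f t (df t).
Proof. by move=> _; apply: mderM; [exact: mder_Tm|exact: hF]. Qed.
Let hg t : 0 <= t <= alpha -> mder g t (dg t).
Proof. by move=> _; apply: mderM; [exact/mder_adj/mder_Tm|exact: hG]. Qed.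

Let BF t : Bm Z t *m f t = Tm' Z t *m F t.
Proof. by rewrite /Bm /f mulmxA mulmxKV ?Tm_unit. Qed.

Let BG t : adj (Bm Z t) *m g t = adj (Tm' Z t) *m G t.
Proof. exact: adj_Bm_mul. Qed.

Let hdf t : 0 < t < alpha -> df t = lam *: (Bm Z t *m f t).
Proof.
move=> ht; have [h _] := DF0 ht.
by apply: (etrans (congr1 _ h)); rewrite BF; exact: scale_pred.
Qed.

Let hdg t : 0 < t < alpha -> dg t = lam *: (adj (Bm Z t) *m g t).
Proof.
move=> ht; have [_ h] := DF0 ht.
by apply: (etrans (congr1 _ h)); rewrite BG; exact: scale_pred.
Qed.

Let fg t : lam *: V t = f t - g t. Proof. exact: lamV. Qed.

Let fg_eq t : V t = 0 -> g t = f t.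
Proof. by move=> v0; apply/esym/eqP; rewrite -subr_eq0 -fg v0 scaler0. Qed.

(** If lam = 0, then f = g is a constant k and V' = (Bm - adj Bm) k.  Unless k is 0,
    Im (k, V) increases strictly, although V vanishes at both ends. *)
Lemma reduction_lam_neq0 : lam != 0.
Proof.
apply/eqP => lam0.
have fgt t : g t = f t by apply/esym/eqP; rewrite -subr_eq0 -fg lam0 scale0r.
have dfe t : 0 < t < alpha -> df t = 0 by move=> ht; rewrite hdf // lam0 scale0r.
pose k := f 0.
have fk t : 0 <= t <= alpha -> f t = k.
  move=> /andP[t0 ta]; apply/esym; apply: (mder_eq0_cst (F := f) t0).
    by move=> x /andP[x0 xt]; apply: hf; rewrite x0 (le_trans xt).
  by move=> x /andP[x0 xt]; apply: dfe; rewrite x0 (lt_le_trans xt).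
have dVk t : 0 <= t <= alpha -> dV t = (Bm Z t - adj (Bm Z t)) *m k.
  by move=> ht; rewrite dVE -BF -BG fgt fk // mulmxBl.
have [k0|k0] := eqVneq k 0.
  have [t /andP[t0 ta]] := Vn0; rewrite -V0 => /eqP; apply; apply/esym.
  apply: (mder_eq0_cst (F := V) (dF := dV) t0) => // x /andP[x0 xt].
  by rewrite dVk ?k0 ?mulmx0 // (ltW x0) (le_trans (ltW xt)).
have : Im (dot k (V 0)) < Im (dot k (V alpha)).
  apply: (rder_gt0_lt (f := fun x => Im (dot k (V x))) (df := fun x => Im (dot k (dV x))) alpha0).
    by move=> t ht; have [_ h] := cder_dot (mder_cst k t) (hV t); rewrite dot0l add0r in h.
  move=> t /andP[t0 ta]; rewrite dVk ?(ltW t0) ?(ltW ta) // mulmxBl dotBr (dotMr (adj (Bm Z t))) adjK (dotC k).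
  have := Bm_dissipative hZ t k0; case: (dot k _) => a b /=; lra.
by rewrite V0 Va ltxx.
Qed.

Lemma reduction_c_neq0 : f 0 != 0.
Proof.
apply/eqP => f00.
have [E hE] := is_power_exists hZ (- Re lam).
have [t ht vt] := Vn0.
have [ft gt0] := first_order_zero hZ alpha0 hf hg hdf hdg (erefl _) (fg_eq V0) (erefl _) (fg_eq Va) hE f00 ht.
have := fg t; rewrite ft gt0 subr0 => /eqP; rewrite scaler_eq0 (negbTE reduction_lam_neq0) /=.
by rewrite (negbTE vt).
Qed.

Lemma reduction :
  [/\ lam != 0,
      alpha < pi -> 1 < `|Re lam|,
      pi < alpha < 2 * pi -> 2^-1 < `|Re lam|,
      alpha = pi -> exists m : int, lam = m%:~R &
      alpha = 2 * pi -> exists m : int, lam = m%:~R / 2].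
Proof.
have l0 := reduction_lam_neq0; have c0 := reduction_c_neq0.
have g0 := fg_eq V0; have ga := fg_eq Va.
split; first exact: l0.
- exact: (spectrum_convex hZ alpha0 hf hg hdf hdg (erefl _) g0 (erefl _) ga c0 l0).
- exact: (spectrum_reentrant hZ alpha0 hf hg hdf hdg (erefl _) g0 (erefl _) ga c0 l0).
- exact: (spectrum_flat hZ alpha0 hf hg hdf hdg (erefl _) g0 (erefl _) ga c0).
- exact: (spectrum_crack hZ alpha0 hf hg hdf hdg (erefl _) g0 (erefl _) ga c0).
Qed.

End Reduction.

(** * Polar coordinates *)

Section Polar.
Variable R : realType.
Local Notation C := R[i].
Local Notation Re := (@complex.Re R).
Local Notation Im := (@complex.Im R).
Variable n : nat.
Implicit Types (U : R -> R -> 'cV[C]_n) (w dw : R -> 'cV[C]_n).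

Lemma mder_comp (w : R -> 'cV[C]_n) (th : R -> R) t d e : mder w (th t) d -> rder th t e ->
  mder (fun x => w (th x)) t (e%:C *: d).
Proof.
move=> hw hth i j; have [h1 h2] := hw i j; rewrite mxE; split.
  by apply: rder_val (rder_comp h1 hth) _; rewrite Re_mul /= mul0r subr0 mulrC.
by apply: rder_val (rder_comp h2 hth) _; rewrite Im_mul /= mul0r addr0 mulrC.
Qed.

Lemma cpowE r mu : cpow r mu = (expR (Re mu * ln r))%:C * cis (Im mu * ln r) :> C.
Proof.
by rewrite /cpow /cis; apply/eqP; rewrite eq_complex /= !mul0r subr0 addr0 !eqxx.
Qed.

Lemma cpow_neq0 r mu : cpow r mu != 0 :> C.
Proof.
rewrite cpowE mulf_neq0 //; first by rewrite eq_complex /= eqxx andbT gt_eqF ?expR_gt0.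
apply/eqP => c0; have := csq_cis (Im mu * ln r); rewrite c0 /csq /= !expr0n addr0.
by move/eqP; rewrite eq_sym oner_eq0.
Qed.

Lemma cpow_pred r mu : 0 < r -> cpow r (mu - 1) = cpow r mu * (r^-1)%:C :> C.
Proof.
move=> r0; rewrite !cpowE Re_add Im_add Re_opp Im_opp /= subr0 mulrBl mul1r expRD expRN lnK //.
by rewrite rmorphM /= mulrAC.
Qed.

Lemma cder_cpow (r : R -> R) t dr mu : 0 < r t -> rder r t dr ->
  cder (fun x => cpow (r x) mu) t (mu * (dr / r t)%:C * cpow (r t) mu).
Proof.
move=> r0 hr.
have hl : rder (fun x => ln (r x)) t (dr / r t).
  by apply: rder_val (rder_comp (is_derive1_ln r0) hr) _; rewrite mulrC.
have he : rder (fun x => expR (Re mu * ln (r x))) t (Re mu * (dr / r t) * expR (Re mu * ln (r t))).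
  apply: rder_val (rder_comp (is_derive_expR _) (rderM (rder_cst (Re mu) t) hl)) _.
  by rewrite mul0r add0r mulrC.
have hc : cder (fun x => cis (Im mu * ln (r x))) t ('i * (Im mu * (dr / r t))%:C * cis (Im mu * ln (r t))).
  have hi : rder (fun x => Im mu * ln (r x)) t (Im mu * (dr / r t)).
    by apply: rder_val (rderM (rder_cst (Im mu) t) hl) _; rewrite mul0r add0r.
  split.
    by apply: rder_val (rder_comp (is_derive_cos _) hi) _ => /=; ring.
  by apply: rder_val (rder_comp (is_derive_sin _) hi) _ => /=; ring.
apply: (cder_ext (f := fun x => (expR (Re mu * ln (r x)))%:C * cis (Im mu * ln (r x)))).
  by move=> x; rewrite cpowE.
apply: cder_val (cderM (cder_real he) hc) _.
rewrite cpowE; move: (expR _) (cis _) (dr / r t) => e z x.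
rewrite [X in _ = X * _ * _](_ : mu = (Re mu)%:C + 'i * (Im mu)%:C).
  by rewrite !rmorphM /=; ring.
by case: (mu) => a b; apply/eqP; rewrite eq_complex /=; apply/andP; split; apply/eqP; ring.
Qed.

(** The chain rule in polar coordinates.  Near t0 the point (X, Y) has the radius
    dt / cos de and the angle phi0 + de with de = atan (cr / dt), where dt and cr
    are its components along and across the ray phi0. *)
Lemma polar_curve U mu w dw (alpha : R) (X Y : R -> R) t0 dX dY r0 phi0 :
  (forall r phi, 0 < r -> 0 < phi < alpha -> U (r * cos phi) (r * sin phi) = cpow r mu *: w phi) ->
  0 < r0 -> 0 < phi0 < alpha -> mder w phi0 (dw phi0) ->
  rder X t0 dX -> rder Y t0 dY -> X t0 = r0 * cos phi0 -> Y t0 = r0 * sin phi0 ->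
  mder (fun t => U (X t) (Y t)) t0
    (cpow r0 (mu - 1) *: ((mu * (dX * cos phi0 + dY * sin phi0)%:C) *: w phi0
      + (dY * cos phi0 - dX * sin phi0)%:C *: dw phi0)).
Proof.
move=> hU r0p hphi hw hX hY X0 Y0.
pose dt t := X t * cos phi0 + Y t * sin phi0.
pose cr t := Y t * cos phi0 - X t * sin phi0.
have hdt : rder dt t0 (dX * cos phi0 + dY * sin phi0).
  by apply: rder_val (rderD (rderM hX (rder_cst _ _)) (rderM hY (rder_cst _ _))) _; rewrite !mulr0 !addr0.
have hcr : rder cr t0 (dY * cos phi0 - dX * sin phi0).
  by apply: rder_val (rderB (rderM hY (rder_cst _ _)) (rderM hX (rder_cst _ _))) _; rewrite !mulr0 !addr0.
have dt0 : dt t0 = r0.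
  by rewrite /dt X0 Y0 -!mulrA -mulrDr -!expr2 cos2Dsin2 mulr1.
have cr0 : cr t0 = 0 by rewrite /cr X0 Y0; ring.
pose z t := cr t * (dt t)^-1.
have dtn0 : dt t0 != 0 by rewrite dt0 gt_eqF.
have z0 : z t0 = 0 by rewrite /z cr0 mul0r.
have hz : rder z t0 ((dY * cos phi0 - dX * sin phi0) / r0).
  by apply: rder_val (rderM hcr (rderV dtn0 hdt)) _; rewrite cr0 mul0r addr0 dt0.
pose de t := atan (z t).
have de0 : de t0 = 0 by rewrite /de z0 atan0.
have hde : rder de t0 ((dY * cos phi0 - dX * sin phi0) / r0).
  apply: rder_val (rder_comp (is_derive1_atan _) hz) _.
  by rewrite z0 expr0n addr0 invr1 mul1r.
have cosp t : 0 < cos (de t).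
  by apply: cos_gt0_pihalf; rewrite /de atan_gtNpi2 atan_ltpi2.
pose rr t := dt t * (cos (de t))^-1.
have rr0 : rr t0 = r0 by rewrite /rr de0 cos0 invr1 mulr1.
have hrr : rder rr t0 (dX * cos phi0 + dY * sin phi0).
  have cn0 : cos (de t0) != 0 by rewrite de0 cos0 oner_neq0.
  have hc := rder_comp (is_derive_cos _) hde.
  apply: rder_val (rderM hdt (rderV cn0 hc)) _.
  by rewrite de0 cos0 sin0 oppr0 !mul0r oppr0 mul0r mulr0 addr0 invr1 mulr1.
pose th t := phi0 + de t.
have th0 : th t0 = phi0 by rewrite /th de0 addr0.
have hth : rder th t0 ((dY * cos phi0 - dX * sin phi0) / r0).
  by apply: rder_val (rderD (rder_cst phi0 t0) hde) _; rewrite add0r.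
have near_pos : \forall t \near t0, 0 < dt t.
  have h : dt @ t0 --> r0 by rewrite -dt0; exact: rder_continuous hdt.
  exact: (cvgr_gt _ h).
have near_th : \forall t \near t0, 0 < th t < alpha.
  have h : th @ t0 --> phi0 by rewrite -th0; exact: rder_continuous hth.
  have /andP[p1 p2] := hphi.
  by apply: filterS2 (cvgr_gt _ h 0 p1) (cvgr_lt _ h alpha p2) => x a b; rewrite a b.
have h1 : \forall t \near t0, cpow (rr t) mu *: w (th t) = U (X t) (Y t).
  apply: filterS2 near_pos near_th => t dp tp.
  have rp : 0 < rr t by rewrite /rr mulr_gt0 // invr_gt0.
  rewrite -(hU _ _ rp tp).
  have c1 : rr t * cos (de t) = dt t by rewrite /rr mulfVK // gt_eqF.
  have s1 : rr t * sin (de t) = cr t.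
    have -> : sin (de t) = tan (de t) * cos (de t) by rewrite /tan mulfVK // gt_eqF.
    by rewrite mulrCA c1 /de atanK /z mulfVK // gt_eqF.
  rewrite /th cosD sinD; congr U.
    have -> : rr t * (cos phi0 * cos (de t) - sin phi0 * sin (de t)) =
      cos phi0 * (rr t * cos (de t)) - sin phi0 * (rr t * sin (de t)) by ring.
    rewrite c1 s1 /dt /cr -[RHS]mulr1 -(cos2Dsin2 phi0); ring.
  have -> : rr t * (sin phi0 * cos (de t) + cos phi0 * sin (de t)) =
      sin phi0 * (rr t * cos (de t)) + cos phi0 * (rr t * sin (de t)) by ring.
  rewrite c1 s1 /dt /cr -[RHS]mulr1 -(cos2Dsin2 phi0); ring.
apply: mder_near h1 _.
have rp0 : 0 < rr t0 by rewrite rr0.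
have hw' : mder w (th t0) (dw phi0) by rewrite th0.
apply: mder_val (mderZ (cder_cpow mu rp0 hrr) (mder_comp hw' hth)) _.
rewrite rr0 th0 cpow_pred // scalerDr !scalerA !rmorphM /=.
by congr (_ *: _ + _ *: _); ring.
Qed.

Lemma cV_deriveE (f : R -> 'cV[C]_n) t d : mder f t d -> cV_derive f t = d.
Proof.
move=> h; apply/colP => k; rewrite mxE; have [h1 h2] := h k 0.
rewrite (rder_derive1 h1) (rder_derive1 h2).
by case: (d k 0).
Qed.

Lemma partial1_polar U mu w dw (alpha r phi : R) :
  (forall r phi, 0 < r -> 0 < phi < alpha -> U (r * cos phi) (r * sin phi) = cpow r mu *: w phi) ->
  0 < r -> 0 < phi < alpha -> mder w phi (dw phi) ->
  partial1 U (r * cos phi) (r * sin phi) = cpow r (mu - 1) *: polar1 mu w dw phi.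
Proof.
move=> hU r0 hphi hw; apply: cV_deriveE.
have := polar_curve (X := fun t => t) (Y := fun=> r * sin phi) hU r0 hphi hw
  (rder_id _) (rder_cst _ _) (erefl (r * cos phi)) (erefl _).
move=> h; apply: mder_val h _; congr (_ *: _); rewrite /polar1 !mul1r !mul0r addr0 add0r rmorphN /=.
by rewrite scaleNr.
Qed.

Lemma partial2_polar U mu w dw (alpha r phi : R) :
  (forall r phi, 0 < r -> 0 < phi < alpha -> U (r * cos phi) (r * sin phi) = cpow r mu *: w phi) ->
  0 < r -> 0 < phi < alpha -> mder w phi (dw phi) ->
  partial2 U (r * cos phi) (r * sin phi) = cpow r (mu - 1) *: polar2 mu w dw phi.
Proof.
move=> hU r0 hphi hw; apply: cV_deriveE.
have := polar_curve (X := fun=> r * cos phi) (Y := fun t => t) hU r0 hphi hw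
  (rder_cst _ _) (rder_id _) (erefl _) (erefl (r * sin phi)).
by move=> h; apply: mder_val h _; congr (_ *: _); rewrite /polar2 !mul1r !mul0r subr0 add0r.
Qed.

Lemma L_op_polar (A : mx_triple R n) U lam v dv ddv (alpha r phi : R) :
  (forall r phi, 0 < r -> 0 < phi < alpha -> U (r * cos phi) (r * sin phi) = cpow r lam *: v phi) ->
  (forall t, 0 < t < alpha -> mder v t (dv t)) ->
  (forall t, 0 < t < alpha -> mder dv t (ddv t)) ->
  0 < r -> 0 < phi < alpha ->
  let p := polar1 lam v dv in let q := polar2 lam v dv in
  let dp := dpolar1 lam v dv ddv in let dq := dpolar2 lam v dv ddv in
  L_op A U (r * cos phi) (r * sin phi) = cpow r (lam - 1 - 1) *:
    (actmx (A11 A) (polar1 (lam - 1) p dp phi) + actmx (A12 A) (polar1 (lam - 1) q dq phi)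
     + actmx (A12 A) (polar2 (lam - 1) p dp phi) + actmx (A22 A) (polar2 (lam - 1) q dq phi)).
Proof.
move=> hU hv hdv r0 hphi p q dp dq.
have hp t : 0 < t < alpha -> mder p t (dp t) by move=> ht; apply: mder_polar1; [exact: hv|exact: hdv].
have hq t : 0 < t < alpha -> mder q t (dq t) by move=> ht; apply: mder_polar2; [exact: hv|exact: hdv].
have U1 r' phi' : 0 < r' -> 0 < phi' < alpha ->
  partial1 U (r' * cos phi') (r' * sin phi') = cpow r' (lam - 1) *: p phi'.
  by move=> h1 h2; apply: partial1_polar hU h1 h2 (hv _ h2).
have U2 r' phi' : 0 < r' -> 0 < phi' < alpha ->
  partial2 U (r' * cos phi') (r' * sin phi') = cpow r' (lam - 1) *: q phi'.
  by move=> h1 h2; apply: partial2_polar hU h1 h2 (hv _ h2).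
rewrite /L_op (partial1_polar U1 r0 hphi (hp _ hphi)) (partial1_polar U2 r0 hphi (hq _ hphi)).
rewrite (partial2_polar U1 r0 hphi (hp _ hphi)) (partial2_polar U2 r0 hphi (hq _ hphi)).
by rewrite /actmx -!scalemxAr -!scalerDr.
Qed.

End Polar.

(** * Smoothness, and injectivity of polar coordinates *)

Section Existence.
Variable R : realType.
Local Notation C := R[i].
Local Notation Re := (@complex.Re R).
Local Notation Im := (@complex.Im R).

Fixpoint differentiable_times (N m n : nat) (F : R -> 'M[C]_(m, n)) : Prop :=
  if N is N'.+1 then
    exists dF, (forall t, mder F t (dF t)) /\ differentiable_times N' dF
  else True.

Lemma differentiable_timesW N m n (F : R -> 'M[C]_(m, n)) :
  differentiable_times N.+1 F -> differentiable_times N F.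
Proof.
elim: N F => [//|N IH] F [dF [h hN]]; exists dF; split=> //; exact: IH.
Qed.

Lemma differentiable_times_cst N m n (A : 'M[C]_(m, n)) : differentiable_times N (fun=> A).
Proof.
elim: N m n A => [//|N IH] m n A; exists (fun=> 0); split; last exact: IH.
by move=> t; exact: mder_cst.
Qed.

Lemma differentiable_timesD N m n (F G : R -> 'M[C]_(m, n)) :
  differentiable_times N F -> differentiable_times N G ->
  differentiable_times N (fun t => F t + G t).
Proof.
elim: N F G => [//|N IH] F G [dF [hF hF']] [dG [hG hG']].
exists (fun t => dF t + dG t); split; last exact: IH.
by move=> t; exact: mderD.
Qed.

Lemma differentiable_timesM N m n p (F : R -> 'M[C]_(m, n)) (G : R -> 'M[C]_(n, p)) :
  differentiable_times N F -> differentiable_times N G ->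
  differentiable_times N (fun t => F t *m G t).
Proof.
elim: N F G => [//|N IH] F G hF hG; have hF1 := differentiable_timesW hF.
have hG1 := differentiable_timesW hG; case: hF hG => dF [hF hF'] [dG [hG hG']].
exists (fun t => dF t *m G t + F t *m dG t); split.
  by move=> t; exact: mderM.
by apply: differentiable_timesD; exact: IH.
Qed.

Lemma differentiable_times_adj N m n (F : R -> 'M[C]_(m, n)) :
  differentiable_times N F -> differentiable_times N (fun t => adj (F t)).
Proof.
elim: N F => [//|N IH] F [dF [h hN]]; exists (fun t => adj (dF t)); split; last exact: IH.
by move=> t; exact: mder_adj.
Qed.

Lemma smooth_differentiable_times n (f : R -> 'cV[C]_n) :
  (forall N, differentiable_times N f) -> smooth f.
Proof.
move=> h k N; move: {h}f (h N.+1); elim: N => [|N IH] f [df [h hN]] t.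
  by have [[h1 _] [h2 _]] := h t k 0.
have e1 : derive1 (re_comp f k) = re_comp df k.
  by apply/funext => x; have [/rder_derive1 h1 _] := h x k 0.
have e2 : derive1 (im_comp f k) = im_comp df k.
  by apply/funext => x; have [_ /rder_derive1 h1] := h x k 0.
by rewrite !derive1Sn e1 e2; apply: IH.
Qed.

Lemma smooth_mder n (f : R -> 'cV[C]_n) : smooth f ->
  exists df ddf : R -> 'cV[C]_n,
    (forall t, mder f t (df t)) /\ (forall t, mder df t (ddf t)).
Proof.
move=> h.
pose d N t : 'cV[C]_n := \col_k (derive1n N (re_comp f k) t +i* derive1n N (im_comp f k) t).
exists (d 1%N), (d 2%N); split=> t k j; rewrite ord1 mxE.
  have [h1 h2] := h k 0%N t.
  by split; [exact: derivable_rder h1|exact: derivable_rder h2].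
have [h1 h2] := h k 1%N t.
split; [apply: rder_ext (derivable_rder h1)|apply: rder_ext (derivable_rder h2)];
  by move=> x; rewrite mxE.
Qed.

Lemma cis_intpi (m : int) : cis (2 * m%:~R * pi) = 1 :> C.
Proof.
have nat_case (k : nat) : cis (2 * k%:R * pi) = 1 :> C.
  elim: k => [|k IH]; first by rewrite mulr0 mul0r cis0.
  have -> : 2 * k.+1%:R * pi = 2 * k%:R * pi + pi *+ 2 :> R by rewrite -natr1; ring.
  by rewrite (cisD (2 * k%:R * pi)) IH mul1r /cis cos2pi sin2pi.
case: (intP m) => [|k|k]; rewrite ?mulr0 ?mul0r ?cis0 //; first exact: (nat_case k.+1).
rewrite mulrNz mulrN mulNr -cc_cis pmulrn (nat_case k.+1).
by apply/eqP; rewrite eq_complex /= oppr0 !eqxx.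
Qed.

Lemma polar_inj (alpha r phi r' phi' : R) : alpha <= 2 * pi -> 0 < r -> 0 < r' ->
  0 < phi < alpha -> 0 < phi' < alpha ->
  r * cos phi = r' * cos phi' -> r * sin phi = r' * sin phi' -> r = r' /\ phi = phi'.
Proof.
move=> al r0 r0' /andP[p0 pa] /andP[p0' pa'] ec es.
have er : r = r'.
  have e2 : r ^+ 2 = r' ^+ 2.
    rewrite -[LHS]mulr1 -(cos2Dsin2 phi) -[RHS]mulr1 -(cos2Dsin2 phi') !mulrDr -!exprMn.
    by rewrite ec es.
  by apply/eqP; rewrite -(@eqrXn2 _ 2) ?ltW //; apply/eqP.
split=> //; rewrite er in ec es.
have {}ec : cos phi = cos phi' by exact: (mulfI (lt0r_neq0 r0') ec).
have {}es : sin phi = sin phi' by exact: (mulfI (lt0r_neq0 r0') es).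
have pi0 := pi_gt0 R.
pose x := (phi - phi') / (2 * pi).
have ex : phi - phi' = 2 * x * pi by rewrite /x mulrAC mulrC mulfVK // mulf_neq0 // gt_eqF.
have [|m em] := @cis_int _ x.
  rewrite -ex cisD /cis cosN sinN ec es.
  apply/eqP; rewrite eq_complex /=; apply/andP; split; apply/eqP; last by ring.
  by rewrite -[RHS](cos2Dsin2 phi'); ring.
have : `|m%:~R : R| < 1.
  by rewrite -em /x normrM normfV ltr_pdivrMr ?normr_gt0 ?mulf_neq0 ?gt_eqF // mul1r
    [ltRHS]gtr0_norm ?mulr_gt0 // ltr_norml; apply/andP; split; lra.
rewrite -intr_norm -[ltRHS](mulr1z 1) ltr_int => h.
have m0 : m = 0 by move: h; case: (m) => [[|k]|k].
by apply/eqP; rewrite -subr_eq0 ex em m0 mulr0 mul0r.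
Qed.

End Existence.

(** * Waves built from the powers *)

Section PowerSolutions.
Variable R : realType.
Local Notation C := R[i].
Local Notation Re := (@complex.Re R).
Local Notation Im := (@complex.Im R).
Variables (n : nat) (Z S : 'M[C]_n).
Hypotheses (hZ : dissipative Z).

(** If F = Tm^s, then r^s times the wave is S (K (x1 + x2 Z)^s - its adjoint) c when
    K commutes with Z.  The factor K lets the partial derivatives of a wave be
    waves again. *)
Definition power_wave (K : 'M[C]_n) (F : R -> 'M[C]_n) (c : 'cV[C]_n) (t : R) : 'cV[C]_n :=
  S *m ((K *m F t - adj K *m adj (F t)) *m c).

Lemma power_split s E E1 x : is_power Z s E -> is_power Z (s - 1) E1 -> E x = Tm Z x *m E1 x.
Proof.
move=> hE hE1; have h := is_power_succ hZ hE1.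
by rewrite subrK in h; exact: (power_fun_inj hZ hE h).
Qed.

Lemma power_mder s E E1 x : is_power Z s E -> is_power Z (s - 1) E1 ->
  mder E x (s%:C *: (Tm' Z x *m E1 x)).
Proof.
move=> hE hE1; have [_ h _ _ _] := hE; apply: mder_val (h x) _.
by rewrite (power_split x hE hE1) -!mulmxA mulKmx ?Tm_unit.
Qed.

Lemma power_differentiable_times N s E : is_power Z s E -> differentiable_times N E.
Proof.
have hT M : differentiable_times M (Tm Z) /\ differentiable_times M (Tm' Z).
  elim: M => [//|M [IH IH']]; split; first by exists (Tm' Z); split=> // t; exact: mder_Tm.
  exists (fun t => - 1%:M *m Tm Z t); split.
    by move=> t; rewrite mulNmx mul1mx; exact: mder_Tm'.
  by apply: differentiable_timesM => //; exact: differentiable_times_cst.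
elim: N s E => [//|N IH] s E hE.
have hE1 := is_power_pred hZ hE; set E1 := (fun x => invmx _ *m _) in hE1.
exists (fun t => s%:C%:M *m (Tm' Z t *m E1 t)); split.
  by move=> t; rewrite mul_scalar_mx; exact: power_mder.
apply: differentiable_timesM; first exact: differentiable_times_cst.
by apply: differentiable_timesM; [case: (hT N)|exact: IH hE1].
Qed.

Definition dpower_wave s (K : 'M[C]_n) (F1 : R -> 'M[C]_n) (c : 'cV[C]_n) (t : R) : 'cV[C]_n :=
  s%:C *: power_wave K (fun x => Tm' Z x *m F1 x) c t.

Lemma power_wave_smooth s K E c : is_power Z s E -> smooth (power_wave K E c).
Proof.
move=> hE; apply: smooth_differentiable_times => N.
have hN := power_differentiable_times N hE.
have hc m p (A : 'M[C]_(m, p)) := differentiable_times_cst N A.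
apply: differentiable_timesM; first exact: hc.
apply: differentiable_timesM; last exact: hc.
have -> : (fun x => K *m E x - adj K *m adj (E x)) =
    (fun x => K *m E x + (- adj K) *m adj (E x)).
  by apply/funext => x; rewrite mulNmx.
apply: differentiable_timesD; apply: differentiable_timesM; [exact: hc| exact: hN | exact: hc |].
exact: differentiable_times_adj.
Qed.

Lemma power_wave_mder s K E E1 c t : is_power Z s E -> is_power Z (s - 1) E1 ->
  mder (power_wave K E c) t (dpower_wave s K E1 c t).
Proof.
move=> hE hE1; have h := power_mder t hE hE1.
apply: mder_val (mderMl S (mderMr c (mderB (mderMl K h) (mderMl (adj K) (mder_adj h))))) _.
by rewrite /dpower_wave /power_wave adjZ cjR -!scalemxAr -scalerBr -scalemxAl -scalemxAr.
Qed.

(** The partial derivatives of x1 + x2 Z, which are 1 and Z, in polar coordinates. *)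
Lemma Tm_radial t (X : 'M[C]_n) :
  (cos t)%:C *: (Tm Z t *m X) - (sin t)%:C *: (Tm' Z t *m X) = X.
Proof.
rewrite !scalemxAl -mulmxBl -[RHS]mul1mx; congr (_ *m _).
rewrite /Tm /Tm' rmorphN /=; have := cos2Dsin2C t.
move: (cos t)%:C (sin t)%:C => a b e; apply/matrixP => i j; rewrite !mxE.
by case: (i == j); rewrite ?mulr1n ?mulr0n -?e; ring.
Qed.

Lemma Tm_angular t (X : 'M[C]_n) :
  (sin t)%:C *: (Tm Z t *m X) + (cos t)%:C *: (Tm' Z t *m X) = Z *m X.
Proof.
rewrite !scalemxAl -mulmxDl; congr (_ *m _).
rewrite /Tm /Tm' rmorphN /=; have := cos2Dsin2C t.
move: (cos t)%:C (sin t)%:C => a b e; apply/matrixP => i j; rewrite !mxE.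
by rewrite -[RHS]mul1r -e; case: (i == j); rewrite ?mulr1n ?mulr0n; ring.
Qed.

Lemma power_waveD K (F G : R -> 'M[C]_n) (a b : R) c t :
  a%:C *: power_wave K F c t + b%:C *: power_wave K G c t =
  power_wave K (fun x => a%:C *: F x + b%:C *: G x) c t.
Proof.
rewrite /power_wave 2!(scalemxAr _ S) -mulmxDr 2!(scalemxAl _ _ c) -mulmxDl adjD !adjZ !cjR.
congr (_ *m (_ *m _)).
rewrite !mulmxDr -!scalemxAr; move: (K *m _) (adj K *m _) (K *m _) (adj K *m _) => *.
by apply/matrixP => i j; rewrite !mxE; ring.
Qed.

Lemma power_wave_ext K (F G : R -> 'M[C]_n) c t : F t = G t ->
  power_wave K F c t = power_wave K G c t.
Proof. by rewrite /power_wave => ->. Qed.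

Lemma power_wave_scale K F c t (a : R) :
  a%:C *: power_wave K F c t = power_wave (a%:C *: K) F c t.
Proof.
rewrite /power_wave adjZ cjR (scalemxAr _ S) (scalemxAl _ _ c).
by rewrite scalerBr -!scalemxAl.
Qed.

(** d1 (x1 + x2 Z)^s = s (x1 + x2 Z)^(s - 1). *)
Lemma polar1_power_wave s K E E1 c t : is_power Z s E -> is_power Z (s - 1) E1 ->
  polar1 s%:C (power_wave K E c) (dpower_wave s K E1 c) t =
  power_wave (s%:C *: K) E1 c t.
Proof.
move=> hE hE1; rewrite -power_wave_scale /polar1 /dpower_wave [_ *: (s%:C *: _)]scalerA (mulrC (sin t)%:C) -!scalerA -scalerBr.
congr (_ *: _); rewrite -scaleNr -rmorphN power_waveD; apply: power_wave_ext.
by rewrite rmorphN scaleNr (power_split t hE hE1) Tm_radial.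
Qed.

(** d2 (x1 + x2 Z)^s = s Z (x1 + x2 Z)^(s - 1). *)
Lemma polar2_power_wave s K E E1 c t : K *m Z = Z *m K ->
  is_power Z s E -> is_power Z (s - 1) E1 ->
  polar2 s%:C (power_wave K E c) (dpower_wave s K E1 c) t =
  power_wave (s%:C *: (K *m Z)) E1 c t.
Proof.
move=> KZ hE hE1; rewrite -power_wave_scale /polar2 /dpower_wave [_ *: (s%:C *: _)]scalerA (mulrC (cos t)%:C) -!scalerA -scalerDr.
congr (_ *: _); rewrite power_waveD (@power_wave_ext K _ (fun x => Z *m E1 x)).
  have [_ _ ec _ _] := hE1.
  have e : adj K *m adj (Z *m E1 t) = adj (K *m Z) *m adj (E1 t).
    by rewrite -ec (adjM (E1 t)) mulmxA -adjM KZ.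
  by rewrite /power_wave e (mulmxA K).
by rewrite (power_split t hE hE1) Tm_angular.
Qed.

End PowerSolutions.

(** * Solutions of the model problem for given generators *)

Section Spectrum.
Variable R : realType.
Local Notation C := R[i].
Local Notation Re := (@complex.Re R).
Local Notation Im := (@complex.Im R).
Local Notation complexify := (map_mx (real_complex R)).
Variable n : nat.

Section Generators.
Variables (A : mx_triple R n) (Z S : 'M[C]_n).
Hypotheses (hZ : dissipative Z) (Su : S \in unitmx).
Local Notation a11 := (complexify (A11 A) *m S).
Local Notation a12 := (complexify (A12 A) *m S).
Local Notation a22 := (complexify (A22 A) *m S).
Hypothesis eZ : a11 + (a12 + a12) *m Z + a22 *m Z *m Z = 0.
Hypothesis eZ' : a11 + (a12 + a12) *m adj Z + a22 *m adj Z *m adj Z = 0.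

Lemma symbol_power_wave (k : R) F c t :
  actmx (A11 A) (power_wave S (k%:C *: 1%:M) F c t)
  + actmx (A12 A) (power_wave S (k%:C *: Z) F c t)
  + actmx (A12 A) (power_wave S (k%:C *: Z) F c t)
  + actmx (A22 A) (power_wave S (k%:C *: (Z *m Z)) F c t) = 0.
Proof.
rewrite -!power_wave_scale /actmx -!scalemxAr -!scalerDr [X in _ *: X](_ : _ = 0) ?scaler0 //.
have e K : power_wave S K F c t = S *m (K *m (F t *m c)) - S *m (adj K *m (adj (F t) *m c)).
  by rewrite -mulmxBr !mulmxA -mulmxBl.
rewrite !{}e adj1 !mul1mx adjM; move: (F t *m c) (adj (F t) *m c) => x y.
have sol (X : 'M[C]_n) (z : 'cV[C]_n) : a11 + (a12 + a12) *m X + a22 *m X *m X = 0 ->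
    complexify (A11 A) *m (S *m z) + complexify (A12 A) *m (S *m (X *m z))
    + complexify (A12 A) *m (S *m (X *m z)) + complexify (A22 A) *m (S *m (X *m (X *m z))) = 0.
  by move=> h; rewrite -[RHS](mul0mx _ z) -h !mulmxDl !mulmxA !addrA.
have h1 := sol _ x eZ; have h2 := sol _ y eZ'.
rewrite !mulmxBr -!mulmxA -[RHS](subrr 0) -{1}h1 -{}h2 {h1 sol}.
move: (_ *m (S *m x)) (_ *m (S *m y)) (_ *m (S *m (Z *m x))) (_ *m (S *m (adj Z *m y))).
move=> a a' b b'; move: (_ *m (S *m _)) (_ *m (S *m _)) => d d'.
by apply/matrixP => i j; rewrite !mxE; ring.
Qed.

Lemma L_op_power_wave U (s alpha : R) E E1 E2 c r phi :
  is_power Z s E -> is_power Z (s - 1) E1 -> is_power Z (s - 1 - 1) E2 ->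
  (forall r phi, 0 < r -> 0 < phi < alpha ->
    U (r * cos phi) (r * sin phi) = cpow r s%:C *: power_wave S 1%:M E c phi) ->
  0 < r -> 0 < phi < alpha -> L_op A U (r * cos phi) (r * sin phi) = 0.
Proof.
move=> hE hE1 hE2 hU r0 hphi.
have predC (x : R) : x%:C - 1 = (x - 1)%:C :> C by rewrite rmorphB rmorph1.
have d1 (x : R) F F1 K V : is_power Z x F -> is_power Z (x - 1) F1 ->
    (forall r phi, 0 < r -> 0 < phi < alpha ->
      V (r * cos phi) (r * sin phi) = cpow r x%:C *: power_wave S K F c phi) ->
    forall r phi, 0 < r -> 0 < phi < alpha ->
      partial1 V (r * cos phi) (r * sin phi) =
      cpow r (x - 1)%:C *: power_wave S (x%:C *: K) F1 c phi.
  move=> hF hF1 hV r' phi' r0' hphi'.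
  rewrite (partial1_polar hV r0' hphi' (power_wave_mder S hZ K c phi' hF hF1)) predC.
  by rewrite polar1_power_wave.
have d2 (x : R) F F1 K V : K *m Z = Z *m K -> is_power Z x F -> is_power Z (x - 1) F1 ->
    (forall r phi, 0 < r -> 0 < phi < alpha ->
      V (r * cos phi) (r * sin phi) = cpow r x%:C *: power_wave S K F c phi) ->
    forall r phi, 0 < r -> 0 < phi < alpha ->
      partial2 V (r * cos phi) (r * sin phi) =
      cpow r (x - 1)%:C *: power_wave S (x%:C *: (K *m Z)) F1 c phi.
  move=> KZ hF hF1 hV r' phi' r0' hphi'.
  rewrite (partial2_polar hV r0' hphi' (power_wave_mder S hZ K c phi' hF hF1)) predC.
  by rewrite polar2_power_wave.
have U1 := d1 _ _ _ _ _ hE hE1 hU.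
have c1 : 1%:M *m Z = Z *m 1%:M by rewrite mul1mx mulmx1.
have U2 := d2 _ _ _ _ _ c1 hE hE1 hU.
have cs (K : 'M[C]_n) : K *m Z = Z *m K -> (s%:C *: K) *m Z = Z *m (s%:C *: K).
  by move=> h; rewrite -scalemxAl h scalemxAr.
rewrite /L_op (d1 _ _ _ _ _ hE1 hE2 U1 _ _ r0 hphi) (d1 _ _ _ _ _ hE1 hE2 U2 _ _ r0 hphi).
have cZ : (1%:M *m Z) *m Z = Z *m (1%:M *m Z) by rewrite mul1mx.
rewrite (d2 _ _ _ _ _ (cs _ c1) hE1 hE2 U1 _ _ r0 hphi) (d2 _ _ _ _ _ (cs _ cZ) hE1 hE2 U2 _ _ r0 hphi).
have sk (K : 'M[C]_n) : (s - 1)%:C *: (s%:C *: K) = ((s - 1) * s)%:C *: K.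
  by rewrite scalerA -rmorphM.
rewrite -!(scalemxAl s%:C) !sk mul1mx; set k := (s - 1) * s.
have act (M : 'M[R]_n) (mu : C) x : actmx M (mu *: x) = mu *: actmx M x.
  exact/esym/scalemxAr.
by rewrite !act -!scalerDr symbol_power_wave scaler0.
Qed.

(** Inside an interval where the wave vanishes, its gradient does; so x = Tm^(s-1) c
    and its counterpart x' satisfy x = x' and Z x = adj(Z) x', and Z - adj Z is
    invertible. *)
Lemma power_wave_neq0 s E c (alpha : R) : s != 0 -> is_power Z s E -> c != 0 -> 0 < alpha ->
  exists2 t, 0 <= t <= alpha & power_wave S 1%:M E c t != 0.
Proof.
move=> s0 hE c0 a0; have [//|h] := pselect (exists2 t, 0 <= t <= alpha & power_wave S 1%:M E c t != 0).
have z t : 0 <= t <= alpha -> power_wave S 1%:M E c t = 0.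
  by move=> ht; apply/eqP; apply: contraT => vt; case: h; exists t.
pose t := alpha / 2.
have t0 : 0 < t by rewrite divr_gt0.
have ta : t < alpha by rewrite /t; lra.
have [E1 hE1] := is_power_exists hZ (s - 1).
have d0 : mder (power_wave S 1%:M E c) t 0.
  apply: mder_near (mder_cst 0 t); near=> x; rewrite z //.
  apply/andP; split; apply: ltW; near: x; [exact: lt_nbhsr|exact: lt_nbhsl].
have := mder_uniq (power_wave_mder S hZ 1%:M c t hE hE1) d0.
have w0 : power_wave S 1%:M E c t = 0 by apply: z; rewrite !ltW.
have p1 := polar1_power_wave S hZ 1%:M c t hE hE1.
have c1 : 1%:M *m Z = Z *m 1%:M by rewrite mul1mx mulmx1.
have p2 := polar2_power_wave S hZ c t c1 hE hE1.
move=> dw0; move: p1 p2; rewrite /polar1 /polar2 w0 dw0 !scaler0 subr0 addr0.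
have sC0 : s%:C != 0 :> C by rewrite eq_complex /= negb_and s0.
have unscale K : 0 = power_wave S (s%:C *: K) E1 c t -> (K *m E1 t - adj K *m adj (E1 t)) *m c = 0.
  rewrite -power_wave_scale => /esym /eqP; rewrite scaler_eq0 (negbTE sC0) /= => /eqP.
  exact: unitmx_inj.
move=> /unscale; rewrite adj1 !mul1mx mulmxBl => /eqP; rewrite subr_eq0 => /eqP e1.
move=> /unscale; rewrite mulmxBl -!mulmxA -e1 -mulmxBl => /(unitmx_inj (unit_sub_adj hZ)).
have [_ _ _ uE _] := hE1; move=> /(unitmx_inj (uE t)) /eqP.
by rewrite (negbTE c0).
Unshelve. all: end_near. Qed.

(** At 0 and at alpha the power is a real scalar, so the wave vanishes there. *)
Lemma power_wave_Lambda (s alpha : R) : (0 < n)%N -> s != 0 -> 0 < alpha <= 2 * pi ->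
  cis (2 * (s * alpha)) = 1 :> C ->
  (forall E, is_power Z s E -> E alpha = cis (s * alpha) *: 1%:M) ->
  Lambda A alpha s%:C.
Proof.
move=> n0 s0 /andP[a0 a2] hcis hEa.
have [E hE] := is_power_exists hZ s.
have [E1 hE1] := is_power_exists hZ (s - 1).
have [E2 hE2] := is_power_exists hZ (s - 1 - 1).
pose c : 'cV[C]_n := const_mx 1.
have c0 : c != 0.
  apply/eqP => /colP /(_ (Ordinal n0)); rewrite !mxE => /eqP.
  by rewrite oner_eq0.
pose w := power_wave S 1%:M E c.
have w_real (t : R) : adj (E t) = E t -> w t = 0.
  by move=> h; rewrite /w /power_wave adj1 !mul1mx h subrr mul0mx mulmx0.
exists w; split.
- by exists w; split=> //; exact: power_wave_smooth hE.
- have [t ht wt] := power_wave_neq0 s0 hE c0 a0.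
  exists 1, t; split=> //.
  by rewrite /power_fun scaler_eq0 negb_or cpow_neq0.
split; last first.
  move=> r r0; have [e0 _ _ _ _] := hE.
  rewrite /power_fun !w_real ?scaler0 ?e0 ?adj1 //.
  rewrite (hEa _ hE) adjZ adj1 cc_cis; congr (_ *: _).
  by rewrite -[LHS]mulr1 -hcis -cisD; congr cis; ring.
pose P x y (q : R * R) := [/\ 0 < q.1, 0 < q.2 < alpha, x = q.1 * cos q.2 & y = q.1 * sin q.2].
pose U x y := if pselect (exists q, P x y q) is left h then
  power_fun s%:C w (projT1 (cid h)).1 (projT1 (cid h)).2 else 0.
have hU r phi : 0 < r -> 0 < phi < alpha -> U (r * cos phi) (r * sin phi) = power_fun s%:C w r phi.
  move=> r0 hphi; rewrite /U; case: pselect => [h|]; last by case; exists (r, phi).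
  case: (cid h) => -[r' phi'] /= [/= r0' hphi' e1 e2].
  by have [-> ->] := polar_inj a2 r0 r0' hphi hphi' e1 e2.
exists U => r phi r0 hphi; split; first exact: hU.
exact: (L_op_power_wave hE hE1 hE2 hU r0 hphi).
Qed.

Lemma Lambda_conditions alpha lam : 0 < alpha -> a22 \in unitmx -> Lambda A alpha lam ->
  [/\ lam != 0,
      alpha < pi -> 1 < `|Re lam|,
      pi < alpha < 2 * pi -> 2^-1 < `|Re lam|,
      alpha = pi -> exists m : int, lam = m%:~R &
      alpha = 2 * pi -> exists m : int, lam = m%:~R / 2].
Proof.
move=> a0 a22u [v [[g [gs vg]] [r1 [t1 [r10 ht1 vt1]]] [[U hU] bd]]].
have [dg [ddg [hg hdg]]] := smooth_mder gs.
pose V t := invmx S *m g t; pose dV t := invmx S *m dg t; pose ddV t := invmx S *m ddg t.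
have gV : g = (fun t => S *m V t) by apply/funext => t; rewrite /V mulKVmx.
have dgV : dg = (fun t => S *m dV t) by apply/funext => t; rewrite /dV mulKVmx.
have ddgV : ddg = (fun t => S *m ddV t) by apply/funext => t; rewrite /ddV mulKVmx.
have cancel_cpow r mu (x : 'cV[C]_n) : cpow r mu *: x = 0 -> x = 0.
  by move=> /eqP; rewrite scaler_eq0 (negbTE (cpow_neq0 _ _)) => /eqP.
have V_0 t : 0 <= t <= alpha -> v t = 0 -> V t = 0.
  by move=> ht vt; rewrite /V -vg // vt mulmx0.
have [b0 ba] := bd 1 ltr01.
apply: (@reduction _ _ Z hZ a11 a12 a22 a22u eZ eZ' lam alpha V dV ddV) => //.
- by move=> t; exact: mderMl.
- by move=> t; exact: mderMl.
- move=> t ht.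
  have hUg r phi : 0 < r -> 0 < phi < alpha -> U (r * cos phi) (r * sin phi) = cpow r lam *: g phi.
    move=> r0 /andP[p0 pa]; have [-> _] := hU r phi r0 (introT andP (conj p0 pa)).
    by rewrite /power_fun vg // !ltW.
  have [_] := hU 1 t ltr01 ht.
  rewrite (L_op_polar A hUg (fun x _ => hg x) (fun x _ => hdg x) ltr01 ht) => /cancel_cpow.
  have pS : (fun x => S *m polar1 lam V dV x) = polar1 lam g dg.
    by apply/funext => x; rewrite polar_linear1 gV dgV.
  have qS : (fun x => S *m polar2 lam V dV x) = polar2 lam g dg.
    by apply/funext => x; rewrite polar_linear2 gV dgV.
  have dpS : (fun x => S *m dpolar1 lam V dV ddV x) = dpolar1 lam g dg ddg.
    apply/funext => x; rewrite /dpolar1 gV dgV ddgV.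
    by rewrite mulmxBr !mulmxDr -!scalemxAr.
  have dqS : (fun x => S *m dpolar2 lam V dV ddV x) = dpolar2 lam g dg ddg.
    apply/funext => x; rewrite /dpolar2 gV dgV ddgV.
    by rewrite !mulmxDr -!scalemxAr.
  rewrite /actmx -pS -qS -dpS -dqS -!(polar_linear1 t _ S) -!(polar_linear2 t _ S).
  by rewrite !mulmxA.
- by apply: V_0; rewrite ?lexx ?ltW //; exact: cancel_cpow b0.
- by apply: V_0; rewrite ?lexx ?ltW //; exact: cancel_cpow ba.
exists t1 => //; apply: contra vt1 => /eqP Vt; rewrite /power_fun vg //.
by rewrite gV /= Vt mulmx0 scaler0.
Qed.

End Generators.
End Spectrum.

(** * Elliptic tuples *)

Section EllipticTuple.
Variable R : realType.
Local Notation C := R[i].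
Local Notation Re := (@complex.Re R).
Local Notation Im := (@complex.Im R).
Local Notation cj := (map_mx (@conjc R)).
Local Notation complexify := (map_mx (real_complex R)).

Lemma complexify_real m n (M : 'M[R]_(m, n)) : cj (complexify M) = complexify M.
Proof. by apply/matrixP => i j; rewrite !mxE cjR. Qed.

Lemma dot_complexify n (M : 'M[R]_n) (a b : 'cV[R]_n) :
  dot (complexify a) (complexify M *m complexify b) = ((a^T *m M *m b) 0 0)%:C.
Proof.
by rewrite /dot /adj complexify_real map_trmx -!map_mxM mxE mulmxA.
Qed.

Lemma posdefmx_complexify n (M : 'M[R]_n) : posdefmx M ->
  forall x : 'cV[C]_n, x != 0 -> 0 < Re (dot x (complexify M *m x)).
Proof.
move=> hM x x0; pose a := map_mx Re x; pose b := map_mx Im x.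
have ex : x = complexify a + 'i *: complexify b.
  apply/matrixP => i j; rewrite !mxE; case: (x i j) => u v.
  by apply/eqP; rewrite eq_complex /=; apply/andP; split; apply/eqP; ring.
have ge0 (y : 'cV[R]_n) : 0 <= (y^T *m M *m y) ord0 ord0.
  by have [->|/hM/ltW //] := eqVneq y 0; rewrite mulmx0 mxE.
rewrite ex mulmxDr -scalemxAr dotDl !dotDr !dotZl !dotZr !dot_complexify.
have ab : 0 < (a^T *m M *m a) 0 0 + (b^T *m M *m b) 0 0.
  have [a0|a0] := eqVneq a 0; last by apply: ltr_wpDr (ge0 b) (hM _ a0).
  have b0 : b != 0.
    apply: contra x0 => /eqP b0; rewrite ex a0 b0; apply/eqP/matrixP => i j.
    by rewrite !mxE mulr0 addr0.
  by apply: ltr_wpDl (ge0 a) (hM _ b0).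
move: ab; move: ((a^T *m M *m a) 0 0) ((a^T *m M *m b) 0 0) ((b^T *m M *m a) 0 0) => p q r.
move: ((b^T *m M *m b) 0 0) => s h /=; lra.
Qed.

(** Ellipticity at the covectors (1, t) is the absence of real eigenvalues of the
    quadratic polynomial. *)
Lemma elliptic_generators (k : nat) (A : mx_triple R k.+1) : elliptic_tuple A ->
  exists Z S : 'M[C]_k.+1,
    let a11 := complexify (A11 A) *m S in
    let a12 := complexify (A12 A) *m S in
    let a22 := complexify (A22 A) *m S in
    [/\ dissipative Z, S \in unitmx, a22 \in unitmx,
      a11 + (a12 + a12) *m Z + a22 *m Z *m Z = 0 &
      a11 + (a12 + a12) *m adj Z + a22 *m adj Z *m adj Z = 0].
Proof.
move=> [[s1 s2 s3] _ p2 ell].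
have tC (M : 'M[R]_k.+1) : M^T = M -> (complexify M)^T = complexify M.
  by move=> h; rewrite map_trmx h.
have ellC z : Im z = 0 -> complexify (A11 A) + z *: complexify (A12 A + A12 A)
    + z ^+ 2 *: complexify (A22 A) \in unitmx.
  case: z => t _ /= ->.
  have -> : complexify (A11 A) + (t +i* 0) *: complexify (A12 A + A12 A)
      + (t +i* 0) ^+ 2 *: complexify (A22 A) = complexify (symbol A 1 t).
    apply/matrixP => i j; rewrite /symbol !mxE.
    by apply/eqP; rewrite eq_complex /= !expr2 /=; apply/andP; split; apply/eqP; ring.
  rewrite unitmxE det_map_mx unitfE fmorph_eq0; apply: ell.
  by rewrite xpair_eqE oner_eq0.
have e2 : complexify (A12 A + A12 A) = complexify (A12 A) + complexify (A12 A).
  by rewrite map_mxD.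
have s22 : (A12 A + A12 A)^T = A12 A + A12 A by rewrite linearD /= s2.
have [Z0 [S [Su eq0 dZ aZ]]] := dissipative_solvent (complexify_real _) (complexify_real _)
  (complexify_real _) (tC _ s1) (tC _ s22) (tC _ s3) (posdefmx_complexify p2) ellC.
have a22u : complexify (A22 A) \in unitmx.
  apply: unitmx_ker => x h; apply/eqP; apply: contraT => /(posdefmx_complexify p2).
  by rewrite h dot0r ltxx.
have eq0' : complexify (A11 A) + complexify (A12 A + A12 A) *m cj Z0
    + complexify (A22 A) *m cj Z0 *m cj Z0 = 0.
  have cD (X Y : 'M[C]_k.+1) : cj (X + Y) = cj X + cj Y by exact: map_mxD.
  have cM (X Y : 'M[C]_k.+1) : cj (X *m Y) = cj X *m cj Y by exact: map_mxM.
  by have := congr1 (fun X => cj X) eq0; rewrite /= map_mx0 !cD !cM !complexify_real.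
have change_basis (X : 'M[C]_k.+1) : complexify (A11 A) + complexify (A12 A + A12 A) *m X
    + complexify (A22 A) *m X *m X = 0 ->
    let Y := invmx S *m X *m S in
    complexify (A11 A) *m S + (complexify (A12 A) *m S + complexify (A12 A) *m S) *m Y
    + complexify (A22 A) *m S *m Y *m Y = 0.
  move=> h; have : S *m (invmx S *m X *m S) = X *m S by rewrite !mulmxA mulmxV // mul1mx.
  move: (invmx S *m X *m S) => Y SY /=.
  have SYY (M : 'M[C]_k.+1) : M *m S *m Y = M *m X *m S by rewrite -mulmxA SY mulmxA.
  by rewrite -mulmxDl -e2 !SYY -!mulmxDl h mul0mx.
exists (invmx S *m Z0 *m S), S; split; [exact: dZ|exact: Su| | |].
- by rewrite unitmx_mul a22u.
- exact: change_basis.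
- by rewrite aZ; exact: change_basis.
Qed.

End EllipticTuple.

Theorem theorem7p1 (R : realType) (l : nat) (hl : (0 < l)%N)
    (A : mx_triple R l) (hA : elliptic_tuple A) :
  [/\ forall alpha : R, 0 < alpha < pi ->
        Lambda A alpha `<=` [set lambda : R[i] | 1 < `|complex.Re lambda|],
      Lambda A pi = [set lambda : R[i] | exists m : int, m != 0 /\ lambda = m%:~R],
      forall alpha : R, pi < alpha < 2 * pi ->
        Lambda A alpha `<=` [set lambda : R[i] | 2^-1 < `|complex.Re lambda|]
    & Lambda A (2 * pi) =
        [set lambda : R[i] | exists m : int, m != 0 /\ lambda = m%:~R / 2]].
Proof.
case: l hl A hA => [//|k] _ A hA.
have [Z [S [hZ Su a22u eZ eZ']]] := elliptic_generators hA.
have pi0 := pi_gt0 R.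
have pi2 : pi < 2 * pi :> R by lra.
have nec alpha lam a0 := Lambda_conditions (alpha := alpha) (lam := lam) hZ Su eZ eZ' a0 a22u.
have suf := power_wave_Lambda hZ Su eZ eZ' (ltn0Sn k).
split.
- by move=> alpha /andP[a0 a1] lam /(nec _ _ a0)[_ h _ _ _]; exact: h.
- apply/seteqP; split=> lam /=.
    move=> /(nec _ _ pi0)[l0 _ _ /(_ erefl)[m em] _]; exists m; split=> //.
    by apply: contra l0 => /eqP m0; rewrite em m0.
  move=> [m [m0 ->]].
  have -> : m%:~R = (m%:~R : R)%:C :> R[i] by rewrite rmorph_int.
  apply: suf; rewrite ?intr_eq0 ?pi0 ?ltW //.
    by rewrite mulrA cis_intpi.
  by move=> E [e0 _ _ _ ep]; rewrite -[in LHS](add0r pi) ep e0.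
- move=> alpha /andP[a1 a2] lam; have a0 := lt_trans pi0 a1.
  by move=> /(nec _ _ a0)[_ _ h _ _]; apply: h; rewrite a1.
apply/seteqP; split=> lam /=.
  have a0 : 0 < 2 * pi :> R by rewrite mulr_gt0.
  move=> /(nec _ _ a0)[l0 _ _ _ /(_ erefl)[m em]]; exists m; split=> //.
  by apply: contra l0 => /eqP m0; rewrite em m0 mul0r.
move=> [m [m0 ->]].
have -> : m%:~R / 2 = (m%:~R / 2 : R)%:C :> R[i].
  by rewrite rmorphM fmorphV /= rmorph_int rmorph_nat.
apply: suf.
- by rewrite mulf_neq0 ?intr_eq0 ?invr_eq0.
- by rewrite lexx andbT mulr_gt0.
- have -> : 2 * (m%:~R / 2 * (2 * pi)) = 2 * m%:~R * pi :> R by field.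
  exact: cis_intpi.
move=> E [e0 _ _ _ ep].
have -> : 2 * pi = 0 + pi + pi :> R by ring.
rewrite ep ep e0 scalerA -cisD; congr (cis _ *: _); ring.
Qed.
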